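(* Let $\mathbb{H}$ be a non-empty family of finite graphs, each with minimum degree at least $1$ and none isomorphic to a star, let $n$ be sufficiently large (depending on $\mathbb{H}$), let $G^*\in SPEX(n,\mathbb{H}_{minor})$, and let $L$ be the set of dominating vertices of $G^*$. If $\Gamma(\mathbb{H})$ is a connected family (every member of $\Gamma(\mathbb{H})$ is a connected graph), then $G^*-L\in EX(n-\gamma_\mathbb{H},\Gamma(\mathbb{H})_{minor})$.
   Context: All graphs are finite and simple; $|G|$ is the number of vertices of $G$ and $\rho(G)$ is its spectral radius (largest adjacency eigenvalue). A graph $H$ is a minor of $G$ if $H$ can be obtained from $G$ by a sequence of vertex deletions, edge deletions and edge contractions. For a graph family $\mathbb{F}$, $G$ is $\mathbb{F}$-minor-free if no member of $\mathbb{F}$ is a minor of $G$. $ex(m,\mathbb{F}_{minor})$ is the maximum number of edges in an $m$-vertex $\mathbb{F}$-minor-free graph, and $EX(m,\mathbb{F}_{minor})$ is the set of $m$-vertex $\mathbb{F}$-minor-free graphs attaining it. $SPEX(n,\mathbb{H}_{minor})$ is the set of $n$-vertex $\mathbb{H}$-minor-free graphs whose spectral radius is maximum among all $n$-vertex $\mathbb{H}$-minor-free graphs. $\alpha_H$ is the independence number of $H$; $\gamma_H=|H|-\alpha_H-1$ and $\gamma_\mathbb{H}=\min_{H\in\mathbb{H}}\gamma_H$ (which is at least $1$). $\Gamma_s(H)$ is the set of $s$-vertex induced subgraphs of $H$; a member $H[S]$ of $\Gamma_s(H)$ is irreducible if $\Gamma_s(H)$ contains no member isomorphic to a proper subgraph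 of $H[S]$; $\Gamma_s^*(H)$ is the set of irreducible members of $\Gamma_s(H)$; and $\Gamma(\mathbb{H})=\bigcup_{H\in\mathbb{H}}\Gamma^*_{|H|-\gamma_\mathbb{H}}(H)$. A dominating vertex is a vertex adjacent to all other vertices; for $n$ sufficiently large, $G^*$ has exactly $|L|=\gamma_\mathbb{H}$ dominating vertices. *)

(* Defs.v *)
From mathcomp Require Import all_boot all_order all_algebra.
From mathcomp Require Import boolp classical_sets reals.

Set Implicit Arguments.
Unset Strict Implicit.
Unset Printing Implicit Defensive.

Record sgraph := SGraph {
  vert :> finType;
  adj : rel vert;
  adj_sym : symmetric adj;
  adj_irr : irreflexive adj }.

Notation "x -- y" := (adj x y) (at level 30, no associativity).

Definition iso (G H : sgraph) : Prop :=
  exists2 f : G -> H, bijective f & forall x y, f x -- f y = x -- y.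

Definition edges (G : sgraph) : {set {set G}} :=
  [set e : {set G} | [exists x, exists y, (x -- y) && (e == [set x; y])]]%SET.

Definition degree (G : sgraph) (x : G) : nat := #|[set y | x -- y]%SET|.

(* The neutral element #|G| exceeds every degree; it only matters for the
   graph without vertices, whose minimum degree is thus 0. *)
Definition min_degree (G : sgraph) : nat :=
  \big[minn/#|G|]_(x : G) degree x.

Definition connected (G : sgraph) : Prop :=
  forall x y : G, connect (@adj G) x y.

Definition dominating (G : sgraph) : {set G} :=
  [set x : G | [forall y, (y != x) ==> x -- y]]%SET.

Section Star.
Variable t : nat.
Definition star_adj : rel 'I_t.+1 := [rel i j | (i == ord0) != (j == ord0)].
Lemma star_adj_sym : symmetric star_adj.
Proof. by move=> i j; rewrite /star_adj /= eq_sym. Qed.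
Lemma star_adj_irr : irreflexive star_adj.
Proof. by move=> i; rewrite /star_adj /= eqxx. Qed.
(* K_{1,t} *)
Definition star : sgraph := SGraph star_adj_sym star_adj_irr.
End Star.

Section Induced.
Variables (G : sgraph) (S : {set G}).
Definition induced_adj : rel {x : G | x \in S} :=
  [rel a b | val a -- val b].
Lemma induced_adj_sym : symmetric induced_adj.
Proof. by move=> a b; apply: adj_sym. Qed.
Lemma induced_adj_irr : irreflexive induced_adj.
Proof. by move=> a; apply: adj_irr. Qed.
Definition induced : sgraph := SGraph induced_adj_sym induced_adj_irr.
End Induced.

(* Same vertices as G; only the edges of G that belong to E are kept. *)
Section KeepEdges.
Variables (G : sgraph) (E : {set {set G}}).
Definition keep_adj : rel G := [rel x y | (x -- y) && ([set x; y]%SET \in E)].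
Lemma keep_adj_sym : symmetric keep_adj.
Proof. by move=> x y; rewrite /keep_adj /= adj_sym finset.setUC. Qed.
Lemma keep_adj_irr : irreflexive keep_adj.
Proof. by move=> x; rewrite /keep_adj /= adj_irr. Qed.
Definition keep_edges : sgraph := SGraph keep_adj_sym keep_adj_irr.
End KeepEdges.

(* Contraction of the edge xy: y is merged into x. *)
Section Contract.
Variables (G : sgraph) (x y : G).
Definition contract_adj : rel {z : G | z != y} :=
  [rel a b | (a != b) && [|| val a -- val b,
                             (val a == x) && (y -- val b)
                           | (val b == x) && (y -- val a)]].
Lemma contract_adj_sym : symmetric contract_adj.
Proof.
move=> a b; rewrite /contract_adj /= eq_sym (adj_sym (val a)).
by congr (_ && (_ || _)); rewrite orbC.
Qed.
Lemma contract_adj_irr : irreflexive contract_adj.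
Proof. by move=> a; rewrite /contract_adj /= eqxx. Qed.
Definition contract : sgraph := SGraph contract_adj_sym contract_adj_irr.
End Contract.

Definition del_vertex (G : sgraph) (v : G) : sgraph := induced [set~ v]%SET.

Definition del_edge (G : sgraph) (x y : G) : sgraph :=
  keep_edges (edges G :\ [set x; y])%SET.

Inductive minor (H : sgraph) : sgraph -> Prop :=
| minor_iso (G : sgraph) of iso H G : minor H G
| minor_del_vertex (G : sgraph) (v : G) of minor H (del_vertex v) : minor H G
| minor_del_edge (G : sgraph) (x y : G) of
    x -- y & minor H (del_edge x y) : minor H G
| minor_contract (G : sgraph) (x y : G) of
    x -- y & minor H (contract x y) : minor H G.

(* The subgraphs of G are the graphs [induced (G := keep_edges E) W]; such a
   subgraph is proper when it misses a vertex or an edge of G. *)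
Definition iso_proper_subgraph (K G : sgraph) : Prop :=
  exists (E : {set {set G}}) (W : {set keep_edges E}),
    iso K (induced W) /\ (W != [set: G]%SET \/ ~~ (edges G \subset E)).

Definition independent (G : sgraph) (S : {set G}) : bool :=
  [forall x in S, forall y in S, ~~ (x -- y)].

Definition independence_number (G : sgraph) : nat :=
  \max_(S : {set G} | independent S) #|S|.

(* Families are plain predicates: [set sgraph] would be universe-inconsistent. *)
Definition graph_family : Type := sgraph -> Prop.

Definition minor_free (F : graph_family) (G : sgraph) : Prop :=
  forall H, F H -> ~ minor H G.

Definition EX (m : nat) (F : graph_family) : graph_family := fun G =>
  [/\ #|G| = m, minor_free F G &
    forall G' : sgraph, #|G'| = m -> minor_free F G' ->
      #|edges G'| <= #|edges G|].

Definition adjmx (R : realType) (G : sgraph) : 'M[R]_#|G| :=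
  (\matrix_(i, j) (enum_val i -- enum_val j)%:R)%R.

(* An adjacency matrix is real symmetric, so when G has a vertex this set is
   finite and non-empty, and the supremum is the largest eigenvalue. *)
Definition spectral_radius (R : realType) (G : sgraph) : R :=
  sup [set a : R | eigenvalue (adjmx R G) a]%classic.

Definition SPEX (R : realType) (n : nat) (F : graph_family) : graph_family := fun G =>
  [/\ #|G| = n, minor_free F G &
    forall G' : sgraph, #|G'| = n -> minor_free F G' ->
      (spectral_radius R G' <= spectral_radius R G)%R].

(* |H| - alpha_H >= 1 as soon as H has an edge, so the subtractions do not
   truncate on the graphs of interest. *)
Definition gamma (H : sgraph) : nat := #|H| - independence_number H - 1.

(* The minimum of gamma over F, when F is non-empty. *)
Definition gamma_family (F : graph_family) : nat :=
  xget 0 [set g | (exists2 H, F H & gamma H = g) /\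
                  forall H, F H -> g <= gamma H]%classic.

Definition induced_subgraphs (s : nat) (H : sgraph) : graph_family := fun K =>
  exists2 S : {set H}, #|S| = s & K = induced S.

Definition irreducible_subgraphs (s : nat) (H : sgraph) : graph_family := fun K =>
  induced_subgraphs s H K /\
  forall K', induced_subgraphs s H K' -> ~ iso_proper_subgraph K' K.

Definition Gamma_family (F : graph_family) : graph_family := fun K =>
  exists2 H, F H & irreducible_subgraphs (#|H| - gamma_family F) H K.

(* Main.v *)
Require Import Defs.
From mathcomp Require Import all_boot all_order all_algebra.
From mathcomp Require Import boolp classical_sets reals.
From mathcomp Require Import zify ring lra.
From mathcomp Require Import fintype finset.

From mathcomp Require Import perm.

Set Implicit Arguments.
Unset Strict Implicit.
Unset Printing Implicit Defensive.

(** Write s for gamma_family HH, Gamma for Gamma_family HH, and rho for the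
    spectral radius of an extremal graph G on n vertices.

    Why G has exactly s dominating vertices. The join of s vertices with an
    independent set is HH-free, because members of HH have no vertex cover of
    size s; hence rho^2 >= s (n - s). Conversely G excludes a fixed complete
    graph, so all its subgraphs are sparse ([mader]), and s + 1 vertices have
    boundedly many common neighbours ([common_nbrs_bound]). Feeding this into
    the eigenvalue equation applied twice shows that exactly s entries of the
    Perron vector are close to its maximum, that the corresponding set L of
    vertices misses only a small fraction of the graph, and that every other
    entry is small ([principal_vertices]). Now compare G with the graph in which
    L becomes dominating, the vertices outside the common neighbourhood B of L
    are joined to L only, and, if L was not a clique, s vertices of B lose their
    edges inside B. Every pair gained involves a large entry and every edge lost
    joins small entries, so the Rayleigh quotient would increase unless nothing
    changes ([dominating_of_principal]). The s sacrificed vertices of B are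
    what makes the new graph HH-free: a Gamma-minor on the rest of B, together
    with L made into a clique through them, was already an HH-minor of G.

    Why G - L has the most edges. With L dominating, G is HH-free exactly when
    G - L is Gamma-free, and rho is monotone in the sum of the vector z solving
    lam z = lam 1 + A z for A the adjacency matrix of G - L and lam = rho. So
    G - L maximizes this sum among Gamma-free graphs ([extremal_walk_optimal]).
    For two graphs on the same vertices the sums differ by
    z2^T (A2 - A1) z1 / lam, and the entries of z tend to 1 as lam grows; hence
    no exchange of boundedly many edges can increase the number of edges
    ([walk_exchange_le]). Gamma consists of connected graphs, so disjoint unions
    of Gamma-free graphs are Gamma-free, and one of its members is contained in a
    star, so a connected set has boundedly many outside neighbours
    ([Gamma_star_bound]). It remains to turn a global defect into a local one.

    If some path is excluded or some Gamma-free graph has more edges than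
    vertices, components of an optimal graph are bounded: a long geodesic has
    few incident edges and could be traded for something denser
    ([bounded_components]). Two optimal graphs are then compared by cancelling
    blocks of components of equal total order
    ([arcs_eq_of_bounded_components]). Otherwise every component is a tree or
    unicyclic, and is covered by boundedly many paths
    ([path_covered_component]). Two missing edges are repaired by rearranging at
    most two components into one path ([not_two_deficient]). A single missing
    edge is repaired by rearranging boundedly many components into triangles
    and a bounded unicyclic rest. That changes many edges, but a disjoint union
    of triangles has the same z as one long cycle, and the cycle is reached by a
    bounded exchange ([not_one_deficient]). *)

(** * Minors as branch-set models *)

(** Paths for this relation never leave a branch set, so connectivity of branch
    sets can be expressed without induced subgraphs. *)
Definition class_adj (G H : sgraph) (f : G -> option H) : rel G :=
  [rel x y | (x -- y) && (f x == f y)].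

(** A model of the minor H: f sends a vertex to the branch set containing it,
    and to None when it is unused. *)
Definition model (H G : sgraph) (f : G -> option H) : Prop :=
  [/\ forall h, exists v, f v = Some h,
      forall u v h, f u = Some h -> f v = Some h -> connect (class_adj f) u v &
      forall h k, h -- k -> exists u v, [/\ f u = Some h, f v = Some k & u -- v]].

Definition has_model (H G : sgraph) : Prop := exists f : G -> option H, model f.

Definition embedding (G1 G2 : sgraph) (j : G1 -> G2) : Prop :=
  injective j /\ forall x y, x -- y -> j x -- j y.

Lemma class_adj_connect_sym (G H : sgraph) (f : G -> option H) :
  connect_sym (class_adj f).
Proof.
by apply: sym_connect_sym => x y; rewrite /class_adj /= adj_sym eq_sym.
Qed.

Lemma connect_map (T1 T2 : finType) (e1 : rel T1) (e2 : rel T2) (j : T1 -> T2) :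
  (forall x y, e1 x y -> connect e2 (j x) (j y)) ->
  forall x y, connect e1 x y -> connect e2 (j x) (j y).
Proof.
move=> he x y /connectP[p]; elim: p x => [|w p IHp] x /= => [_ -> //|].
case/andP=> exw pth /(IHp _ pth); exact/connect_trans/he.
Qed.

Lemma has_model_embedding (H G1 G2 : sgraph) (j : G1 -> G2) :
  embedding j -> has_model H G1 -> has_model H G2.
Proof.
move=> [jinj jhom] [f [fne fcon fadj]].
pose f' (u : G2) := obind f [pick w | j w == u].
have f'j w : f' (j w) = f w.
  rewrite /f'; case: pickP => [w' /eqP/jinj -> //|/(_ w)].
  by rewrite eqxx.
have f'E u h : f' u = Some h -> exists2 w, u = j w & f w = Some h.
  by rewrite /f'; case: pickP => [w /eqP <- /=|//]; exists w.
exists f'; split=> [h|u v h /f'E[u' -> fu] /f'E[v' -> fv]|h k /fadj].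
- by have [v fv] := fne h; exists (j v); rewrite f'j.
- apply: (connect_map (e1 := class_adj f)); last exact: fcon fu fv.
  move=> x y /andP[xy fxy]; apply: connect1.
  by rewrite /class_adj /= !f'j fxy jhom.
by case=> u [v [fu fv uv]]; exists (j u), (j v); rewrite !f'j; split=> //; apply: jhom.
Qed.

Lemma has_model_hom (K H G : sgraph) (g : K -> H) :
  bijective g -> (forall x y, x -- y -> g x -- g y) ->
  has_model H G -> has_model K G.
Proof.
case=> g' gK g'K ghom [f [fne fcon fadj]].
have E u k : omap g' (f u) = Some k -> f u = Some (g k).
  by case: (f u) => //= h [<-]; rewrite g'K.
exists (omap g' \o f); split=> [k|u v k /E fu /E fv|h k /ghom/fadj].
- by have [v fv] := fne (g k); exists v; rewrite /= fv /= gK.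
- apply: (connect_sub _ (fcon _ _ _ fu fv)) => x y /andP[xy /eqP fxy].
  by apply: connect1; rewrite /class_adj /= xy fxy eqxx.
by case=> u [v [fu fv uv]]; exists u, v; rewrite /= fu fv /= !gK.
Qed.

Lemma has_model_iso (H G : sgraph) : iso H G -> has_model H G.
Proof.
case=> g [g' gK g'K] gadj; exists (Some \o g'); split=> /=.
- by move=> h; exists (g h); rewrite gK.
- by move=> u v h [<-] [/(can_inj g'K) ->].
by move=> h k hk; exists (g h), (g k); rewrite !gK gadj.
Qed.

Lemma embedding_induced (G : sgraph) (S : {set G}) :
  embedding (val : induced S -> G).
Proof. by split=> //; apply: val_inj. Qed.

Lemma embedding_keep_edges (G : sgraph) (E : {set {set G}}) :
  embedding (id : keep_edges E -> G).
Proof. by split=> // x y /andP[]. Qed.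

Lemma card_induced (G : sgraph) (S : {set G}) : #|induced S| = #|S|.
Proof. by rewrite /= card_sig; apply: eq_card => x; rewrite inE. Qed.

Lemma card_contract (G : sgraph) (x y : G) : #|contract x y| = #|G|.-1.
Proof.
rewrite /= card_sig -(cardsC1 y); apply: eq_card => z; rewrite in_setC in_set1; exact: erefl.
Qed.

(** The branch set of x, if any, also receives y. *)
Lemma has_model_contract (H G : sgraph) (x y : G) :
  x -- y -> has_model H (contract x y) -> has_model H G.
Proof.
move=> xy [f [fne fcon fadj]].
have xny : x != y by apply: contraTneq xy => ->; rewrite adj_irr.
pose cx : contract x y := exist _ x xny.
pose c (z : G) : contract x y := insubd cx z.
have cK (a : contract x y) : c (val a) = a by apply: valKd.
have cy : c y = cx by rewrite /c /insubd insubF ?eqxx.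
have cE z : z != y -> val (c z) = z by move=> zy; rewrite insubdK.
have c2 z : connect (class_adj (f \o c)) z (val (c z)).
  have [->|zy] := eqVneq z y; last by rewrite cE.
  rewrite cy /=; apply: connect1; rewrite /class_adj /= adj_sym xy cy.
  by rewrite (cK cx) eqxx.
have step (a b : contract x y) : a -- b -> f a = f b ->
    connect (class_adj (f \o c)) (val a) (val b).
  rewrite /= /contract_adj /= => /andP[_ /or3P[ab|/andP[/eqP ax yb]|/andP[/eqP bx ya]]] fab.
  - by apply: connect1; rewrite /class_adj /= ab !cK fab /=.
  - apply: (@connect_trans _ _ y); apply: connect1; rewrite /class_adj /=.
      by rewrite ax xy cy (cK cx) /=.
    by rewrite yb cy cK -fab; apply/eqP; congr f; apply: val_inj.
  - apply: (@connect_trans _ _ y); apply: connect1; rewrite /class_adj /=.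
      by rewrite adj_sym ya cy cK fab; apply/eqP; congr f; apply: val_inj.
    by rewrite bx adj_sym xy cy (cK cx) /=.
exists (f \o c); split=> [h|u v h /= fu fv|h k /fadj].
- by have [v fv] := fne h; exists (val v); rewrite /= cK.
- apply: (connect_trans (c2 u)); rewrite class_adj_connect_sym.
  apply: (connect_trans (c2 v)).
  apply: (connect_map (e1 := class_adj f)); last exact: fcon fv fu.
  by move=> a b /andP[ab /eqP fab]; apply: step.
case=> a [b [fa fb]]; rewrite /= => /andP[_].
case/or3P=> [ab|/andP[/eqP ax yb]|/andP[/eqP bx ya]].
- by exists (val a), (val b); rewrite /= !cK.
- exists y, (val b); rewrite /= cK cy yb; split=> //.
  by rewrite -fa; congr f; apply: val_inj.
exists (val a), y; rewrite /= cK cy adj_sym ya; split=> //.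
by rewrite -fb; congr f; apply: val_inj.
Qed.

Lemma minor_has_model (H G : sgraph) : minor H G -> has_model H G.
Proof.
elim=> {G} [G /has_model_iso //|G v _|G x y _ _|G x y xy _].
- exact/has_model_embedding/embedding_induced.
- exact/has_model_embedding/embedding_keep_edges.
exact: has_model_contract.
Qed.

(** Serves both to discard unused vertices and to discard the branch sets that
    meet a given set of vertices. *)
Lemma model_restrict (H G : sgraph) (f : G -> option H) (S : {set H}) (U : {set G}) :
  model f -> (forall u h, h \in S -> f u = Some h -> u \in U) ->
  has_model (induced S) (induced U).
Proof.
case=> fne fcon fadj inU.
pose f' (u : induced U) : option (induced S) := obind insub (f (val u)).
have f'E u h : f' u = Some h -> f (val u) = Some (val h).
  by rewrite /f'; case: (f _) => //= k; case: insubP => //= k' _ <- [->].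
have Ef' u h : f (val u) = Some (val h) -> f' u = Some h.
  by rewrite /f' => -> /=; rewrite valK.
exists f'; split=> [h|u u' h /f'E fu /f'E fu'|h k /fadj].
- have [u fu] := fne (val h); exists (exist _ u (inU _ _ (valP h) fu)); exact: Ef'.
- have /connectP[p pth pl] := fcon _ _ _ fu fu'.
  elim: p u fu pth pl => [|w p IHp] u fu /=.
    by move=> _ E; rewrite (val_inj (E : val u' = val u)).
  case/andP=> /andP[uw /eqP fuw] pth pl.
  have fw : f w = Some (val h) by rewrite -fuw.
  pose w' : induced U := exist _ w (inU _ _ (valP h) fw).
  apply: (@connect_trans _ _ w'); last exact: IHp.
  by apply: connect1; rewrite /class_adj /= (Ef' _ h fu) (Ef' w' h fw) eqxx andbT.
case=> u [u' [fu fu' uu']].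
exists (exist _ u (inU _ _ (valP h) fu)), (exist _ u' (inU _ _ (valP k) fu')).
by split=> //; apply: Ef'.
Qed.

Lemma has_model_inducedT (H G : sgraph) : has_model (induced [set: H]) G -> has_model H G.
Proof.
apply: (@has_model_hom H (induced [set: H]) G (fun h => exist _ h (in_setT h))) => //.
by exists val => // h; apply: val_inj.
Qed.

Lemma model_restrict_dom (H G : sgraph) (f : G -> option H) (U : {set G}) :
  model f /\ (forall u h, f u = Some h -> u \in U) -> has_model H (induced U).
Proof.
by case=> mf inU; apply/has_model_inducedT/(model_restrict mf) => u h _; apply: inU.
Qed.

Definition arcs (G : sgraph) : nat := #|[set p : G * G | p.1 -- p.2]|.

Lemma edges_adj (G : sgraph) (x y : G) : ([set x; y] \in edges G) = x -- y.
Proof.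
apply/idP/idP; last first.
  by move=> xy; rewrite inE; apply/existsP; exists x; apply/existsP; exists y; rewrite xy eqxx.
rewrite inE => /existsP[a /existsP[b /andP[ab /eqP E]]].
have : a \in [set x; y] by rewrite E !inE eqxx.
have : b \in [set x; y] by rewrite E !inE eqxx orbT.
rewrite !inE => /orP[]/eqP Eb /orP[]/eqP Ea; subst; rewrite ?adj_irr // in ab *.
by rewrite adj_sym.
Qed.

(** The surplus edges of G are deleted one at a time. *)
Lemma minor_bij (H G : sgraph) (g : H -> G) :
  bijective g -> (forall x y, x -- y -> g x -- g y) -> minor H G.
Proof.
have [n] := ubnP (arcs G).
elim: n G g => // n IHn G g; rewrite ltnS => leGn gbij ghom.
have [[x [y [xy nxy]]]|noxy] := pselect (exists x y : H, g x -- g y /\ ~~ (x -- y)).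
  apply: (minor_del_edge (x := g x) (y := g y)) => //.
  have ginj := bij_inj gbij.
  have hom' a b : a -- b -> @adj (del_edge (g x) (g y)) (g a) (g b).
    move=> ab; rewrite /= /keep_adj /= ghom // !inE.
    have := edges_adj (g a) (g b); rewrite inE => ->; rewrite ghom // andbT.
    apply: contraNneq nxy => E.
    have : g a \in [set g x; g y] by rewrite -E !inE eqxx.
    have : g b \in [set g x; g y] by rewrite -E !inE eqxx orbT.
    rewrite !inE !(inj_eq ginj) => /orP[]/eqP Eb /orP[]/eqP Ea; subst; rewrite ?adj_irr // in ab *.
    by rewrite adj_sym.
  apply: (IHn (del_edge (g x) (g y)) g) => //; apply: leq_trans leGn.
  apply/proper_card/properP; split.
    by apply/subsetP=> p; rewrite !inE => /andP[].
  exists (g x, g y); first by rewrite inE.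
  by rewrite !inE /= /keep_adj /= !inE eqxx /= andbF.
apply: minor_iso; exists g => // x y; apply/idP/idP; last exact: ghom.
by move=> gxy; apply/negPn/negP=> nxy; case: noxy; exists x, y.
Qed.

(** Delete unused vertices and contract edges inside branch sets until every
    branch set is a single vertex. *)
Lemma has_model_minor (H G : sgraph) : has_model H G -> minor H G.
Proof.
have [n] := ubnP #|G|; elim: n G => // n IHn G; rewrite ltnS => leGn [f [fne fcon fadj]].
have [[v fv]|allS] := pselect (exists v, f v = None).
  apply: (minor_del_vertex (v := v)); apply: IHn.
    apply: leq_trans leGn; rewrite card_induced cardsC1.
    by rewrite prednK //; apply/card_gt0P; exists v.
  apply: (model_restrict_dom (f := f)); split=> // u h fu; rewrite !inE.
  by apply/eqP => E; rewrite E fv in fu.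
have [[x [y [xy fxy]]]|noxy] := pselect (exists x y, x -- y /\ f x = f y).
  have xny : x != y by apply: contraTneq xy => ->; rewrite adj_irr.
  apply: (minor_contract (x := x) (y := y)) => //; apply: IHn.
    apply: leq_trans leGn; rewrite card_contract.
    by rewrite prednK //; apply/card_gt0P; exists y.
  pose cx : contract x y := exist _ x xny.
  pose c (z : G) : contract x y := insubd cx z.
  have cK (a : contract x y) : c (val a) = a by apply: valKd.
  have cy : c y = cx by rewrite /c /insubd insubF ?eqxx.
  have cE z : z != y -> val (c z) = z by move=> zy; rewrite insubdK.
  have fc z : f (val (c z)) = f z.
    by have [->|/cE-> //] := eqVneq z y; rewrite cy.
  have cadj u v : u -- v -> c u != c v -> c u -- c v.
    move=> uv ncuv; rewrite /= /contract_adj /= ncuv /=.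
    have [uy|uy] := eqVneq u y.
      have vy : v != y by apply: contraNneq ncuv => ->; rewrite uy.
      by rewrite uy in uv *; rewrite cy /= eqxx (cE v) // uv orbT.
    have [vy|vy] := eqVneq v y.
      by rewrite vy in uv *; rewrite cy /= eqxx (cE u) // (adj_sym y u) uv !orbT.
    by rewrite !cE // uv.
  exists (f \o val); split=> [h|u u' h /= fu fu'|h k hk].
  - by have [u fu] := fne h; exists (c u); rewrite /= fc.
  - rewrite -(cK u) -(cK u').
    apply: (connect_map (e1 := class_adj f)); last exact: fcon fu fu'.
    move=> a b /andP[ab /eqP fab].
    have [-> //|ncab] := eqVneq (c a) (c b).
    by apply: connect1; rewrite /class_adj /= !fc fab eqxx andbT; apply: cadj.
  have [u [v [fu fv uv]]] := fadj _ _ hk.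
  exists (c u), (c v); rewrite /= !fc; split=> //; apply: cadj => //.
  apply: contraTneq hk => E; move: fu; rewrite -fc E fc fv => -[->].
  by rewrite adj_irr.
have fS u : f u by case E : (f u) => //; case: allS; exists u.
have finj : injective f.
  move=> u v fuv; case E : (f u) (fS u) => [h|//] _.
  have /connectP[[|w p] /= pth pl] := fcon u v h E (etrans (esym fuv) E); first by rewrite pl.
  by case/andP: pth => /andP[uw /eqP fuw]; case: noxy; exists u, w.
have /choice[f1 f1P] : forall u, exists h, f u = Some h.
  by move=> u; case: (f u) (fS u) => // h _; exists h.
have [g gP] := choice fne.
have fgK : cancel g f1 by move=> h; have := gP h; rewrite f1P => -[].
apply: (minor_bij (g := g)).
  by exists f1 => // u; apply: finj; rewrite gP f1P.
move=> h k /fadj[u [v [fu fv uv]]].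
by rewrite -(finj u (g h)) ?gP // -(finj v (g k)) ?gP.
Qed.

(** * Building and splitting models *)

(** The injection from S to D is given by its partial inverse: this is the shape
    of branch-set maps, and it exists even when T1 is empty. *)
Lemma partial_injection (T1 T2 : finType) (S : {set T1}) (D : {set T2}) :
  #|S| <= #|D| ->
  exists g : T2 -> option T1,
    [/\ forall d s, g d = Some s -> d \in D /\ s \in S,
        forall s, s \in S -> exists2 d, d \in D & g d = Some s,
        forall d d' s, g d = Some s -> g d' = Some s -> d = d' &
        #|S| = #|D| -> forall d, d \in D -> exists2 s, s \in S & g d = Some s].
Proof.
move=> leSD.
pose g d := if d \in D then onth (enum S) (index d (enum D)) else None.
have gD d s : g d = Some s -> [/\ d \in D, s \in S & index s (enum S) = index d (enum D)].
  rewrite /g; case: ifP => // dD os.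
  have := onthTE (enum S) (index d (enum D)); rewrite os /= => /esym lt_i.
  have E : nth s (enum S) (index d (enum D)) = s by apply: onth_nth.
  split=> //.
    by rewrite -mem_enum -E mem_nth.
  by rewrite -{1}E index_uniq ?enum_uniq.
exists g; split=> [d s /gD[]//|s sS|d d' s /gD[dD _ e] /gD[dD' _ e']|eSD d dD].
- have lts : index s (enum S) < size (enum D).
    by rewrite -cardE; apply: leq_trans leSD; rewrite cardE index_mem mem_enum.
  have [d0 _] : exists d : T2, d \in D.
    by apply/card_gt0P; rewrite cardE; apply: leq_ltn_trans lts.
  have dD : nth d0 (enum D) (index s (enum S)) \in D by rewrite -mem_enum mem_nth.
  exists (nth d0 (enum D) (index s (enum S))) => //.
  rewrite /g dD index_uniq ?enum_uniq // onthE (nth_map s) ?nth_index ?mem_enum //.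
  by rewrite index_mem mem_enum.
- rewrite e in e'.
  by rewrite -(nth_index d (s := enum D) (x := d)) ?mem_enum // e' nth_index ?mem_enum.
have lt_i : index d (enum D) < size (enum S) by rewrite -cardE eSD cardE index_mem mem_enum.
have := onthTE (enum S) (index d (enum D)); rewrite lt_i.
have gE : g d = onth (enum S) (index d (enum D)) by rewrite /g dD.
by rewrite -gE; case E : (g d) => [s|//] _; have [_ sS _] := gD _ _ E; exists s.
Qed.

Definition restr (G : sgraph) (P : {set G}) : rel G :=
  [rel x y | [&& x -- y, x \in P & y \in P]].

Definition connected_set (G : sgraph) (P : {set G}) : Prop :=
  forall u v, u \in P -> v \in P -> connect (restr P) u v.

Lemma subset_of_card (T : finType) (A : {set T}) n :
  n <= #|A| -> exists2 B : {set T}, B \subset A & #|B| = n.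
Proof.
elim: n => [|n IHn] leA; first by exists set0; rewrite ?sub0set ?cards0.
have [B sBA cB] := IHn (ltnW leA).
have /set0Pn[a] : A :\: B != set0.
  rewrite -cards_eq0 cardsD (setIidPr sBA) cB -lt0n; lia.
rewrite inE => /andP[anB aA]; exists (a |: B); last by rewrite cardsU1 anB cB.
by apply/subsetP => x; rewrite !inE => /orP[/eqP->|/(subsetP sBA)].
Qed.

(** At most s branch sets meet L, and all others survive in G - L. *)
Lemma model_avoid (H G : sgraph) (L : {set G}) s :
  has_model H G -> #|L| <= s -> s <= #|H| ->
  exists2 S : {set H}, #|S| = #|H| - s & has_model (induced S) (induced (~: L)).
Proof.
move=> [f mf] leLs les.
pose T := [set h : H | [exists l in L, f l == Some h]].
have leT : #|T| <= #|L|.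
  have sinj : injective (@Some H) by move=> ? ? [].
  pose F := [set f l | l in L].
  apply: (@leq_trans #|F|); last exact: leq_imset_card.
  rewrite -(card_imset _ sinj); apply: subset_leq_card; apply/subsetP => o.
  case/imsetP=> h; rewrite inE => /existsP[l /andP[lL /eqP fl]] ->.
  by apply/imsetP; exists l.
have [|S sST cS] := @subset_of_card H (~: T) (#|H| - s).
  by rewrite cardsCs setCK; apply: leq_sub2l; apply: leq_trans leLs.
exists S => //; apply: (model_restrict mf) => u h hS fu; rewrite inE.
apply/negP => uL; have := subsetP sST _ hS; rewrite !inE => /negP; apply.
by apply/existsP; exists u; rewrite uL fu eqxx.
Qed.

(** The vertices of H outside S become branch sets around the vertices of L; r
    tells which vertices they absorb in order to be pairwise adjacent. *)
Lemma model_join (H G : sgraph) (S : {set H}) (L B : {set G}) (r : G -> option G) :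
  #|~: S| = #|L| ->
  (forall l, l \in L -> r l = Some l) ->
  (forall u l, r u = Some l -> l \in L /\ (u = l \/ u -- l)) ->
  (forall u, u \in B -> r u = None) ->
  (forall l l', l \in L -> l' \in L -> l != l' ->
     exists u u', [/\ r u = Some l, r u' = Some l' & u -- u']) ->
  (forall l b, l \in L -> b \in B -> l -- b) ->
  has_model (induced S) (induced B) -> has_model H G.
Proof.
move=> cSL rL rE rB rclique join [f1 [f1ne f1con f1adj]].
have [p [pE pS pinj pL]] := partial_injection (eq_leq cSL).
have {}pL := pL cSL.
pose f (u : G) : option H :=
  if r u is Some l then p l else omap val (obind f1 (insub u : option (induced B))).
have fr u l : r u = Some l -> f u = p l by rewrite /f => ->.
have fB (b : induced B) : f (val b) = omap val (f1 b).
  by rewrite /f rB ?(valP b) //; rewrite valK.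
have fE u h : f u = Some h ->
    (exists l, [/\ h \notin S, l \in L, r u = Some l & p l = Some h]) \/
    (exists2 b : induced B, u = val b & exists2 hS, f1 b = Some hS & h = val hS).
  rewrite /f; case E : (r u) => [l|].
    move=> pl; left; exists l; split=> //; first by have [_] := pE _ _ pl; rewrite inE.
    by have [] := rE _ _ E.
  case: insubP => [b _ <-|//] /=; case E1: (f1 b) => [hS|//] /= [<-].
  by right; exists b => //; exists hS.
have cc u l : r u = Some l -> connect (class_adj f) u l.
  move=> ru; have [lL [->//|ul]] := rE _ _ ru.
  by apply: connect1; rewrite /class_adj /= ul (fr _ _ ru) (fr _ _ (rL _ lL)) eqxx.
exists f; split=> [h|u v h fu fv|h k hk].
- have [hS|hS] := boolP (h \in S).
    by have [b fb] := f1ne (exist _ h hS); exists (val b); rewrite fB fb.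
  have /pS[l lL pl] : h \in ~: S by rewrite inE.
  by exists l; rewrite (fr _ _ (rL _ lL)).
- case: (fE _ _ fu) (fE _ _ fv) => [[l [hS lL ru pl]]|[b -> [hS fb hE]]].
    case=> [[l' [_ lL' rv pl']]|[b _ [hS' _ hE]]]; last by rewrite hE (valP hS') in hS.
    rewrite -(pinj _ _ _ pl pl') in rv.
    by apply: (connect_trans (cc _ _ ru)); rewrite class_adj_connect_sym; apply: cc.
  case=> [[l' [hnS _ _ _]]|[b' -> [hS' fb' hE']]]; first by rewrite hE (valP hS) in hnS.
  apply: (connect_map (e1 := class_adj f1)); last first.
    by apply: f1con fb _; rewrite fb'; congr Some; apply: val_inj; rewrite -hE.
  move=> x y /andP[xy /eqP fxy]; apply: connect1.
  by rewrite /class_adj /= !fB fxy eqxx andbT.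
have bS h' (hS : h' \in S) : exists2 b, b \in B & f b = Some h'.
  by have [b fb] := f1ne (exist _ h' hS); exists (val b); rewrite ?(valP b) // fB fb.
have bL h' (hS : h' \notin S) : exists l, [/\ l \in L, r l = Some l & p l = Some h'].
  have /pS[l lL pl] : h' \in ~: S by rewrite inE.
  by exists l; split=> //; apply: rL.
have [hS|hS] := boolP (h \in S); have [kS|kS] := boolP (k \in S).
- have [b [b' [fb fb' bb']]] := f1adj (exist _ h hS) (exist _ k kS) hk.
  by exists (val b), (val b'); rewrite !fB fb fb'.
- have [b bB fb] := bS _ hS; have [l [lL rl pl]] := bL _ kS.
  by exists b, l; rewrite (fr _ _ rl) adj_sym join.
- have [b bB fb] := bS _ kS; have [l [lL rl pl]] := bL _ hS.
  by exists l, b; rewrite (fr _ _ rl) join.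
have [l [lL rl pl]] := bL _ hS; have [l' [lL' rl' pl']] := bL _ kS.
have [|u [u' [ru ru' uu']]] := rclique l l' lL lL'.
  apply: contraTneq hk => E; move: pl; rewrite E pl' => -[->]; by rewrite adj_irr.
by exists u, u'; rewrite (fr _ _ ru) (fr _ _ ru').
Qed.

Lemma model_join_clique (H G : sgraph) (S : {set H}) (L B : {set G}) :
  #|~: S| = #|L| -> [disjoint L & B] ->
  (forall l l', l \in L -> l' \in L -> l != l' -> l -- l') ->
  (forall l b, l \in L -> b \in B -> l -- b) ->
  has_model (induced S) (induced B) -> has_model H G.
Proof.
move=> cSL dis cl join; pose r u := if u \in L then Some u else None.
have rL l : l \in L -> r l = Some l by rewrite /r => ->.
apply: (@model_join _ _ _ L B r) => //.
- by move=> u l; rewrite /r; case: ifP => // uL [<-]; split=> //; left.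
- by move=> u uB; rewrite /r (disjointFl dis uB).
- by move=> l l' lL lL' ll'; exists l, l'; rewrite !rL // cl.
Qed.

(** Merging each vertex of L with a private common neighbour of L turns L into
    a clique. *)
Lemma model_join_spare (H G : sgraph) (S : {set H}) (L B Q : {set G}) :
  #|~: S| = #|L| -> [disjoint L & B] -> [disjoint Q & B] -> [disjoint L & Q] ->
  #|L| <= #|Q| ->
  (forall l q, l \in L -> q \in Q -> l -- q) ->
  (forall l b, l \in L -> b \in B -> l -- b) ->
  has_model (induced S) (induced B) -> has_model H G.
Proof.
move=> cSL dLB dQB dLQ leLQ jQ join.
have [g [gE gL ginj _]] := partial_injection leLQ.
pose r u := if u \in L then Some u else g u.
have rL l : l \in L -> r l = Some l by rewrite /r => ->.
apply: (@model_join _ _ _ L B r) => //.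
- move=> u l; rewrite /r; case: ifP => [uL [<-]|uL /gE[uQ lL]]; split=> //; first by left.
  by right; rewrite adj_sym jQ.
- move=> u uB; rewrite /r (disjointFl dLB uB).
  by case E : (g u) => [l|//]; have [uQ _] := gE _ _ E; rewrite (disjointFr dQB uQ) in uB.
- move=> l l' lL lL' _; have [q qQ gq] := gL _ lL'.
  exists l, q; rewrite rL // jQ //; split=> //.
  by rewrite /r (disjointFl dLQ qQ).
Qed.

Lemma model_edgeless (H G : sgraph) :
  #|H| <= #|G| -> (forall x y : H, ~~ (x -- y)) -> has_model H G.
Proof.
rewrite -(cardsT H) -(cardsT G) => le noadj.
have [g [gE gS ginj _]] := partial_injection le.
exists g; split=> [h|u v h gu gv|h k hk]; last by have := noadj h k; rewrite hk.
  by have [d _ gd] := gS h (in_setT _); exists d.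
by rewrite (ginj _ _ _ gu gv).
Qed.

(** P is contracted to the centre. *)
Lemma model_star (H G : sgraph) (c : H) (P D : {set G}) :
  (forall x y : H, x -- y -> x = c \/ y = c) ->
  P != set0 -> connected_set P -> [disjoint P & D] ->
  (forall d, d \in D -> exists2 p, p \in P & p -- d) ->
  #|H| <= #|D|.+1 -> has_model H G.
Proof.
move=> cE /set0Pn[p0 p0P] conP dis DP leH.
have [|g [gE gS ginj _]] := @partial_injection H G [set~ c] D.
  by rewrite cardsC1; lia.
pose f u := if u \in P then Some c else g u.
have fP u : u \in P -> f u = Some c by rewrite /f => ->.
have fD u h : f u = Some h -> h != c -> u \in D /\ g u = Some h.
  rewrite /f; case: ifP => [_ [->]|_ gu _]; first by rewrite eqxx.
  by have [] := gE _ _ gu.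
have fc u : f u = Some c -> u \in P.
  rewrite /f; case: ifP => // _ gu.
  by have [_] := gE _ _ gu; rewrite !inE eqxx.
have gf d h : g d = Some h -> f d = Some h.
  by move=> gd; have [dD _] := gE _ _ gd; rewrite /f (disjointFl dis dD).
have hD h : h != c -> exists2 d, d \in D & f d = Some h.
  by move=> hc; have [|d dD gd] := gS h; rewrite ?inE //; exists d; rewrite ?(gf _ _ gd).
exists f; split=> [h|u v h fu fv|h k hk].
- have [->|/hD[d _ fd]] := eqVneq h c; last by exists d.
  by exists p0; rewrite fP.
- have [E|hc] := eqVneq h c.
    rewrite E in fu fv; have := conP _ _ (fc _ fu) (fc _ fv).
    apply: connect_sub => x y /and3P[xy xP yP]; apply: connect1.
    by rewrite /class_adj /= xy !fP // eqxx.
  have [_ gu] := fD _ _ fu hc; have [_ gv] := fD _ _ fv hc.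
  by rewrite (ginj _ _ _ gu gv).
have hkc : h != k by apply: contraTneq hk => ->; rewrite adj_irr.
case: (cE _ _ hk) => E; subst.
  have [|d dD fd] := hD k; first by rewrite eq_sym.
  by have [p pP pd] := DP _ dD; exists p, d; rewrite (fP p).
have [d dD fd] := hD _ hkc; have [p pP pd] := DP _ dD.
by exists d, p; rewrite (fP p) // adj_sym.
Qed.

(** Adjacent branch sets lie on the same side, so the connectedness of K keeps
    the whole model on one side. *)
Lemma model_closed_side (K G : sgraph) (U : {set G}) :
  connected K -> 0 < #|K| -> (forall x y, x \in U -> x -- y -> y \in U) ->
  has_model K G -> has_model K (induced U) \/ has_model K (induced (~: U)).
Proof.
move=> conK /card_gt0P[k0 _] closU [f mf].
have [fne fcon fadj] := mf; have [v0 fv0] := fne k0.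
have key (A : {set G}) : (forall x y, x \in A -> x -- y -> y \in A) -> v0 \in A ->
    has_model K (induced A).
  move=> closA v0A; apply: (model_restrict_dom (f := f)); split=> // u h fu.
  have inA x y : connect (class_adj f) x y -> x \in A -> y \in A.
    case/connectP=> p; elim: p x => [|w p IHp] x /= => [_ -> //|].
    by case/andP=> /andP[xw _] pth yl xA; apply: (IHp w) => //; apply: closA xw.
  have /connectP[p pth hl] := conK k0 h.
  have all0 v : f v = Some k0 -> v \in A by move=> fv; apply: inA (fcon _ _ _ fv0 fv) v0A.
  elim: p (k0) all0 pth hl => [|k p IHp] k1 all1 /=; first by move=> _ E; apply: all1; rewrite -E.
  case/andP=> /fadj[x [y [fx fy xy]]] pth hl; apply: (IHp k) => // v fv.
  by apply: inA (fcon _ _ _ fy fv) _; apply: closA xy; apply: all1.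
have [v0U|v0U] := boolP (v0 \in U); [left|right]; apply: key; rewrite ?inE //.
move=> x y; rewrite !inE => xU xy; apply: contra xU => yU.
by apply: closU yU _; rewrite adj_sym.
Qed.

(** * The forbidden families HH and Gamma(HH) *)

Lemma minor_freeP (F : graph_family) (G : sgraph) :
  minor_free F G <-> (forall H, F H -> ~ has_model H G).
Proof.
by split=> free H FH m; apply: (free H FH); [apply: has_model_minor|apply: minor_has_model].
Qed.

Lemma gamma_familyP (F : graph_family) : (exists H, F H) ->
  (exists2 H, F H & gamma H = gamma_family F) /\
  (forall H, F H -> gamma_family F <= gamma H).
Proof.
move=> [H0 FH0].
have [n [Pn nmin]] : exists n, (exists2 H, F H & gamma H = n) /\
    forall H, F H -> n <= gamma H.
  have [m] := ubnP (gamma H0); elim: m H0 FH0 => // m IHm H FH; rewrite ltnS => leH.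
  have [[H' FH' lt']|no] := pselect (exists2 H', F H' & gamma H' < gamma H).
    exact: (IHm H' FH' (leq_trans lt' leH)).
  exists (gamma H); split; first by exists H.
  by move=> H' FH'; rewrite leqNgt; apply/negP=> lt'; apply: no; exists H'.
have := @xgetPex _ 0 [set g | (exists2 H, F H & gamma H = g) /\
                  forall H, F H -> g <= gamma H]%classic.
by case=> [|A B]; [exists n; split|split].
Qed.

Lemma min_degree_le (G : sgraph) : min_degree G <= #|G| /\ forall x : G, min_degree G <= degree x.
Proof.
rewrite /min_degree; split; first by elim/big_rec: _ => // x m _ le; rewrite geq_min le orbT.
move=> x; have := mem_index_enum x; elim: (index_enum G) => // y r IHr.
rewrite inE big_cons geq_min => /orP[/eqP <-|/IHr ->]; last by rewrite orbT.
by rewrite leqnn.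
Qed.

Lemma independentP (G : sgraph) (S : {set G}) :
  reflect (forall x y, x \in S -> y \in S -> ~~ (x -- y)) (independent S).
Proof.
apply: (iffP idP) => [/forallP h x y xS yS|h].
  by have /implyP/(_ xS)/forallP/(_ y)/implyP/(_ yS) := h x.
by apply/forallP=> x; apply/implyP=> xS; apply/forallP=> y; apply/implyP=> yS; apply: h.
Qed.

Lemma independence_number_max (G : sgraph) :
  exists2 S : {set G}, independent S & #|S| = independence_number G.
Proof.
have i0 : independent (set0 : {set G}) by apply/independentP=> x y; rewrite inE.
have [|S iS E] := eq_bigmax_cond (fun S : {set G} => #|S|) (A := @independent G).
  by apply/card_gt0P; exists set0.
by exists S; rewrite // -E; apply: eq_bigl.
Qed.

(** If at most one vertex c were outside a maximum independent set, every other
    vertex would be adjacent to c and to nothing else, which makes H a star. *)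
Lemma independence_number_lt (H : sgraph) :
  1 <= min_degree H -> (forall t, ~ iso H (star t)) -> independence_number H + 2 <= #|H|.
Proof.
move=> deg1 nstar; have [S /independentP iS <-] := independence_number_max H.
have [mG mx] := min_degree_le H.
have nbr (x : H) : exists y, x -- y.
  have : 0 < degree x by exact: leq_trans deg1 (mx x).
  by case/card_gt0P=> y; rewrite inE => xy; exists y.
rewrite leqNgt; apply/negP => lt2.
have [c cS] : exists c, c \notin S.
  have /card_gt0P[x _] : 0 < #|H| by exact: leq_trans deg1 mG.
  have [y xy] := nbr x; have [xS|xS] := boolP (x \in S); last by exists x.
  by exists y; apply: contraTN xy => yS; apply: iS.
have inS x : x != c -> x \in S.
  move=> xc; apply: contraTT lt2 => xS; rewrite -leqNgt.
  have : #|[set x; c] :|: S| <= #|H| by apply: max_card.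
  rewrite -setUA cardsU1 cardsU1 !inE negb_or xc xS cS; lia.
have cadj x : x != c -> x -- c.
  move=> xc; have [y xy] := nbr x; have [<- //|yc] := eqVneq y c.
  by have := iS _ _ (inS _ xc) (inS _ yc); rewrite xy.
have [t Ht] : exists t, #|H| = t.+1 by exists #|H|.-1; rewrite prednK //; apply: leq_trans mG.
pose e (x : H) : 'I_t.+1 := cast_ord Ht (enum_rank x).
have ebij : bijective e.
  by exists (fun i => enum_val (cast_ord (esym Ht) i)) => x;
    rewrite /e ?cast_ordK ?enum_rankK // enum_valK cast_ordKV.
apply: (nstar t); exists (tperm (e c) ord0 \o e).
  by apply: bij_comp => //; exists (tperm (e c) ord0) => x; rewrite tpermK.
have f0 x : (tperm (e c) ord0 (e x) == ord0) = (x == c).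
  by rewrite -[X in _ == X](tpermL (e c)) (inj_eq perm_inj) (inj_eq (bij_inj ebij)).
move=> x y; rewrite /= /star_adj /= !f0.
have [->|xc] := eqVneq x c; have [->|yc] := eqVneq y c => //=.
- by rewrite adj_irr.
- by rewrite adj_sym cadj.
- by rewrite cadj.
by apply/esym/negbTE; apply: iS; apply: inS.
Qed.

Lemma gamma_independence (H : sgraph) : independence_number H + 2 <= #|H| ->
  gamma H + independence_number H + 1 = #|H|.
Proof. rewrite /gamma; lia. Qed.

Lemma arcs_embedding_lt (G1 G2 : sgraph) (j : G1 -> G2) x y :
  embedding j -> x -- y -> (forall a b, a -- b -> (j a, j b) != (x, y)) -> arcs G1 < arcs G2.
Proof.
case=> jinj jhom xy nxy; rewrite /arcs.
pose jj (p : G1 * G1) := (j p.1, j p.2).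
have jjinj : injective jj by move=> [a b] [a' b'] [/jinj E1 /jinj E2]; rewrite E1 E2.
rewrite -(card_imset _ jjinj); apply/proper_card/properP; split.
  by apply/subsetP=> q /imsetP[p]; rewrite inE => hp ->; rewrite inE; apply: jhom.
exists (x, y); rewrite ?inE //; apply/imsetP=> -[[a b]]; rewrite inE => /nxy/eqP nab E.
by apply: nab.
Qed.

(** Descent: a graph that is not irreducible can be replaced by an induced
    subgraph of the same order with fewer edges that still embeds in H[S]. *)
Lemma irreducible_below (H : sgraph) (S : {set H}) :
  exists K, irreducible_subgraphs #|S| H K /\
    exists2 g : K -> induced S, bijective g & forall x y, x -- y -> g x -- g y.
Proof.
suff: forall K, induced_subgraphs #|S| H K ->
    (exists2 g : K -> induced S, bijective g & forall x y, x -- y -> g x -- g y) ->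
    exists K, irreducible_subgraphs #|S| H K /\
    exists2 g : K -> induced S, bijective g & forall x y, x -- y -> g x -- g y.
  by apply; [exists S|exists id => //; exists id].
move=> K; have [n] := ubnP (arcs K); elim: n K => // n IHn K.
rewrite ltnS => leK iK [g gbij ghom].
have [irr|] := pselect (forall K', induced_subgraphs #|S| H K' -> ~ iso_proper_subgraph K' K).
  by exists K; split; [split|exists g].
move=> /existsNP[K' /not_implyP[iK' /contrapT[E [W [[f fbij fadj] proper]]]]].
have cK : #|K| = #|S| by case: iK => A cA ->; rewrite card_induced.
have cK' : #|K'| = #|S| by case: iK' => A cA ->; rewrite card_induced.
have cW : #|W| = #|K| by rewrite -(card_induced (G := keep_edges E)) -(bij_eq_card fbij) cK cK'.
have WT : W = [set: keep_edges E] by apply/eqP; rewrite eqEcard subsetT cW cardsT leqnn.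
case: proper => [|/subsetPn[ed]]; first by rewrite WT eqxx.
rewrite inE => /existsP[x /existsP[y /andP[xy /eqP ->]]] nE.
pose j (k : K') : K := val (f k).
have jinj : injective j by move=> a b /val_inj/(bij_inj fbij).
have jadj a b : a -- b -> j a -- j b /\ [set j a; j b] \in E.
  by rewrite -fadj /= /induced_adj /= /keep_adj /= => /andP.
have jbij : bijective j.
  by apply: inj_card_bij jinj _; rewrite cK cK'.
apply: (IHn K') => //.
  apply: leq_trans leK; apply: (@arcs_embedding_lt _ _ j x y _ xy).
    by split=> // a b /jadj[].
  by move=> a b /jadj[_ abE]; apply: contraNneq nE => -[<- <-].
exists (g \o j); first exact: bij_comp.
by move=> a b /jadj[ab _]; apply: ghom.
Qed.

Definition common_nbrs (G : sgraph) (L : {set G}) : {set G} :=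
  [set v | [forall l in L, l -- v]].

Lemma common_nbrsP (G : sgraph) (L : {set G}) v :
  reflect (forall l, l \in L -> l -- v) (v \in common_nbrs L).
Proof.
rewrite inE; apply: (iffP forallP) => [h l lL|h l]; first by have /implyP := h l; apply.
by apply/implyP; apply: h.
Qed.

Lemma common_nbrs_disjoint (G : sgraph) (L : {set G}) : [disjoint L & common_nbrs L].
Proof.
rewrite disjoint_subset; apply/subsetP=> l lL; rewrite inE; apply/negP=> /common_nbrsP/(_ _ lL).
by rewrite adj_irr.
Qed.

Section Families.
Variable HH : graph_family.
Hypothesis HH_ex : exists H, HH H.
Hypothesis HH_deg : forall H, HH H -> 1 <= min_degree H.
Hypothesis HH_star : forall H, HH H -> forall t : nat, ~ iso H (star t).

Let s := gamma_family HH.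

Lemma gamma_family_gt0 : 0 < s.
Proof.
have [[H HHH gH] _] := gamma_familyP HH_ex; rewrite /s -gH.
by have := independence_number_lt (HH_deg HHH) (HH_star HHH); rewrite /gamma; lia.
Qed.

Lemma gamma_family_card H : HH H -> s + 2 <= #|H|.
Proof.
move=> HHH; have [_ /(_ _ HHH)] := gamma_familyP HH_ex; rewrite -/s.
have := independence_number_lt (HH_deg HHH) (HH_star HHH).
have: 0 < independence_number H; last by rewrite /gamma; lia.
have [_ mx] := min_degree_le H.
have /card_gt0P[x _] : 0 < #|H| by apply: leq_trans (HH_deg HHH) _; have [] := min_degree_le H.
rewrite -(cards1 x); apply: (leq_bigmax_cond (F := fun S : {set H} => #|S|)).
by apply/independentP=> a b; rewrite !inE => /eqP-> /eqP->; rewrite adj_irr.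
Qed.

Lemma Gamma_family_card K : Gamma_family HH K -> 1 < #|K|.
Proof.
move=> [H HHH [[S cS ->] _]]; rewrite card_induced cS -/s.
by have := gamma_family_card HHH; lia.
Qed.

(** A model of H loses at most gamma branch sets when L is deleted, and below what
    is left there is a member of Gamma. *)
Lemma HH_free_of_Gamma_free (G : sgraph) (L : {set G}) : #|L| <= s ->
  minor_free (Gamma_family HH) (induced (~: L)) -> minor_free HH G.
Proof.
move=> leL /minor_freeP free; apply/minor_freeP=> H HHH mH.
have les : s <= #|H| by have := gamma_family_card HHH; lia.
have [S cS mS] := model_avoid mH leL les.
have [K [irr [g gbij ghom]]] := irreducible_below S.
apply: (free K); last exact: has_model_hom gbij ghom mS.
by exists H => //; rewrite -cS.
Qed.

(** Vertices joined to all of B supply the gamma vertices of H that a member of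
    Gamma lacks; they form a clique, or are made into one by spare vertices. *)
Lemma Gamma_free_join (G : sgraph) (L B : {set G}) : #|L| = s -> [disjoint L & B] ->
  (forall l b, l \in L -> b \in B -> l -- b) ->
  (forall l l', l \in L -> l' \in L -> l != l' -> l -- l') \/
  (exists Q : {set G}, [/\ [disjoint Q & B], [disjoint L & Q], #|L| <= #|Q| &
      forall l q, l \in L -> q \in Q -> l -- q]) ->
  minor_free HH G -> minor_free (Gamma_family HH) (induced B).
Proof.
move=> cL dLB join cl /minor_freeP free; apply/minor_freeP=> K [H HHH [[S cS ->] _]] mK.
apply: (free H HHH).
have cSL : #|~: S| = #|L|.
  by rewrite cardsCs setCK cS cL -/s subKn //; have := gamma_family_card HHH; lia.
case: cl => [cl|[Q [dQB dLQ leLQ jQ]]]; first exact: model_join_clique cSL dLB cl join mK.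
exact: model_join_spare cSL dLB dQB dLQ leLQ jQ join mK.
Qed.

(** A member of HH attaining gamma has a vertex cover of gamma + 1 vertices, and
    its other vertices can be placed on common neighbours. *)
Lemma common_nbrs_bound : exists N', forall G : sgraph, minor_free HH G ->
  forall L : {set G}, s < #|L| -> #|common_nbrs L| < N'.
Proof.
have [[H HHH gH] _] := gamma_familyP HH_ex.
have gi := gamma_independence (independence_number_lt (HH_deg HHH) (HH_star HHH)).
have [I /independentP iI cI] := independence_number_max H; rewrite -cI gH -/s in gi.
exists (#|I| + (s + 1)) => G /minor_freeP free L0 ltL0; rewrite ltnNge; apply/negP=> le0.
have [L sL cL] := subset_of_card ltL0.
have {le0} le : #|I| + (s + 1) <= #|common_nbrs L|.
  apply: leq_trans le0 _; apply/subset_leq_card/subsetP=> v /common_nbrsP h.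
  by apply/common_nbrsP=> l lL; apply: h; apply: (subsetP sL).
apply: (free H HHH).
have [|B sB cB] := @subset_of_card _ (common_nbrs L) #|I|.
  by apply: leq_trans le; apply: leq_addr.
have dL := common_nbrs_disjoint L.
apply: (@model_join_spare H G I L B (common_nbrs L :\: B)).
- by rewrite cardsCs setCK cL; lia.
- by apply: disjointWr dL.
- by rewrite -setI_eq0 setIDAC -setIDA setDv setI0.
- by apply: disjointWr dL; apply: subsetDl.
- by rewrite cardsD (setIidPr sB) cB cL; lia.
- by move=> l q lL; rewrite inE => /andP[_ /common_nbrsP]; apply.
- by move=> l b lL /(subsetP sB) /common_nbrsP; apply.
apply: model_edgeless; first by rewrite !card_induced cB.
by move=> x y; apply: iI; apply: valP.
Qed.

(** In a member of HH attaining gamma, a maximum independent set I and one vertex c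
    outside it span a subgraph of a star, and a member of Gamma lies below it. *)
Lemma Gamma_star_bound : exists t, forall G : sgraph, minor_free (Gamma_family HH) G ->
  forall P D : {set G}, P != set0 -> connected_set P -> [disjoint P & D] ->
    (forall d, d \in D -> exists2 p, p \in P & p -- d) -> #|D| < t.
Proof.
have [[H HHH gH] _] := gamma_familyP HH_ex.
have ltH := independence_number_lt (HH_deg HHH) (HH_star HHH).
have gi := gamma_independence ltH.
have [I /independentP iI cI] := independence_number_max H; rewrite -cI gH -/s in gi ltH.
have [c cnI] : exists c, c \notin I.
  have /set0Pn[c] : ~: I != set0 by rewrite -cards_eq0 cardsCs setCK; lia.
  by rewrite inE => cI'; exists c.
exists #|I| => G /minor_freeP free P D P0 conP dPD DP; rewrite ltnNge; apply/negP=> le.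
have cS : #|c |: I| = #|H| - s by rewrite cardsU1 cnI; lia.
have [K [irr [g gbij ghom]]] := irreducible_below (c |: I).
apply: (free K); first by exists H => //; rewrite -cS.
apply: has_model_hom gbij ghom _.
pose c' : induced (c |: I) := exist _ c (setU11 c I).
apply: (@model_star _ _ c' P D) => //; last by rewrite card_induced cardsU1 cnI.
move=> x y xy.
have cE (z : induced (c |: I)) : z <> c' -> val z \in I.
  move=> zc; have := valP z; rewrite !inE => /orP[/eqP E|//].
  by case: zc; apply: val_inj.
have [->|xc] := pselect (x = c'); [by left|right].
have [//|yc] := pselect (y = c').
by have := iI _ _ (cE _ xc) (cE _ yc); rewrite (xy : val x -- val y).
Qed.

End Families.

(** * Counting arcs; minor-closed classes are sparse *)

Definition nbr (G : sgraph) (x : G) : {set G} := [set y | x -- y].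

Definition arcs_between (G : sgraph) (A B : {set G}) : nat :=
  #|[set p : G * G | [&& p.1 -- p.2, p.1 \in A & p.2 \in B]]|.

Lemma arcs_betweenE (G : sgraph) (A B : {set G}) :
  arcs_between A B = \sum_(x in A) #|nbr x :&: B|.
Proof.
rewrite /arcs_between -sum1_card.
rewrite (partition_big (fun p : G * G => p.1) (mem A)) => [|p]; last first.
  by rewrite inE => /and3P[].
apply: eq_bigr => x xA; rewrite sum1_card.
rewrite -(card_imset (nbr x :&: B) (f := pair x)); last by move=> ? ? [].
apply: eq_card => -[a b]; rewrite -[LHS]topredE /= inE /=; apply/idP/imsetP.
  case/andP=> /and3P[ab aA bB] /eqP E; exists b; rewrite -?E //.
  by rewrite !inE ab.
by case=> c; rewrite !inE => /andP[xc cB] [-> ->]; rewrite xc (xA : x \in A) cB eqxx.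
Qed.

Lemma arcs_betweenC (G : sgraph) (A B : {set G}) : arcs_between A B = arcs_between B A.
Proof.
have sw : injective (fun p : G * G => (p.2, p.1)) by move=> [a b] [c d] [-> ->].
rewrite /arcs_between -(card_imset _ sw); apply: eq_card => -[a b]; rewrite !inE /=.
apply/imsetP/and3P.
  by case=> -[c d]; rewrite inE /= => /and3P[cd cA dB] [-> ->]; rewrite adj_sym.
case=> ab aB bA; exists (b, a) => //; by rewrite inE /= adj_sym ab bA aB.
Qed.

Lemma arcs_betweenS (G : sgraph) (A B A' B' : {set G}) :
  A \subset A' -> B \subset B' -> arcs_between A B <= arcs_between A' B'.
Proof.
move=> /subsetP sA /subsetP sB; apply/subset_leq_card/subsetP => p; rewrite !inE.
by case/and3P=> -> /sA -> /sB ->.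
Qed.

Lemma arcsT (G : sgraph) : arcs G = arcs_between [set: G] [set: G].
Proof. by apply: eq_card => p; rewrite !inE !andbT. Qed.

Lemma arcs_sum (G : sgraph) : arcs G = \sum_(x : G) #|nbr x|.
Proof.
rewrite arcsT arcs_betweenE; apply: eq_big => [x|x _]; rewrite ?inE //.
by rewrite setIT.
Qed.

Lemma arcs_induced (G : sgraph) (A : {set G}) : arcs (induced A) = arcs_between A A.
Proof.
pose j (p : induced A * induced A) := (val p.1, val p.2).
have jinj : injective j by move=> [a b] [c d] [/val_inj E /val_inj E']; rewrite E E'.
rewrite /arcs -(card_imset _ jinj); apply: eq_card => -[a b]; rewrite !inE /=.
apply/imsetP/and3P.
  by case=> -[c d]; rewrite inE /= => cd [-> ->]; split; [exact: cd|exact: valP|exact: valP].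
case=> ab aA bA; exists (exist _ a aA, exist _ b bA) => //.
by rewrite inE.
Qed.

(** What disappears is the edge xy and, for each common neighbour of x and y, one
    of two parallel edges. *)
Lemma arcs_contract (G : sgraph) (x y : G) : x -- y ->
  arcs G <= arcs (contract x y) + 2 + #|nbr x :&: nbr y|.*2.
Proof.
move=> xy; have xny : x != y by apply: contraTneq xy => ->; rewrite adj_irr.
pose cx : contract x y := exist _ x xny.
pose c (z : G) : contract x y := insubd cx z.
have cy : c y = cx by rewrite /c /insubd insubF ?eqxx.
have cE z : z != y -> val (c z) = z by move=> zy; rewrite insubdK.
have cv z : val (c z) = if z == y then x else z.
  by have [->|/cE] := eqVneq z y; rewrite ?cy.
set C := nbr x :&: nbr y.
pose X := [set (x, y); (y, x)] :|: [set (y, w) | w in C] :|: [set (w, y) | w in C].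
have cX : #|X| <= 2 + #|C|.*2.
  rewrite -addnn addnA; apply: leq_trans (leq_card_setU _ _) _; apply: leq_add.
    apply: leq_trans (leq_card_setU _ _) _; apply: leq_add; last exact: leq_imset_card.
    by rewrite cards2; case: (_ == _).
  exact: leq_imset_card.
pose A := [set p : G * G | p.1 -- p.2].
pose cc (p : G * G) := (c p.1, c p.2).
have XE a b : a -- b -> (a, b) \notin X ->
    [/\ (a == y) ==> (b != x) && ~~ (x -- b), (b == y) ==> (a != x) && ~~ (x -- a) & c a != c b].
  move=> ab; rewrite !inE !negb_or -!andbA => /and4P[n1 n2 n3 n4].
  have ya : (a == y) ==> (b != x) && ~~ (x -- b).
    apply/implyP=> /eqP E; subst a; apply/andP; split; first by move: n2; rewrite xpair_eqE eqxx.
    by apply: contra n3 => xb; apply/imsetP; exists b; rewrite // !inE xb.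
  have yb : (b == y) ==> (a != x) && ~~ (x -- a).
    apply/implyP=> /eqP E; subst b; apply/andP; split; first by move: n1; rewrite xpair_eqE eqxx andbT.
    by apply: contra n4 => xa; apply/imsetP; exists a; rewrite // !inE xa adj_sym.
  split=> //; rewrite -val_eqE /= !cv.
  case: (eqVneq a y) ya => [Ea /= /andP[bx _]|na _].
    case: (eqVneq b y) => [Eb|nb]; first by rewrite Ea Eb adj_irr in ab.
    by rewrite eq_sym.
  case: (eqVneq b y) yb => [Eb /= /andP[]//|nb _].
  by apply: contraTneq ab => ->; rewrite adj_irr.
have cinj : {in A :\: X &, injective cc}.
  move=> [a b] [a' b'] /setDP[+ nX] /setDP[+ nX'].
  rewrite !inE /= => ab ab' [] /(congr1 val) E1 /(congr1 val) E2; move: E1 E2; rewrite !cv.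
  have [ya yb _] := XE _ _ ab nX; have [ya' yb' _] := XE _ _ ab' nX'.
  have ba : b -- a by rewrite adj_sym.
  have ba' : b' -- a' by rewrite adj_sym.
  case: (eqVneq a y) ya => [Ea|na] ya; case: (eqVneq a' y) ya' => [Ea'|na'] ya';
  case: (eqVneq b y) yb => [Eb|nb] yb; case: (eqVneq b' y) yb' => [Eb'|nb'] yb' E1 E2;
  rewrite ?Ea ?Ea' ?Eb ?Eb' ?adj_irr // in ab ab' ba ba' ya ya' yb yb' E1 E2 *;
  rewrite -?E1 -?E2 ?E1 ?E2 ?eqxx ?adj_irr //= in ab ab' ba ba' ya ya' yb yb' *;
  move: ya ya' yb yb'; rewrite ?ab ?ab' ?ba ?ba' ?andbF //.
rewrite {1}/arcs -/A -(cardsID X A) addnC -addnA; apply: leq_add; last first.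
  by apply: leq_trans cX; apply: subset_leq_card; apply: subsetIr.
rewrite -(card_in_imset cinj); apply: subset_leq_card; apply/subsetP=> q /imsetP[[a b]].
case/setDP=> + nX -> /=; rewrite !inE /= => ab.
have [_ _ cab] := XE _ _ ab nX.
rewrite /contract_adj /= cab /= !cv.
have [Ea|na] := eqVneq a y; have [Eb|nb] := eqVneq b y.
- by rewrite Ea Eb adj_irr in ab.
- by have yb : y -- b by [rewrite -Ea]; rewrite eqxx yb orbT.
- by have ya : y -- a by [rewrite -Eb adj_sym]; rewrite eqxx ya !orbT.
by rewrite ab.
Qed.

Definition complete_adj h : rel 'I_h := [rel i j | i != j].
Lemma complete_adj_sym h : symmetric (@complete_adj h).
Proof. by move=> i j; rewrite /complete_adj /= eq_sym. Qed.
Lemma complete_adj_irr h : irreflexive (@complete_adj h).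
Proof. by move=> i; rewrite /complete_adj /= eqxx. Qed.
Definition complete h : sgraph := SGraph (@complete_adj_sym h) (@complete_adj_irr h).

Lemma model_complete (H G : sgraph) : has_model (complete #|H|) G -> has_model H G.
Proof.
apply: (has_model_hom (g := @enum_rank H : H -> complete #|H|)).
  by exists enum_val => x; rewrite ?enum_rankK ?enum_valK.
move=> x y xy; rewrite /= /complete_adj /=; apply: contraTneq xy => /enum_rank_inj->.
by rewrite adj_irr.
Qed.

Lemma model_complete_cone h (G : sgraph) (v : G) :
  has_model (complete h) (induced (nbr v)) -> has_model (complete h.+1) G.
Proof.
move=> m; apply: (@model_join_clique _ _ [set~ (ord0 : complete h.+1)] [set v] (nbr v)).
- by rewrite setCK !cards1.
- by rewrite disjoints1 inE adj_irr.
- by move=> l l'; rewrite !inE => /eqP-> /eqP->; rewrite eqxx.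
- by move=> l b; rewrite !inE => /eqP->.
have e : #|induced [set~ (ord0 : complete h.+1)]| = h.
  by rewrite card_induced cardsC1 card_ord.
by apply: model_complete; rewrite e.
Qed.

(** Mader's argument: either some edge lies in few triangles, and contracting
    it keeps the density, or the neighbourhood of a vertex is dense. *)
Lemma mader h (G : sgraph) : 0 < #|G| -> 2 ^ h * #|G| <= arcs G -> has_model (complete h) G.
Proof.
elim: h G => [|h IHh] G; first by move=> _ _; apply: model_edgeless => [|[]//]; rewrite card_ord.
have [n] := ubnP #|G|; elim: n G => // n IHn G; rewrite ltnS => leGn G0 dense.
have [[x [y [xy few]]]|many] := pselect (exists x y : G, x -- y /\ #|nbr x :&: nbr y| < 2 ^ h).
  apply: (has_model_contract xy).
  have G1 : 1 < #|G|.
    rewrite (cardD1 x) (cardD1 y) !inE.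
    by have -> : y != x by apply: contraTneq xy => ->; rewrite adj_irr.
  apply: IHn; rewrite card_contract; [lia|lia|].
  have := arcs_contract xy; move: dense few; rewrite expnS -(prednK G0) mulnS; lia.
have : 0 < arcs G by apply: leq_trans dense; rewrite muln_gt0 expn_gt0.
case/card_gt0P=> -[v w]; rewrite inE /= => vw; apply: (model_complete_cone (v := v)).
apply: IHh; first by rewrite card_induced; apply/card_gt0P; exists w; rewrite inE.
rewrite card_induced arcs_induced arcs_betweenE mulnC -sum_nat_const.
apply: leq_sum => u; rewrite inE => vu; rewrite leqNgt; apply/negP=> few.
by apply: many; exists v, u; rewrite setIC.
Qed.

Lemma sparse_of_minor_free (F : graph_family) (H : sgraph) : F H ->
  exists D, forall G : sgraph, minor_free F G -> forall A : {set G}, arcs_between A A <= D * #|A|.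
Proof.
move=> FH; exists (2 ^ #|H|) => G /minor_freeP free A.
have [A0|A0] := posnP #|A|.
  by rewrite arcs_betweenE big_pred0 // => x; rewrite (cards0_eq A0) inE.
rewrite leqNgt; apply/negP=> /ltnW dense; apply: (free H FH).
apply: (has_model_embedding (embedding_induced A)); apply/model_complete/mader.
  by rewrite card_induced.
by rewrite card_induced arcs_induced.
Qed.

Lemma arcs_between_sparse (G : sgraph) D : (forall A : {set G}, arcs_between A A <= D * #|A|) ->
  forall A B : {set G}, arcs_between A B <= D * (#|A| + #|B|).
Proof.
move=> sp A B; apply: (@leq_trans (arcs_between (A :|: B) (A :|: B))).
  by apply: arcs_betweenS; rewrite ?subsetUl ?subsetUr.
apply: leq_trans (sp _) _; rewrite leq_mul2l; apply/orP; right; apply: leq_card_setU.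
Qed.

(** * The spectral radius as the maximum of the Rayleigh quotient *)

Import Order.TTheory GRing.Theory Num.Theory.
Local Open Scope ring_scope.

Lemma discriminant_le (R : realType) (b c d : R) :
  0 <= d -> (forall t, 0 <= b + 2 * t * c + t ^+ 2 * d) -> c ^+ 2 <= b * d.
Proof.
rewrite le_eqVlt => /orP[/eqP <- h|d0 h].
  rewrite mulr0; have [->|c0] := eqVneq c 0; first by rewrite expr2 mul0r.
  have := h (- (b + 1) / (2 * c)); have -> : b + 2 * (- (b + 1) / (2 * c)) * c +
    (- (b + 1) / (2 * c)) ^+ 2 * 0 = - 1 by field.
  by rewrite oppr_ge0 ler10.
have := h (- c / d); have -> : b + 2 * (- c / d) * c + (- c / d) ^+ 2 * d = b - c ^+ 2 / d.
  by field; rewrite gt_eqF.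
by rewrite subr_ge0 ler_pdivrMr.
Qed.

Section Rayleigh.
Variables (R : realType) (G : sgraph).

Definition nbr_sum (x : G -> R) (v : G) : R := \sum_(w | v -- w) x w.

Definition dot (x y : G -> R) : R := \sum_v x v * y v.

Lemma dotC x y : dot x y = dot y x.
Proof. by apply: eq_bigr => v _; rewrite mulrC. Qed.

Lemma dot_nbr_sumC x y : dot x (nbr_sum y) = dot y (nbr_sum x).
Proof.
rewrite /dot /nbr_sum; under eq_bigr do rewrite mulr_sumr.
rewrite (exchange_big_dep predT) //=; apply: eq_bigr => w _.
by rewrite mulr_sumr; apply: eq_big => [v|v _]; rewrite 1?adj_sym // mulrC.
Qed.

Lemma nbr_sumD x y (t : R) v : nbr_sum (fun w => x w + t * y w) v = nbr_sum x v + t * nbr_sum y v.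
Proof. by rewrite /nbr_sum big_split /= -mulr_sumr. Qed.

Lemma dotDr x y z (t : R) : dot x (fun v => y v + t * z v) = dot x y + t * dot x z.
Proof.
rewrite /dot mulr_sumr -big_split /=; apply: eq_bigr => v _.
by rewrite mulrDr mulrCA.
Qed.

Lemma dotDl x y z (t : R) : dot (fun v => y v + t * z v) x = dot y x + t * dot z x.
Proof. by rewrite dotC dotDr !(dotC x). Qed.

Lemma dot_ge0 x : 0 <= dot x x.
Proof. by apply: sumr_ge0 => v _; rewrite -expr2 sqr_ge0. Qed.

Lemma dot_eq0 x : dot x x = 0 -> forall v, x v = 0.
Proof.
move=> x0 v; have /eqP := x0; rewrite psumr_eq0 => [|w _]; last by rewrite -expr2 sqr_ge0.
by move/allP/(_ v); rewrite mem_index_enum => /(_ isT) /=; rewrite mulf_eq0 orbb => /eqP.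
Qed.

Definition delta_fun (v : G) : G -> R := fun w => (w == v)%:R.

Lemma dot_delta v x : dot (delta_fun v) x = x v.
Proof.
rewrite /dot (bigD1 v) //= /delta_fun eqxx mul1r big1 ?addr0 // => w /negbTE ->.
by rewrite mul0r.
Qed.

(** Forms [m |y|^2 - y.Ay] that are positive semidefinite: by Cauchy-Schwarz
    their isotropic vectors lie in the kernel. *)
Section PSD.
Variable m : R.
Hypothesis psd : forall y, dot y (nbr_sum y) <= m * dot y y.

Let B x y := m * dot x y - dot x (nbr_sum y).

Lemma psd_cauchy_schwarz x y : B x y ^+ 2 <= B x x * B y y.
Proof.
apply: discriminant_le => [|t]; first by rewrite subr_ge0.
have : 0 <= B (fun v => x v + t * y v) (fun v => x v + t * y v) by rewrite subr_ge0.
congr (0 <= _); rewrite /B.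
have -> : nbr_sum (fun v => x v + t * y v) = (fun v => nbr_sum x v + t * nbr_sum y v).
  by apply: funext => v; apply: nbr_sumD.
by rewrite !dotDr !dotDl (dotC y x) (dot_nbr_sumC y x); ring.
Qed.

Lemma psd_isotropic y : m * dot y y <= dot y (nbr_sum y) -> forall v, nbr_sum y v = m * y v.
Proof.
move=> le v; have B0 : B y y = 0.
  by apply/eqP; rewrite eq_le subr_ge0 psd andbT subr_le0.
have := psd_cauchy_schwarz y (delta_fun v); rewrite B0 mul0r => h.
have : B y (delta_fun v) = 0 by apply/eqP; rewrite -sqrf_eq0 eq_le h sqr_ge0.
rewrite /B dotC dot_nbr_sumC !dot_delta => /eqP.
by rewrite subr_eq0 => /eqP ->.
Qed.
End PSD.

Lemma sum_enum_val (F : G -> R) : \sum_(i < #|G|) F (enum_val i) = \sum_v F v.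
Proof.
rewrite (reindex (@enum_rank G)) /=; last by apply: onW_bij; apply: enum_rank_bij.
by apply: eq_bigr => v _; rewrite enum_rankK.
Qed.

Lemma mul_adjmx (x : G -> R) (j : 'I_#|G|) :
  ((\row_i x (enum_val i)) *m adjmx R G) 0 j = nbr_sum x (enum_val j).
Proof.
rewrite mxE; under eq_bigr do rewrite !mxE.
rewrite (sum_enum_val (fun v => x v * (v -- enum_val j)%:R)) /nbr_sum [RHS]big_mkcond /=.
by apply: eq_bigr => v _; rewrite (adj_sym v); case: (_ -- v); rewrite ?mulr1 ?mulr0.
Qed.

Lemma eigenvalue_adjmxP (a : R) :
  eigenvalue (adjmx R G) a <->
  exists2 x : G -> R, (exists v, x v != 0) & forall v, nbr_sum x v = a * x v.
Proof.
split=> [/eigenvalueP[u uA u0]|[x [v xv] xA]].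
  have uE : u = \row_i u 0 (enum_rank (enum_val i)).
    by apply/rowP=> i; rewrite mxE enum_valK.
  exists (fun v => u 0 (enum_rank v)) => [|v].
    move: u0; apply: contra_neqP => no; apply/rowP=> i; rewrite mxE.
    by apply: contra_notP no => /eqP ui; exists (enum_val i); rewrite enum_valK.
  rewrite -[v in LHS]enum_rankK -(mul_adjmx (fun v => u 0 (enum_rank v))) -uE uA.
  by rewrite mxE.
apply/eigenvalueP; exists (\row_i x (enum_val i)).
  by apply/rowP=> j; rewrite mul_adjmx xA !mxE.
apply: contraNneq xv => /rowP/(_ (enum_rank v)); rewrite !mxE enum_rankK => ->.
by rewrite eqxx.
Qed.

Hypothesis G0 : (0 < #|G|)%N.

(** Let m be the supremum of the quotient on the unit sphere. If m were not an
    eigenvalue, then A - m would be invertible and Cauchy-Schwarz would keep the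
    quotient below m - 1 / C. Taking absolute values in an eigenvector for m does
    not decrease the quotient, which gives a nonnegative eigenvector. *)
Lemma spectral_radius_max : let m := spectral_radius R G in
  (forall y, dot y (nbr_sum y) <= m * dot y y) /\
  exists2 x : G -> R, (forall v, 0 <= x v) /\ (exists v, 0 < x v) &
    forall v, nbr_sum x v = m * x v.
Proof.
have /card_gt0P[g _] := G0.
pose S := [set a : R | exists2 y, dot y y = 1 & a = dot y (nbr_sum y)]%classic.
have Sub : ubound S (#|G|%:R * #|G|%:R).
  move=> _ [y y1 ->]; have y_le v : `|y v| <= 1.
    rewrite -(@expr_le1 _ 2) // real_normK ?num_real // -y1 /dot (bigD1 v) //= expr2 lerDl.
    by apply: sumr_ge0 => w _; rewrite -expr2 sqr_ge0.
  apply: le_trans (ler_norm _) _; apply: le_trans (ler_norm_sum _ _ _) _.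
  rewrite -[X in X * _]sumr_const mulr_suml; apply: ler_sum => v _.
  rewrite mul1r normrM -[leRHS]mul1r; apply: ler_pM => //.
  apply: le_trans (ler_norm_sum _ _ _) _; rewrite -[leRHS]sumr_const big_mkcond /=.
  by apply: ler_sum => w _; case: ifP.
have S0 : nonempty S.
  exists (dot (delta_fun g) (nbr_sum (delta_fun g))); exists (delta_fun g) => //.
  by rewrite dot_delta /delta_fun eqxx.
pose m := sup S.
have hasS : has_sup S by split=> //; exists (#|G|%:R * #|G|%:R).
have le_m y : dot y y = 1 -> dot y (nbr_sum y) <= m.
  by move=> y1; apply: (sup_upper_bound hasS); exists y.
have psd y : dot y (nbr_sum y) <= m * dot y y.
  have [y0|y0] := eqVneq (dot y y) 0.
    by rewrite y0 mulr0 /dot big1 // => v _; rewrite (dot_eq0 y0) mul0r.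
  have yp : 0 < dot y y by rewrite lt_def y0 dot_ge0.
  pose c := (Num.sqrt (dot y y))^-1.
  have cc : c * c * dot y y = 1.
    by rewrite -expr2 /c exprVn sqr_sqrtr ?dot_ge0 // mulVf.
  have E (F : (G -> R) -> G -> R) : (forall v, F (fun v => c * y v) v = c * F y v) ->
      dot (fun v => c * y v) (F (fun v => c * y v)) = c * c * dot y (F y).
    move=> FE; rewrite /dot mulr_sumr; apply: eq_bigr => v _; rewrite FE; ring.
  have := le_m (fun v => c * y v); rewrite (E id) // (E nbr_sum).
    move=> /(_ cc) h; have c0 : 0 < c * c by rewrite -expr2 exprn_gt0 // invr_gt0 sqrtr_gt0.
    by rewrite -(ler_pM2l c0) (mulrCA (c * c)) cc mulr1.
  by move=> v; rewrite /nbr_sum mulr_sumr.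
have eig : eigenvalue (adjmx R G) m.
  apply: contraT => neig; exfalso.
  have unitM : adjmx R G - m%:M \in unitmx.
    rewrite -row_free_unit -kermx_eq0; move: neig.
    by rewrite /eigenvalue /eigenspace negbK.
  pose N := invmx (adjmx R G - m%:M).
  pose C := \sum_i \sum_j `|N i j| + 1.
  have C0 : 0 < C by apply: ltr_wpDl => //; apply: sumr_ge0 => i _; apply: sumr_ge0.
  have [a Sa lt_a] := sup_adherent (divr_gt0 ltr01 C0) hasS.
  case: Sa => y y1 aE; rewrite aE in lt_a.
  pose w v := ((\row_i y (enum_val i)) *m N) 0 (enum_rank v).
  have wE v : nbr_sum w v - m * w v = y v.
    have := mulmxKV unitM (\row_i y (enum_val i)) => /rowP/(_ (enum_rank v)).
    rewrite -/N mulmxBr mul_mx_scalar mxE [X in _ + X]mxE [X in - X]mxE [X in _ = X -> _]mxE.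
    rewrite enum_rankK => <-; congr (_ - _).
    rewrite -{1}[v]enum_rankK -mul_adjmx; congr ((_ *m _) 0 _).
    by apply/rowP=> i; rewrite mxE /w enum_valK.
  have Byw : m * dot y w - dot y (nbr_sum w) = - 1.
    rewrite -y1 /dot mulr_sumr -sumrB -sumrN; apply: eq_bigr => u _.
    by rewrite -!(wE u); ring.
  have Bww : m * dot w w - dot w (nbr_sum w) <= C.
    have -> : m * dot w w - dot w (nbr_sum w) = - dot w y.
      rewrite /dot mulr_sumr -sumrB -sumrN; apply: eq_bigr => v _; rewrite -wE; ring.
    have y_le v : `|y v| <= 1.
      rewrite -(@expr_le1 _ 2) // real_normK ?num_real // -y1 /dot (bigD1 v) //= expr2 lerDl.
      by apply: sumr_ge0 => u _; rewrite -expr2 sqr_ge0.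
    apply: le_trans (ler_norm _) _; rewrite normrN; apply: le_trans (ler_norm_sum _ _ _) _.
    apply: (@le_trans _ _ (\sum_v `|w v|)).
      by apply: ler_sum => v _; rewrite normrM ler_piMr.
    rewrite -(sum_enum_val (fun v => `|w v|)) /C exchange_big ler_wpDr //.
    apply: ler_sum => j _; rewrite /w enum_valK mxE.
    apply: le_trans (ler_norm_sum _ _ _) _; apply: ler_sum => i _.
    by rewrite !mxE normrM ler_piMl.
  have := psd_cauchy_schwarz psd y w; rewrite Byw sqrrN expr1n y1 mulr1 => h.
  have {h} h1 : 1 <= (m - dot y (nbr_sum y)) * C.
    by apply: le_trans h _; apply: ler_wpM2l => //; rewrite subr_ge0 le_m.
  move: lt_a; rewrite -/m ltrBlDr -ltrBlDl ltr_pdivlMr // => h2.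
  by have := lt_le_trans h2 h1; rewrite ltxx.
have lub (a : R) : eigenvalue (adjmx R G) a -> a <= m.
  case/eigenvalue_adjmxP => x [v xv] xA; have := psd x.
  have -> : dot x (nbr_sum x) = a * dot x x.
    by rewrite /dot mulr_sumr; apply: eq_bigr => u _; rewrite xA mulrCA.
  rewrite ler_pM2r // lt_def dot_ge0 andbT; apply: contraNneq xv => x0.
  by rewrite (dot_eq0 x0).
have -> : spectral_radius R G = m.
  apply/eqP; rewrite eq_le; apply/andP; split.
    by apply: ge_sup; [exists m|].
  by apply: ub_le_sup; [exists m|].
move=> /=; split=> //; have /eigenvalue_adjmxP[y [v yv] yA] := eig.
exists (fun v => `|y v|); first by split=> //; exists v; rewrite normr_gt0.
apply: psd_isotropic => //.
have -> : dot (fun v => `|y v|) (fun v => `|y v|) = dot y y.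
  by apply: eq_bigr => u _; rewrite -normrM ger0_norm // -expr2 sqr_ge0.
have <- : dot y (nbr_sum y) = m * dot y y.
  by rewrite /dot mulr_sumr; apply: eq_bigr => u _; rewrite yA mulrCA.
apply: ler_sum => u _; apply: le_trans (ler_norm _) _; rewrite normrM ler_wpM2l //.
exact: ler_norm_sum.
Qed.

End Rayleigh.

Local Open Scope nat_scope.

(** * Families of connected graphs *)

Lemma minor_free_embedding (F : graph_family) (G1 G2 : sgraph) (j : G1 -> G2) :
  embedding j -> minor_free F G2 -> minor_free F G1.
Proof.
move=> emb /minor_freeP free; apply/minor_freeP=> K FK m; apply: (free K FK).
exact: has_model_embedding emb m.
Qed.

Lemma minor_free_induced (F : graph_family) (G : sgraph) (S : {set G}) :
  minor_free F G -> minor_free F (induced S).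
Proof. exact/minor_free_embedding/embedding_induced. Qed.

Section Patch.
Variables (G F : sgraph) (J : {set G}) (g : G -> F).

Definition patch_adj : rel G := [rel x y |
  if (x \in J) && (y \in J) then g x -- g y else [&& x \notin J, y \notin J & x -- y]].

Lemma patch_adj_sym : symmetric patch_adj.
Proof.
move=> x y; rewrite /patch_adj /= (adj_sym (g x)) (adj_sym x) andbC.
by case: ifP => // _; rewrite andbCA.
Qed.

Lemma patch_adj_irr : irreflexive patch_adj.
Proof. by move=> x; rewrite /patch_adj /= !adj_irr !andbF; case: ifP. Qed.

(** The exchange on which all comparisons of numbers of edges rest. *)
Definition patch : sgraph := SGraph patch_adj_sym patch_adj_irr.

Lemma arcs_patch : {in J &, injective g} -> #|F| = #|J| ->
  arcs patch = arcs F + arcs_between (~: J) (~: J).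
Proof.
move=> ginj cF; have gim f : exists2 x, x \in J & g x = f.
  have : f \in g @: J.
    have -> : g @: J = setT by apply/eqP; rewrite eqEcard subsetT card_in_imset // cardsT cF /=.
    by rewrite inE.
  by case/imsetP=> x xJ ->; exists x.
rewrite /arcs -(cardsID (setX J J)); congr (_ + _).
  pose gg (p : G * G) := (g p.1, g p.2).
  rewrite -(card_in_imset (f := gg)) => [|[a b] [c d]].
    apply: eq_card => -[f f']; rewrite [RHS]inE /=; apply/imsetP/idP.
      case=> -[a b]; rewrite !inE /= /patch_adj /= => /andP[+ /andP[aJ bJ]].
      by rewrite aJ bJ => ab [-> ->].
    move=> ff'; have [a aJ Ea] := gim f; have [b bJ Eb] := gim f'.
    by exists (a, b); rewrite ?/gg /= ?Ea ?Eb // !inE /= /patch_adj /= aJ bJ /= Ea Eb ff'.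
  rewrite !inE /= => /andP[_ /andP[aJ bJ]] /andP[_ /andP[cJ dJ]] [/(ginj _ _ aJ cJ) -> /(ginj _ _ bJ dJ) ->].
  by [].
apply: eq_card => -[a b]; rewrite !inE /= /patch_adj /=.
by case: (a \in J) (b \in J) => [] [] //=; rewrite ?andbT ?andbF.
Qed.
End Patch.

Section ConnectedFamily.
Variable Fam : graph_family.
Hypothesis Fam_connected : forall K, Fam K -> connected K.
Hypothesis Fam_card : forall K, Fam K -> 1 < #|K|.

Lemma minor_free_closed_union (G : sgraph) (U : {set G}) :
  (forall x y, x \in U -> x -- y -> y \in U) ->
  minor_free Fam (induced U) -> minor_free Fam (induced (~: U)) -> minor_free Fam G.
Proof.
move=> closU /minor_freeP freeU /minor_freeP freeC; apply/minor_freeP=> K FK m.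
have [mU|mC] := model_closed_side (Fam_connected FK) (ltnW (Fam_card FK)) closU m.
  exact: freeU mU.
exact: freeC mC.
Qed.

Lemma minor_free_edgeless (G : sgraph) : (forall x y : G, ~~ (x -- y)) -> minor_free Fam G.
Proof.
move=> noadj; apply/minor_freeP=> K FK [f [_ _ fadj]].
have [k kk'] : exists k k' : K, k != k'.
  have /card_gt0P[k _] := ltnW (Fam_card FK).
  have [k'] : exists k', k' \in [set~ k].
    by apply/card_gt0P; rewrite cardsC1; have := Fam_card FK; lia.
  by rewrite !inE => kk'; exists k', k.
have [k' nkk'] := kk'; have /connectP[[|l p] /=] := Fam_connected FK k k'.
  by move=> _ E; rewrite E eqxx in nkk'.
case/andP=> /fadj[u [v [_ _ uv]]] _ _; by have := noadj u v; rewrite uv.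
Qed.

Lemma minor_free_patch (G F : sgraph) (J : {set G}) (g : G -> F) :
  {in J &, injective g} -> minor_free Fam G -> minor_free Fam F -> minor_free Fam (patch J g).
Proof.
move=> ginj freeG freeF; apply: (@minor_free_closed_union (patch J g) J).
- by move=> x y xJ; rewrite /= /patch_adj /= xJ /=; case: ifP.
- apply: (@minor_free_embedding _ (induced (G := patch J g) J) F (g \o val)) freeF.
  split=> [x y /= E|x y]; first by apply/val_inj/ginj => //; apply: valP.
  by rewrite /= /induced_adj /= /patch_adj /= (valP x) (valP y).
apply: (@minor_free_embedding _ (induced (G := patch J g) (~: J)) G val) freeG.
split=> [|x y]; first exact: val_inj.
rewrite /= /induced_adj /= /patch_adj /=.
by have := valP x; have := valP y; rewrite !inE => /negbTE -> /negbTE ->.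
Qed.
End ConnectedFamily.

Local Open Scope ring_scope.

(** * Principal vertices of a sparse graph with large spectral radius *)

Section PrincipalVertices.
Variables (R : realType) (G : sgraph) (x : G -> R) (lam : R) (z : G) (s D N' : nat).
Hypotheses (x_ge0 : forall v, 0 <= x v) (x_le1 : forall v, x v <= 1) (xz : x z = 1).
Hypotheses (lam_gt0 : 0 < lam) (x_eig : forall v, nbr_sum x v = lam * x v).
Hypothesis lam2 : s%:R * (#|G|%:R - s%:R) <= lam ^+ 2.
Hypothesis sparse : forall A : {set G}, (arcs_between A A <= D * #|A|)%N.
Hypothesis common : forall L : {set G}, (s < #|L|)%N -> (#|common_nbrs L| < N')%N.
Hypotheses (s_gt0 : (0 < s)%N) (D_gt0 : (0 < D)%N).

Let n : R := #|G|%:R.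

Lemma nbr_sumE v : nbr_sum x v = \sum_(w in nbr v) x w.
Proof. by apply: eq_bigl => w; rewrite inE. Qed.

Lemma sum_degrees_le (A : {set G}) : \sum_(v in A) #|nbr v|%:R <= D%:R * n.
Proof.
rewrite -natr_sum /n -natrM ler_nat -(cardsT G); apply: leq_trans (sparse [set: G]).
rewrite arcs_betweenE [X in (_ <= X)%N](bigID (mem A)) /= -[X in (X <= _)%N]addn0 leq_add //.
by apply/eq_leq/eq_big => [v|v _]; rewrite ?inE ?setIT.
Qed.

Lemma sum_le_card (A : {set G}) : \sum_(v in A) x v <= #|A|%:R.
Proof. by rewrite -sum1_card natr_sum; apply: ler_sum. Qed.

Lemma two_step (A : {set G}) (e : R) u : 0 <= e -> (forall w, w \notin A -> x w <= e) ->
  lam ^+ 2 * x u <= \sum_(v in nbr u) \sum_(w in nbr v :&: A) x w + e * (D%:R * n).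
Proof.
move=> e0 xe; rewrite expr2 -mulrA -x_eig nbr_sumE mulr_sumr.
apply: (@le_trans _ _ (\sum_(v in nbr u) (\sum_(w in nbr v :&: A) x w + e * #|nbr v|%:R))).
  apply: ler_sum => v _; rewrite -x_eig nbr_sumE (big_setID A) /= lerD2l.
  apply: (@le_trans _ _ (\sum_(w in nbr v :\: A) e)).
    by apply: ler_sum => w; rewrite inE => /andP[/xe].
  rewrite sumr_const -[leLHS]mulr_natr ler_wpM2l // ler_nat.
  by apply: subset_leq_card; apply: subsetDl.
rewrite big_split /= lerD2l -mulr_sumr ler_wpM2l //; exact: sum_degrees_le.
Qed.

Lemma card_large_entries (e : R) : 0 < e -> #|[set v | e <= x v]|%:R * (e * lam) <= D%:R * n.
Proof.
move=> e0; set A := [set v | _].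
apply: le_trans (sum_degrees_le A); rewrite mulr_natl -sumr_const.
apply: ler_sum => v; rewrite inE => ev.
rewrite mulrC; apply: (@le_trans _ _ (lam * x v)); first by rewrite ler_pM2l.
by rewrite -x_eig nbr_sumE sum_le_card.
Qed.

(** For a small threshold e, only O(sqrt n) entries exceed e, so sparseness bounds
    the two-step sum at u by a multiple of the degree of u. *)
Lemma degree_large_entry_crude (eta : R) u : 0 < eta -> eta <= x u ->
  4 * s%:R <= n -> 16 * D%:R ^+ 3 <= eta ^+ 2 * s%:R ^+ 2 * lam ->
  eta * s%:R * n <= 4 * D%:R * #|nbr u|%:R.
Proof.
move=> eta0 xu n4 lamL; have sR : 1 <= s%:R :> R by rewrite ler1n.
have DR : 1 <= D%:R :> R by rewrite ler1n.
pose e := eta * s%:R / (4 * D%:R).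
have e0 : 0 < e by rewrite divr_gt0 // mulr_gt0 //; lra.
have eD : e * D%:R * 4 = eta * s%:R by rewrite /e; field; rewrite gt_eqF //; lra.
pose A := [set v | e <= x v].
have xe w : w \notin A -> x w <= e by rewrite inE -ltNge => /ltW.
have := two_step u (ltW e0) xe.
have h1 : \sum_(v in nbr u) \sum_(w in nbr v :&: A) x w <= D%:R * (#|nbr u|%:R + #|A|%:R).
  apply: (@le_trans _ _ (\sum_(v in nbr u) #|nbr v :&: A|%:R)).
    by apply: ler_sum => v _; apply: sum_le_card.
  by rewrite -natr_sum -arcs_betweenE -natrD -natrM ler_nat arcs_between_sparse.
have h2 := card_large_entries e0; rewrite -/A in h2.
have h3 : s%:R * (n - s%:R) * eta <= lam ^+ 2 * x u.
  apply: ler_pM => //; last exact: ltW.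
  by rewrite mulr_ge0 //; lra.
have n0 : 0 <= n by rewrite ler0n.
have h4 : D%:R * #|A|%:R * 4 <= eta * s%:R * n.
  have elam : 4 * D%:R ^+ 2 <= eta * s%:R * (e * lam).
    have -> : eta * s%:R * (e * lam) = eta ^+ 2 * s%:R ^+ 2 * lam / (4 * D%:R).
      by rewrite /e; field; rewrite gt_eqF //; lra.
    rewrite ler_pdivlMr; last lra.
    by apply: le_trans lamL; rewrite le_eqVlt; apply/orP; left; apply/eqP; ring.
  have A0 : 0 <= #|A|%:R :> R by rewrite ler0n.
  have : 4 * D%:R ^+ 2 * #|A|%:R <= eta * s%:R * (D%:R * n).
    apply: le_trans (ler_wpM2r A0 elam) _; rewrite -[leLHS]mulrA ler_pM2l; last first.
      by rewrite mulr_gt0 //; lra.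
    by rewrite mulrC.
  have D0 : 0 < D%:R :> R by lra.
  by move=> h; rewrite -(ler_pM2l D0); apply: le_trans (le_trans _ h) _;
    rewrite le_eqVlt; apply/orP; left; apply/eqP; ring.
have h5 : s%:R * s%:R * eta * 4 <= eta * s%:R * n.
  have -> : s%:R * s%:R * eta * 4 = eta * s%:R * (4 * s%:R) by ring.
  by rewrite ler_pM2l // mulr_gt0 //; lra.
have h6 : e * (D%:R * n) * 4 = eta * s%:R * n by rewrite -eD; ring.
move=> h; nra.
Qed.

Lemma card_large_entries_bounded (eta : R) : 0 < eta ->
  4 * s%:R <= n -> 16 * D%:R ^+ 3 <= eta ^+ 2 * s%:R ^+ 2 * lam ->
  #|[set v | eta <= x v]|%:R * (eta * s%:R) <= 4 * D%:R ^+ 2.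
Proof.
move=> eta0 n4 lamL; set A := [set v | _].
have n0 : 0 < n by apply: lt_le_trans n4; rewrite mulr_gt0 // ltr0n.
rewrite -(ler_pM2r n0) -mulrA [leLHS]mulr_natl -[leLHS]sumr_const.
apply: (@le_trans _ _ (\sum_(v in A) 4 * D%:R * #|nbr v|%:R)).
  by apply: ler_sum => v; rewrite inE => xv; apply: degree_large_entry_crude.
rewrite -mulr_sumr; have D0 : 0 < 4 * D%:R :> R by rewrite mulr_gt0 // ltr0n.
have := sum_degrees_le A; rewrite -(ler_pM2l D0) => h; apply: le_trans h _.
by rewrite le_eqVlt; apply/orP; left; apply/eqP; ring.
Qed.

(** Sorted by their trace on A, the vertices with the same trace of more than s
    elements are common neighbours of it. *)
Lemma card_many_nbrs (A : {set G}) :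
  (#|[set v | s < #|nbr v :&: A|]%N| <= 2 ^ #|A| * N')%N.
Proof.
set Bad := [set v | _]; rewrite -sum1_card.
rewrite (partition_big (fun v => nbr v :&: A) (mem (powerset A))) /= => [|v _]; last first.
  by rewrite inE subsetIr.
rewrite -card_powerset -sum_nat_const; apply: leq_sum => X; rewrite inE => XA.
rewrite sum1_card; have [le_s|lt_s] := leqP #|X| s.
  rewrite eq_card0 // => v; rewrite -topredE /= inE; apply/negbTE.
  by apply/andP=> -[lt_s /eqP E]; rewrite E ltnNge le_s in lt_s.
apply: leq_trans (ltnW (common lt_s)); apply/subset_leq_card/subsetP=> v.
rewrite -topredE /= => /andP[_ /eqP E]; apply/common_nbrsP=> l; rewrite -E !inE => /andP[vl _].
by rewrite adj_sym.
Qed.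

(** The set A of entries at least eta is now bounded, so all but boundedly many
    vertices have at most s neighbours in A. The estimates below weigh this
    against lam^2 >= s (n - s). *)
Section Refined.
Variables (eta : R) (a0 K : nat).
Hypotheses (eta0 : 0 < eta).
Let A := [set v | eta <= x v].
Hypotheses (cA : (#|A| <= a0)%N) (K_eq : K = (2 ^ a0 * N')%N).
Hypothesis n_large : (s ^ 2 + K + a0 * K)%:R <= eta * n.
Let beta : R := eta * D.+1%:R.

Let Bad := [set v | s < #|nbr v :&: A|]%N.
Let g v := \sum_(w in nbr v :&: A) x w.

Lemma card_Bad : (#|Bad| <= K)%N.
Proof.
apply: leq_trans (card_many_nbrs A) _.
by rewrite K_eq leq_mul2r leq_pexp2l ?orbT.
Qed.

Lemma sum_Bad (X : {set G}) : \sum_(v in X | v \in Bad) g v <= (a0 * K)%:R.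
Proof.
apply: (@le_trans _ _ (\sum_(v in Bad) a0%:R)); last first.
  by rewrite sumr_const -[X in X <= _]mulr_natr -natrM ler_nat leq_mul2l card_Bad orbT.
rewrite [leRHS](bigID (mem X)) /= -[leLHS]addr0 lerD //; last first.
  by apply: sumr_ge0 => *; rewrite ler0n.
rewrite (eq_bigl (fun v => (v \in Bad) && (v \in X))) => [|v]; last exact: andbC.
apply: ler_sum => v _; apply: le_trans (sum_le_card _) _; rewrite ler_nat.
by apply: leq_trans cA; apply: subset_leq_card; apply: subsetIr.
Qed.

Lemma g_good v : v \notin Bad -> (#|nbr v :&: A| <= s)%N.
Proof. by rewrite inE -leqNgt. Qed.

Lemma refined_step u (h : G -> R) : (forall v, v \notin Bad -> g v <= h v) ->
  (s%:R * (n - s%:R)) * x u <= \sum_(v in nbr u | v \notin Bad) h v + (a0 * K)%:R + eta * (D%:R * n).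
Proof.
move=> gh; have xe w : w \notin A -> x w <= eta by rewrite inE -ltNge => /ltW.
apply: le_trans (ler_wpM2r (x_ge0 u) lam2) _; apply: le_trans (two_step u (ltW eta0) xe) _.
rewrite lerD2r (bigID (mem Bad)) /= addrC lerD ?sum_Bad //.
by apply: ler_sum => v /andP[_]; apply: gh.
Qed.

Lemma degree_lower u : (x u - beta) * n <= #|nbr u|%:R.
Proof.
have gs v : v \notin Bad -> g v <= s%:R.
  by move=> /g_good vB; apply: le_trans (sum_le_card _) _; rewrite ler_nat.
have := refined_step u gs; rewrite sumr_const.
set c := #|_|; have cd : (c <= #|nbr u|)%N.
  by apply/subset_leq_card/subsetP=> v; rewrite -topredE /= => /andP[].
have sR : 1 <= s%:R :> R by rewrite ler1n.
have n0 : 0 <= n by rewrite ler0n.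
move: n_large; rewrite !natrD natrX /beta -[D.+1]addn1 natrD.
rewrite -[s%:R *+ c]mulr_natr.
have cdR : c%:R <= #|nbr u|%:R :> R by rewrite ler_nat.
have K0 : 0 <= K%:R :> R by rewrite ler0n.
have := x_le1 u; have := x_ge0 u.
set d := #|nbr u|%:R in cdR *; set k := (a0 * K)%:R; set xu := x u.
move=> xu0 xu1 nl h.
have h1 : s%:R * c%:R <= s%:R * d by apply: ler_wpM2l => //; lra.
have h2 : s%:R ^+ 2 * xu <= s%:R ^+ 2 by apply: ler_piMr => //; rewrite exprn_ge0 //; lra.
have h3 : s%:R * (n * xu) <= s%:R * d + eta * n * (D%:R + 1).
  by rewrite expr2 in h2 nl; nra.
have h4 : eta * n * (D%:R + 1) <= s%:R * (eta * n * (D%:R + 1)).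
  by apply: ler_peMl => //; rewrite !mulr_ge0 ?addr_ge0 ?ler0n // ltW.
have s0 : 0 < s%:R :> R by lra.
rewrite -(ler_pM2l s0); lra.
Qed.

(** At the vertex z of maximal entry, every good neighbour of u loses 1 - x u from
    the bound s on its sum over A. *)
Lemma degree_defect u : u \in A -> (1 - x u) * #|nbr u|%:R <= beta * n.
Proof.
move=> uA; pose h v := s%:R - (1 - x u) * (v \in nbr u)%:R.
have gh v : v \notin Bad -> g v <= h v.
  move=> /g_good vB; rewrite /h; case: (boolP (v \in nbr u)) => uv; last first.
    by rewrite mulr0 subr0; apply: le_trans (sum_le_card _) _; rewrite ler_nat.
  have uin : u \in nbr v :&: A by rewrite !inE adj_sym; rewrite inE in uv; rewrite uv; move: uA; rewrite inE.
  rewrite /g (bigD1 u) //= mulr1.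
  apply: (@le_trans _ _ (x u + (#|nbr v :&: A|.-1)%:R)).
    rewrite lerD2l; apply: (@le_trans _ _ (\sum_(w in (nbr v :&: A) :\ u) x w)).
      by rewrite le_eqVlt; apply/orP; left; apply/eqP/eq_bigl => w; rewrite !inE andbC.
    apply: le_trans (sum_le_card _) _; rewrite ler_nat.
    by rewrite [in X in (_ <= X)%N](cardsD1 u) uin.
  have c0 : (0 < #|nbr v :&: A|)%N by apply/card_gt0P; exists u.
  have : (#|nbr v :&: A|.-1)%:R = #|nbr v :&: A|%:R - 1 :> R by rewrite -[in RHS](prednK c0) -addn1 natrD addrK.
  move=> ->; have : #|nbr v :&: A|%:R <= s%:R :> R by rewrite ler_nat.
  lra.
have := refined_step z gh; rewrite xz mulr1.
have h0 v : v \notin Bad -> 0 <= h v.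
  by move=> vB; apply: le_trans (gh v vB); apply: sumr_ge0.
have S1 : \sum_(v in nbr z | v \notin Bad) h v <= \sum_(v | v \notin Bad) h v.
  rewrite [leRHS](bigID (mem (nbr z))) /= -[leLHS]addr0 lerD //; last first.
    by apply: sumr_ge0 => v /andP[/h0].
  by rewrite (eq_bigl (fun v => (v \notin Bad) && (v \in nbr z))) // => v; rewrite andbC.
have S2 : \sum_(v | v \notin Bad) h v <= s%:R * n - (1 - x u) * (#|nbr u|%:R - K%:R).
  rewrite /h big_split /= sumrN -mulr_sumr lerD //.
    rewrite sumr_const -[leLHS]mulr_natr ler_wpM2l ?ler0n // ler_nat; exact: max_card.
  rewrite lerN2 ler_wpM2l ?subr_ge0 // lerBlDr -natr_sum -natrD ler_nat.
  apply: leq_trans (leq_add (leqnn _) card_Bad).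
  rewrite -(cardsID Bad (nbr u)) addnC leq_add //; last by apply: subset_leq_card; apply: subsetIr.
  rewrite -sum1_card big_mkcond /= [X in (_ <= X)%N]big_mkcond /=; apply: leq_sum => v _.
  by rewrite in_setD; case: (v \in Bad) (v \in nbr u) => [] [].
have := x_le1 u; have := x_ge0 u.
move: n_large; rewrite !natrD natrX /beta -[D.+1]addn1 natrD.
set d := #|nbr u|%:R in S2 *; set k := (a0 * K)%:R; set xu := x u in S2 *.
have K0 : 0 <= K%:R :> R by rewrite ler0n.
move=> nl xu0 xu1 h1.
have h2 : (1 - xu) * K%:R <= K%:R by apply: ler_piMl => //; lra.
have : s%:R * (n - s%:R) <= s%:R * n - (1 - xu) * (d - K%:R) + k + eta * (D%:R * n).
  by apply: le_trans h1 _; rewrite !lerD2r (le_trans S1).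
rewrite expr2 in nl; lra.
Qed.

Lemma card_principal_ge (theta : R) : eta <= theta -> 0 <= theta ->
  s%:R * n <= (#|[set v | (theta <= x v)%R]|%:R + theta * s%:R + beta) * n.
Proof.
move=> et t0; set L := [set v | _]; pose h (v : G) := #|L|%:R + theta * s%:R.
have gh v : v \notin Bad -> g v <= h v.
  move=> /g_good vB; rewrite /g (big_setID L) /= /h lerD //.
    apply: le_trans (sum_le_card _) _; rewrite ler_nat.
    by apply: subset_leq_card; apply: subsetIr.
  apply: (@le_trans _ _ (\sum_(w in nbr v :&: A :\: L) theta)).
    by apply: ler_sum => w; rewrite !inE -ltNge => /andP[/ltW].
  rewrite sumr_const -[leLHS]mulr_natr ler_wpM2l // ler_nat; apply: leq_trans vB.
  by apply: subset_leq_card; apply: subsetDl.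
have h0 v : 0 <= h v by rewrite addr_ge0 ?mulr_ge0 ?ler0n.
have := refined_step z gh; rewrite xz mulr1.
have S1 : \sum_(v in nbr z | v \notin Bad) h v <= (#|L|%:R + theta * s%:R) * n.
  rewrite sumr_const -[leLHS]mulr_natr ler_wpM2l //; first exact: (h0 z).
  rewrite ler_nat; exact: max_card.
move: n_large; rewrite !natrD natrX /beta -[D.+1]addn1 natrD expr2.
have K0 : 0 <= K%:R :> R by rewrite ler0n.
set k := (a0 * K)%:R; move: S1; set S := \sum_(v in _ | _) _.
move=> h1 nl h2; lra.
Qed.
End Refined.
End PrincipalVertices.

Lemma common_nbrs_card_ge (R : realType) (G : sgraph) (L : {set G}) (delta : R) :
  (forall l, l \in L -> (1 - delta) * #|G|%:R <= #|nbr l|%:R) ->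
  (1 - delta * #|L|%:R) * #|G|%:R <= #|common_nbrs L|%:R.
Proof.
move=> deg.
have : (#|G| <= #|common_nbrs L| + \sum_(l in L) #|~: nbr l|)%N.
  rewrite -(cardsT G); apply: (@leq_trans #|common_nbrs L :|: \bigcup_(l in L) ~: nbr l|).
    apply/subset_leq_card/subsetP=> v _; rewrite inE; apply/orP.
    have [|nv] := boolP (v \in common_nbrs L); [by left|right].
    move: nv; rewrite inE negb_forall => /existsP[l]; rewrite negb_imply => /andP[lL nlv].
    by apply/bigcupP; exists l => //; rewrite !inE.
  apply: leq_trans (leq_card_setU _ _) _; rewrite leq_add2l.
  elim/big_rec2: _ => [|l m X _ le]; first by rewrite cards0.
  by apply: leq_trans (leq_card_setU _ _) _; rewrite leq_add2l.
rewrite -(ler_nat R) natrD natr_sum => h.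
have : \sum_(l in L) #|~: nbr l|%:R <= \sum_(l in L) delta * #|G|%:R :> R.
  apply: ler_sum => l lL; have := deg l lL.
  have -> : #|~: nbr l|%:R = #|G|%:R - #|nbr l|%:R :> R.
    by rewrite -(cardsC (nbr l)) natrD addrC addKr.
  lra.
rewrite sumr_const -[X in _ <= X -> _]mulr_natr; lra.
Qed.

Lemma ex_nat_ge (R : realType) (c : R) : 0 <= c -> exists m : nat, c <= m%:R.
Proof. by move=> c0; exists (Num.bound c); apply/ltW/archi_boundP. Qed.

(** An entry at least theta forces linear degree, and then the defect estimate
    pushes the entry to 1 and the degree to n. More than s such vertices would
    have too many common neighbours; fewer than s cannot support lam. The scale of
    constants is eta << theta * delta, with eta the threshold of the section
    above. *)
Lemma principal_vertices (R : realType) (s D N' : nat) (theta delta : R) :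
  (0 < s)%N -> (0 < D)%N -> 0 < theta -> theta * s%:R <= 1 / 4 ->
  0 < delta -> delta * (s%:R + 1) <= 1 / 2 ->
  exists n0 : nat, forall (G : sgraph) (x : G -> R) (lam : R) (z : G),
    (forall v, 0 <= x v) -> (forall v, x v <= 1) -> x z = 1 -> 0 < lam ->
    (forall v, nbr_sum x v = lam * x v) ->
    s%:R * (#|G|%:R - s%:R) <= lam ^+ 2 ->
    (forall A : {set G}, (arcs_between A A <= D * #|A|)%N) ->
    (forall L : {set G}, (s < #|L|)%N -> (#|common_nbrs L| < N')%N) ->
    (n0 <= #|G|)%N ->
    exists L : {set G}, [/\ #|L| = s,
      forall u, u \in L -> 1 - delta <= x u /\ (1 - delta) * #|G|%:R <= #|nbr u|%:R &
      forall u, u \notin L -> x u <= theta].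
Proof.
move=> s0 D0 t0 ts d0 ds.
have sR : 1 <= s%:R :> R by rewrite ler1n.
have DR : 1 <= D%:R :> R by rewrite ler1n.
have t4 : theta <= 1 / 4 by nra.
have d4 : delta <= 1 / 4 by nra.
pose beta := theta * delta / 3.
have b0 : 0 < beta by rewrite divr_gt0 // mulr_gt0.
pose eta := beta / D.+1%:R.
have D1 : 0 < D.+1%:R :> R by rewrite ltr0n.
have eta0 : 0 < eta by rewrite divr_gt0.
have etab : eta * D.+1%:R = beta by rewrite divfK // gt_eqF.
have es0 : 0 < eta * s%:R by rewrite mulr_gt0 //; lra.
have [|a0 a0P] := @ex_nat_ge R (4 * D%:R ^+ 2 / (eta * s%:R)).
  by rewrite !(divr_ge0, mulr_ge0, exprn_ge0, ler0n) // ltW.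
pose K := (2 ^ a0 * N')%N.
pose Lam := 16 * D%:R ^+ 3 / (eta ^+ 2 * s%:R ^+ 2).
have Lam0 : 0 <= Lam.
  by rewrite !(divr_ge0, mulr_ge0, exprn_ge0, ler0n) // ltW.
have [|n1 n1P] := @ex_nat_ge R ((s ^ 2 + K + a0 * K)%:R / eta).
  by rewrite divr_ge0 ?ler0n // ltW.
have [|n2 n2P] := @ex_nat_ge R (Lam ^+ 2 * 2); first by rewrite mulr_ge0 // exprn_ge0.
exists (4 * s + n1 + n2 + 2 * N' + 1)%N => G x lam z x0 x1 xz lam0 xe lam2 sparse common nG.
set n : R := #|G|%:R.
have nN (m : nat) : (m <= 4 * s + n1 + n2 + 2 * N' + 1)%N -> m%:R <= n.
  by move=> le; rewrite ler_nat; apply: leq_trans nG.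
have n_4s : 4 * s%:R <= n by have := nN (4 * s)%N; rewrite natrM; apply; clear; lia.
have n_1 : 1 <= n by apply: (nN 1%N); clear; lia.
have n_large : (s ^ 2 + K + a0 * K)%:R <= eta * n.
  rewrite [leRHS]mulrC -ler_pdivrMr //; apply: le_trans n1P (nN n1 _); clear; lia.
have lamL : 16 * D%:R ^+ 3 <= eta ^+ 2 * s%:R ^+ 2 * lam.
  rewrite [leRHS]mulrC -ler_pdivrMr; last by rewrite -exprMn exprn_gt0.
  rewrite -/Lam -(ler_pXn2r (n := 2)) ?nnegrE //; last exact: ltW.
  apply: le_trans lam2; have : Lam ^+ 2 * 2 <= n.
    apply: le_trans n2P (nN n2 _); clear; lia.
  have h : n - s%:R <= s%:R * (n - s%:R) by apply: ler_peMl => //; lra.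
  rewrite -/n; lra.
pose A := [set v | eta <= x v].
have cA : (#|A| <= a0)%N.
  rewrite -(ler_nat R); apply: le_trans a0P; rewrite ler_pdivlMr //.
  exact: (card_large_entries_bounded x1 lam0 xe lam2 sparse s0 D0 eta0 n_4s lamL).
have deg u : (x u - beta) * n <= #|nbr u|%:R.
  by rewrite -etab; apply: (degree_lower x0 x1 xe lam2 sparse common s0 eta0 cA erefl n_large).
have defect u : u \in A -> (1 - x u) * #|nbr u|%:R <= beta * n.
  rewrite -etab => uA.
  exact: (degree_defect x0 x1 xz xe lam2 sparse common eta0 cA erefl n_large uA).
pose L := [set v | theta <= x v].
have eta_t : eta <= theta.
  have h : eta <= beta by rewrite -etab; apply: ler_peMr; [exact: ltW|rewrite ler1n].
  have : beta <= theta by rewrite /beta; nra.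
  lra.
have cardL := card_principal_ge x0 x1 xz xe lam2 sparse common eta0 cA erefl n_large eta_t (ltW t0).
rewrite etab -/L -/n in cardL.
have bt : beta * 3 = theta * delta by rewrite /beta; field.
have Lx u : u \in L -> 1 - delta <= x u /\ (1 - delta) * n <= #|nbr u|%:R.
  rewrite inE => tu; have uA : u \in A by rewrite inE (le_trans eta_t).
  have h1 := deg u; have h2 := defect u uA.
  have bt2 : beta <= theta / 2 by nra.
  have xu1 := x1 u.
  have h3 : (1 - x u) * (theta / 2 * n) <= beta * n.
    apply: le_trans h2; apply: ler_wpM2l; first lra.
    apply: le_trans h1; apply: ler_wpM2r; lra.
  have h4 : (1 - x u) * (theta / 2) <= beta.
    by rewrite -(ler_pM2r (lt_le_trans ltr01 n_1)) -mulrA.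
  have h5 : 1 - x u <= delta * 2 / 3.
    by rewrite -(ler_pM2r t0); lra.
  split; first lra.
  apply: le_trans h1; apply: ler_wpM2r; [lra|].
  have : beta <= delta / 3 by nra.
  lra.
exists L; split=> [|//|u]; last by rewrite inE -ltNge => /ltW.
apply/eqP; rewrite eqn_leq; apply/andP; split.
  rewrite leqNgt; apply/negP=> lt; have [L' sL cL'] := subset_of_card lt.
  have := @common_nbrs_card_ge R G L' delta.
  have -> : #|L'|%:R = s%:R + 1 :> R by rewrite cL' -addn1 natrD.
  move=> /(_ (fun l lL => proj2 (Lx l (subsetP sL l lL)))) h.
  have lt' : (s < #|L'|)%N by rewrite cL'.
  have := common L' lt'; rewrite -(ltr_nat R).
  have : 2 * N'%:R <= n by have := nN (2 * N')%N; rewrite natrM; apply; clear; lia.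
  have : n / 2 <= (1 - delta * (s%:R + 1)) * n.
    by rewrite mulrC; apply: ler_wpM2r; lra.
  rewrite -/n in h; lra.
have n0 : 0 < n by lra.
have {}cardL : s%:R <= #|L|%:R + theta * s%:R + beta by rewrite -(ler_pM2r n0).
have : beta <= 1 / 4 by nra.
move=> b4; have : s%:R < #|L|%:R + 1 :> R by lra.
by rewrite -[1]/(1%:R) -natrD ltr_nat addn1 ltnS.
Qed.

(** * Extremal graphs have gamma dominating vertices *)

Section Completion.
Variables (G : sgraph) (L U : {set G}).

Definition completion_adj : rel G :=
  [rel v w | (v != w) && [|| v \in L, w \in L | [&& v \in U, w \in U & v -- w]]].

Lemma completion_adj_sym : symmetric completion_adj.
Proof.
move=> v w; rewrite /completion_adj /= eq_sym (adj_sym v); congr (_ && _).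
by rewrite orbCA; congr (_ || (_ || _)); rewrite andbCA.
Qed.

Lemma completion_adj_irr : irreflexive completion_adj.
Proof. by move=> v; rewrite /completion_adj /= eqxx. Qed.

(** The competitor against which an extremal graph is measured. *)
Definition completion : sgraph := SGraph completion_adj_sym completion_adj_irr.
End Completion.

Section RayleighGain.
Variables (R : realType) (G : sgraph) (x : G -> R).
Hypothesis x_ge0 : forall v, 0 <= x v.

Lemma dot_nbr_sumE (G' : sgraph) (y : G' -> R) :
  dot y (nbr_sum y) = \sum_v \sum_w (v -- w)%:R * (y v * y w).
Proof.
apply: eq_bigr => v _; rewrite /nbr_sum mulr_sumr big_mkcond /=.
by apply: eq_bigr => w _; case: (v -- w); rewrite ?mul1r ?mul0r.
Qed.

Lemma completion_table (p1 p2 q1 q2 vL wL vU wU e : bool) :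
  p1 ==> [&& vL, ~~ wL & ~~ e] -> p2 ==> [&& wL, ~~ vL & ~~ e] ->
  q1 ==> [&& vL, wL & ~~ e] -> q2 ==> [&& wL, vL & ~~ e] -> ~~ (q1 && q2) ->
  ~~ (vL && vU) -> ~~ (wL && wU) ->
  (e + p1 + p2 + q1 + q2 <= [|| vL, wL | [&& vU, wU & e]] +
    [&& ~~ (vL || vU), e & ~~ wL] + [&& ~~ (wL || wU), e & ~~ vL])%N.
Proof. by case: p1 p2 q1 q2 vL wL vU wU e => [] [] [] [] [] [] [] [] []. Qed.

(** The adjacency matrices are compared pair by pair: T and m select one missing
    edge to L for each vertex of T, and c tells whether l l' is a missing edge of L. *)
Lemma completion_gain (L U : {set G}) (T : {set G}) (m : G -> G) (c : bool) (l l' : G) :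
  let C := ~: L in let W := ~: (L :|: U) in
  [disjoint L & U] -> T \subset C ->
  (forall r, r \in T -> m r \in L /\ ~~ (m r -- r)) ->
  (c -> [/\ l \in L, l' \in L, l != l' & ~~ (l -- l')]) ->
  dot x (nbr_sum x) + 2 * \sum_(r in T) x (m r) * x r + 2 * (c%:R * (x l * x l')) <=
  dot x (nbr_sum (G := completion L U) x) + 2 * \sum_(v in W) \sum_(w in nbr v :&: C) x v * x w.
Proof.
move=> C W dLU /subsetP TC mT cl.
pose g1 (v w : G) := (w \in T) && (v == m w).
pose g2 (v w : G) := c && (v == l) && (w == l').
pose lost (v w : G) := [&& v \in W, v -- w & w \in C].
have key v w : ((v -- w)%:R + (g1 v w)%:R + (g1 w v)%:R + (g2 v w)%:R + (g2 w v)%:R <=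
    (completion_adj L U v w)%:R + (lost v w)%:R + (lost w v)%:R :> R).
  rewrite -!natrD ler_nat /completion_adj /= /lost /g1 /g2 !inE (adj_sym w v).
  have [E|vw] := eqVneq v w.
    subst w; rewrite adj_irr /=.
    have -> : (v \in T) && (v == m v) = false.
      apply/negP=> /andP[vT /eqP E]; have := TC _ vT; have [mL _] := mT _ vT.
      by rewrite inE => /negP; apply; rewrite E.
    have -> : c && (v == l) && (v == l') = false.
      apply/negP=> /andP[/andP[c1 /eqP E1] /eqP E2]; have [_ _ + _] := cl c1.
      by rewrite -E1 -E2 eqxx.
    by [].
  have T1 a b : (b \in T) && (a == m b) -> [/\ a \in L, b \notin L & ~~ (a -- b)].
    by case/andP=> bT /eqP ->; have [-> ->] := mT _ bT; have := TC _ bT; rewrite inE => ->.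
  have C1 a b : c && (a == l) && (b == l') -> [/\ a \in L, b \in L & ~~ (a -- b)].
    by case/andP=> /andP[/cl[lL l'L _ nll'] /eqP -> /eqP ->].
  have C2 : c && (v == l) && (w == l') -> c && (w == l) && (v == l') = false.
    case/andP=> /andP[c1 /eqP E1] /eqP E2; apply/negP=> /andP[/andP[_ /eqP E3] _].
    by rewrite -E1 in E3; rewrite E3 eqxx in vw.
  have LU a : a \in L -> a \in U = false by move=> aL; rewrite (disjointFr dLU).
  apply: completion_table.
  - by apply/implyP=> /T1[-> -> ->].
  - by apply/implyP=> /T1[-> ->]; rewrite adj_sym => ->.
  - by apply/implyP=> /C1[-> -> ->].
  - by apply/implyP=> /C1[-> ->]; rewrite adj_sym => ->.
  - by apply/negP=> /andP[/C2 ->].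
  - by apply/negP=> /andP[/LU ->].
  - by apply/negP=> /andP[/LU ->].
have dotE : dot x (nbr_sum (G := completion L U) x) =
    \sum_v \sum_w (completion_adj L U v w)%:R * (x v * x w).
  exact: (@dot_nbr_sumE (completion L U) x).
rewrite dotE dot_nbr_sumE.
have sg1 : \sum_v \sum_w (g1 v w)%:R * (x v * x w) = \sum_(r in T) x (m r) * x r.
  rewrite exchange_big [RHS]big_mkcond /=; apply: eq_bigr => w _.
  rewrite /g1; case: ifP => wT /=; last by rewrite big1 // => v _; rewrite mul0r.
  by rewrite (bigD1 (m w)) //= eqxx mul1r big1 ?addr0 // => v /negbTE ->; rewrite mul0r.
have sg2 : \sum_v \sum_w (g2 v w)%:R * (x v * x w) = c%:R * (x l * x l').
  rewrite /g2 (bigD1 l) //= eqxx andbT (bigD1 l') //= eqxx andbT.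
  rewrite [X in _ + X + _]big1 => [|w /negbTE ->]; last by rewrite andbF mul0r.
  rewrite [X in _ + X]big1 ?addr0 // => v /negbTE vl.
  by rewrite big1 // => w _; rewrite vl andbF mul0r.
have slost : \sum_v \sum_w (lost v w)%:R * (x v * x w) =
    \sum_(v in W) \sum_(w in nbr v :&: C) x v * x w.
  rewrite [RHS]big_mkcond /=; apply: eq_bigr => v _; rewrite /lost.
  case: ifP => vW /=; last by rewrite big1 // => w _; rewrite mul0r.
  rewrite [RHS]big_mkcond /=; apply: eq_bigr => w _.
  by rewrite in_setI [w \in nbr v]inE; case: ifP; rewrite ?mul1r ?mul0r.
have tr (F : G -> G -> bool) : \sum_v \sum_w (F w v)%:R * (x v * x w) =
    \sum_v \sum_w (F v w)%:R * (x v * x w).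
  rewrite exchange_big /=; apply: eq_bigr => v _; apply: eq_bigr => w _.
  by rewrite [x w * _]mulrC.
rewrite -sg1 -sg2 -slost !mulr2n !mulrDl !mul1r -{2}(tr g1) -{2}(tr g2) -{2}(tr lost).
rewrite !addrA -!big_split /=; apply: ler_sum => v _; rewrite -!big_split /=.
apply: ler_sum => w _; rewrite -!mulrDl ler_wpM2r ?mulr_ge0 //.
Qed.

(** Peel off a vertex of degree at most D inside T. *)
Lemma sparse_form_le (D : nat) (theta : R) (T : {set G}) :
  (forall A : {set G}, (arcs_between A A <= D * #|A|)%N) -> 0 <= theta ->
  (forall v, v \in T -> x v <= theta) ->
  \sum_(v in T) \sum_(w in nbr v :&: T) x v * x w <= 2 * (D%:R * theta) * \sum_(v in T) x v.
Proof.
move=> sparse t0; have [n] := ubnP #|T|; elim: n T => // n IHn T leT xt.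
have [->|T0] := eqVneq T set0; first by rewrite !big_set0 mulr0.
have [r rT dr] : exists2 r, r \in T & (#|nbr r :&: T| <= D)%N.
  apply: contrapT => no; have := sparse T; rewrite leqNgt => /negP; apply.
  rewrite arcs_betweenE mulnC -sum_nat_const; apply: (@leq_trans (\sum_(v in T) D.+1)).
    by rewrite !sum_nat_const ltn_mul2l ltnSn andbT card_gt0.
  apply: leq_sum => v vT; rewrite ltnNge; apply/negP=> le; apply: no; by exists v.
pose T' := T :\ r.
have h1 : \sum_(v in T') \sum_(w in nbr v :&: T') x v * x w <= 2 * (D%:R * theta) * \sum_(v in T') x v.
  apply: IHn => [|v]; last by rewrite inE => /andP[_ /xt].
  by move: leT; rewrite (cardsD1 r) rT.
have h2 : \sum_(w in nbr r :&: T) x w <= D%:R * theta.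
  apply: (@le_trans _ _ (\sum_(w in nbr r :&: T) theta)).
    by apply: ler_sum => w; rewrite inE => /andP[_ /xt].
  by rewrite sumr_const -[leLHS]mulr_natl ler_wpM2r // ler_nat.
have E1 (F : G -> R) : \sum_(v in T) F v = F r + \sum_(v in T') F v.
  by rewrite (bigD1 r) //=; congr (_ + _); apply: eq_bigl => v; rewrite !inE andbC.
have E2 v : v \in T' -> \sum_(w in nbr v :&: T) x v * x w =
    \sum_(w in nbr v :&: T') x v * x w + (r -- v)%:R * (x v * x r).
  move=> vT'; rewrite addrC; case: (boolP (r -- v)) => rv.
    rewrite mul1r (bigD1 r) /=; last by rewrite !inE adj_sym rv.
    by congr (_ + _); apply: eq_bigl => w; rewrite !inE andbAC -andbA.
  rewrite mul0r add0r; apply: eq_bigl => w; rewrite !inE.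
  by have [->|//] := eqVneq w r; rewrite adj_sym (negbTE rv) andbF.
have E3 : \sum_(v in T') \sum_(w in nbr v :&: T) x v * x w = \sum_(v in T')
    (\sum_(w in nbr v :&: T') x v * x w + (r -- v)%:R * (x v * x r)) by apply: eq_bigr.
rewrite !E1 E3 big_split /= -mulr_sumr.
have -> : \sum_(v in T') (r -- v)%:R * (x v * x r) = x r * \sum_(w in nbr r :&: T) x w.
  rewrite mulr_sumr big_mkcond [RHS]big_mkcond /=; apply: eq_bigr => v _.
  rewrite !inE; have [->|_] := eqVneq v r; first by rewrite adj_irr.
  by case: (v \in T) (r -- v) => [] [] //=; rewrite ?mul0r // mul1r mulrC.
have := ler_wpM2l (x_ge0 r) h2; rewrite mulrDr; lra.
Qed.

(** A vertex outside L with many neighbours among the common neighbours of L would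
    contradict the bound for s + 1 vertices. *)
Lemma common_form_le (N' s : nat) (theta : R) (L T : {set G}) :
  (forall L' : {set G}, (s < #|L'|)%N -> (#|common_nbrs L'| < N')%N) -> #|L| = s ->
  (forall v, v \notin L -> x v <= theta) -> 0 <= theta -> [disjoint T & L] ->
  \sum_(v in T) \sum_(w in nbr v :&: common_nbrs L) x v * x w <= N'%:R * theta * \sum_(v in T) x v.
Proof.
move=> common cL xt t0 dTL; rewrite mulr_sumr; apply: ler_sum => v vT.
rewrite -mulr_sumr mulrC ler_wpM2r //.
apply: (@le_trans _ _ (\sum_(w in nbr v :&: common_nbrs L) theta)).
  apply: ler_sum => w; rewrite inE => /andP[_ wB]; apply: xt.
  by rewrite (disjointFl (common_nbrs_disjoint L) wB).
rewrite sumr_const -[leLHS]mulr_natl ler_wpM2r // ler_nat.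
have vL : v \notin L by rewrite (disjointFr dTL vT).
apply: leq_trans (ltnW (common (v |: L) _)); last by rewrite cardsU1 vL cL.
apply/subset_leq_card/subsetP=> w; rewrite inE => /andP[vw /common_nbrsP wB].
by apply/common_nbrsP=> u; rewrite !inE => /orP[/eqP->|/wB //]; rewrite inE in vw.
Qed.
End RayleighGain.

Section Dominating.
Variables (R : realType) (HH : graph_family).
Hypothesis HH_ex : exists H, HH H.
Hypothesis HH_deg : forall H, HH H -> (1 <= min_degree H)%N.
Hypothesis HH_star : forall H, HH H -> forall t : nat, ~ iso H (star t).
Hypothesis Gamma_connected : forall K, Gamma_family HH K -> connected K.

Let s := gamma_family HH.
Let Gam := Gamma_family HH.
Let Gam_card : forall K, Gam K -> (1 < #|K|)%N := Gamma_family_card HH_ex HH_deg HH_star.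

Lemma completion_HH_free (G : sgraph) (L U : {set G}) : (#|L| <= s)%N -> [disjoint L & U] ->
  minor_free Gam (induced U) -> minor_free HH (completion L U).
Proof.
move=> leL dLU freeU; apply: (@HH_free_of_Gamma_free HH HH_ex HH_deg HH_star (completion L U) L leL).
pose G1 := induced (G := completion L U) (~: L).
pose U1 : {set G1} := [set u | val u \in U].
have adjE (u v : G1) : u -- v -> [/\ val u \in U, val v \in U & @adj G (val u) (val v)].
  rewrite /= /induced_adj /= /completion_adj /= => /andP[_].
  by have := valP u; have := valP v; rewrite !inE => /negbTE-> /negbTE-> /= /and3P.
apply: (@minor_free_closed_union _ Gamma_connected Gam_card G1 U1).
- by move=> u v _ /adjE[_ vU _]; rewrite inE.
- pose j (u : induced U1) : induced U :=
    exist _ (val (val u)) (eq_ind _ is_true (valP u) _ (in_set _ _)).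
  apply: (@minor_free_embedding _ _ _ j) freeU; split=> [u v /(congr1 val) /= E|u v].
    by apply/val_inj/val_inj.
  by move/adjE=> [].
apply: minor_free_edgeless => // u v; apply/negP=> /adjE[uU _ _].
by have := valP u; rewrite !inE uU.
Qed.

(** The competitor is the join of L with an independent set; the entries
    sqrt (n - s) on L and sqrt s outside L give both sides the same weight. *)
Lemma spectral_radius_extremal (n : nat) (Gs : sgraph) : (s < n)%N -> SPEX R n HH Gs ->
  0 < spectral_radius R Gs /\
  s%:R * (n%:R - s%:R) <= spectral_radius R Gs ^+ 2.
Proof.
move=> sn [cG _ opt]; have s0 := gamma_family_gt0 HH_ex HH_deg HH_star.
have [|L _ cL] := @subset_of_card Gs setT s; first by rewrite cardsT cG ltnW.
pose G0 := completion L (set0 : {set Gs}).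
have free0 : minor_free HH G0.
  apply: completion_HH_free; [by rewrite cL|by rewrite -setI_eq0 setI0|].
  by apply: minor_free_edgeless => // u; have := valP u; rewrite inE.
have le0 := opt G0 cG free0.
have G0_gt0 : (0 < #|G0|)%N by rewrite [#|_|]cG; apply: leq_trans sn.
have [psd _] := @spectral_radius_max R G0 G0_gt0.
pose a : R := Num.sqrt (n%:R - s%:R); pose b : R := Num.sqrt s%:R.
have ns0 : 0 < n%:R - s%:R :> R by rewrite subr_gt0 ltr_nat.
have sR : 0 < s%:R :> R by rewrite ltr0n.
have a2 : a ^+ 2 = n%:R - s%:R by rewrite sqr_sqrtr // ltW.
have b2 : b ^+ 2 = s%:R by rewrite sqr_sqrtr // ltW.
have a0 : 0 < a by rewrite sqrtr_gt0.
have b0 : 0 < b by rewrite sqrtr_gt0.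
pose y (v : G0) : R := if v \in L then a else b.
have cC : #|~: L|%:R = n%:R - s%:R :> R.
  by rewrite -cG -(cardsC L) cL natrD addrC addKr.
have split_sum (F : Gs -> R) : \sum_v F v = \sum_(v in L) F v + \sum_(v in ~: L) F v.
  by rewrite (bigID (mem L)) /=; congr (_ + _); apply: eq_bigl => v; rewrite inE.
have yy : dot y y = 2 * s%:R * (n%:R - s%:R).
  rewrite /dot split_sum.
  rewrite (eq_bigr (fun=> a ^+ 2)) => [|v vL]; last by rewrite /y vL.
  rewrite [X in _ + X](eq_bigr (fun=> b ^+ 2)) => [|v]; last first.
    by rewrite inE /y => /negbTE->.
  by rewrite !sumr_const cL -[_ *+ s]mulr_natr -[_ *+ #|_|]mulr_natr cC a2 b2; ring.
have yAy : 2 * s%:R * (n%:R - s%:R) * (a * b) <= dot y (nbr_sum y).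
  rewrite /dot split_sum.
  have h1 : \sum_(v in L) a * ((n%:R - s%:R) * b) <= \sum_(v in L) y v * nbr_sum y v.
    apply: ler_sum => v vL; rewrite {1}/y vL ler_wpM2l //; first exact: ltW.
    rewrite -cC mulr_natl -sumr_const big_mkcond [leRHS]big_mkcond /=.
    apply: ler_sum => w _; rewrite inE /completion_adj /= vL /=.
    have [wL|wL] /= := boolP (w \in L).
      by case: ifP => // _; rewrite /y wL ltW.
    have -> : v != w by apply: contraNneq wL => <-.
    by rewrite /y (negbTE wL).
  have h2 : \sum_(v in ~: L) b * (s%:R * a) <= \sum_(v in ~: L) y v * nbr_sum y v.
    apply: ler_sum => v; rewrite inE => vL; rewrite {1}/y (negbTE vL) ler_wpM2l //; first exact: ltW.
    rewrite -cL mulr_natl -sumr_const big_mkcond [leRHS]big_mkcond /=.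
    apply: ler_sum => w _; rewrite /completion_adj /=.
    have [wL|wL] /= := boolP (w \in L).
      have -> : v != w by apply: contraNneq vL => ->.
      by rewrite orbT /y wL.
    by case: ifP => // _; rewrite /y (negbTE wL) ltW.
  apply: le_trans (lerD h1 h2); rewrite !sumr_const cL -[_ *+ s]mulr_natr -[_ *+ #|_|]mulr_natr cC.
  by rewrite le_eqVlt; apply/orP; left; apply/eqP; ring.
have ab : a * b <= spectral_radius R Gs.
  apply: le_trans le0; have := le_trans yAy (psd y).
  by rewrite yy mulrC ler_pM2r // !mulr_gt0.
have ab0 : 0 < a * b by rewrite mulr_gt0.
split; first exact: lt_le_trans ab.
by rewrite -a2 -b2 mulrC -exprMn ler_pXn2r ?nnegrE // ltW // (lt_le_trans ab0).
Qed.

Lemma dominating_card_le : exists n0, forall G : sgraph, minor_free HH G -> (n0 <= #|G|)%N ->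
  (#|dominating G| <= s)%N.
Proof.
have [N' common] := common_nbrs_bound HH_ex HH_deg HH_star.
exists (s.+1 + N')%N => G free nG; rewrite leqNgt; apply/negP=> lt.
have [L sL cL] := subset_of_card lt.
have := common G free L; rewrite cL ltnSn => /(_ isT); rewrite ltnNge => /negP; apply.
apply: (@leq_trans #|~: L|).
  by rewrite cardsCs setCK cL -(leq_add2l s.+1) subnKC //; apply: leq_trans nG; apply: leq_addr.
apply/subset_leq_card/subsetP=> v; rewrite inE => vL; apply/common_nbrsP=> l lL.
have := subsetP sL _ lL; rewrite inE => /forallP/(_ v)/implyP; apply.
by apply: contraNneq vL => ->.
Qed.

Lemma sum_cover_le (T : finType) (F : T -> R) (S A B : {set T}) :
  (forall v, 0 <= F v) -> S \subset A :|: B ->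
  \sum_(v in S) F v <= \sum_(v in A) F v + \sum_(v in B) F v.
Proof.
move=> F0 /subsetP sub; rewrite big_mkcond [X in _ <= X + _]big_mkcond [X in _ <= _ + X]big_mkcond.
rewrite -big_split /=; apply: ler_sum => v _; have := F0 v.
case: (boolP (v \in S)) => [/sub|_]; last by move=> *; apply: addr_ge0; case: ifP.
rewrite inE => /orP[->|->] Fv; first by rewrite lerDl; case: ifP.
by rewrite lerDr; case: ifP.
Qed.

Lemma form_sym (G : sgraph) (x : G -> R) (A B : {set G}) :
  \sum_(v in A) \sum_(w in nbr v :&: B) x v * x w =
  \sum_(v in B) \sum_(w in nbr v :&: A) x v * x w.
Proof.
under eq_bigr do rewrite big_mkcond; under [RHS]eq_bigr do rewrite big_mkcond.
rewrite big_mkcond [RHS]big_mkcond /=.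
rewrite (eq_bigr (fun v => \sum_w if [&& v -- w, v \in A & w \in B] then x v * x w else 0)); last first.
  move=> v _; case: ifP => vA; last by rewrite big1 // => w _; rewrite andbF.
  by apply: eq_bigr => w _; rewrite !inE.
rewrite exchange_big; apply: eq_bigr => v _ /=; case: ifP => vB; last first.
  by rewrite big1 // => w _; rewrite !andbF.
by apply: eq_bigr => w _; rewrite !inE andbT adj_sym mulrC.
Qed.

Lemma gain_arith (N d th S c M M1 W QB RB RR GR q1 q2 : R) :
  M + 2 * GR + 2 * q1 <= M1 + 2 * W -> M1 <= M -> W <= QB + 2 * RB + RR ->
  RB <= N * th * S -> QB <= q2 -> RR <= 2 * (d * th) * S -> c * S <= GR ->
  (4 * N + 4 * d) * th * S <= 1 / 2 * S ->
  2 * (c * S) + 2 * q1 <= 2 * q2 + S / 2.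
Proof. lra. Qed.

Lemma gain_arith0 (M M1 W QB RB RR GR : R) :
  M + 2 * GR <= M1 + 2 * W -> W <= QB + 2 * RB + RR ->
  RB <= 0 -> QB <= 0 -> RR <= 0 -> 0 <= GR -> M <= M1.
Proof. lra. Qed.

Lemma gain_arith1 (S cS q w : R) :
  2 * cS + 2 * q <= 2 * w + S / 2 -> 7 / 8 * S <= cS -> 0 <= S ->
  7 / 8 * (7 / 8) <= q -> w <= 1 / 8 * (1 / 4) -> False.
Proof. lra. Qed.

Lemma gain_arith2 (S cS : R) : 2 * cS <= S / 2 -> 7 / 8 * S <= cS -> S <= 0.
Proof. lra. Qed.

(** The competitor keeps the edges of the common neighbourhood B of L, except at the
    vertices of Q, which are needed as spare vertices when L is not a clique. Each
    vertex outside L and B gains an entry of L and loses only small entries. *)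
Lemma dominating_of_principal (Gs : sgraph) (n N' D : nat) (theta delta : R) (x : Gs -> R)
    (L : {set Gs}) :
  SPEX R n HH Gs ->
  (forall v, 0 <= x v) -> (forall v, nbr_sum x v = spectral_radius R Gs * x v) ->
  (forall A : {set Gs}, (arcs_between A A <= D * #|A|)%N) ->
  (forall L : {set Gs}, (s < #|L|)%N -> (#|common_nbrs L| < N')%N) ->
  #|L| = s ->
  (forall u, u \in L -> 1 - delta <= x u) -> (forall u, u \notin L -> x u <= theta) ->
  (s <= #|common_nbrs L|)%N ->
  0 <= theta -> 0 <= delta -> delta <= 1 / 8 ->
  (4 * N'%:R + 4 * D%:R) * theta <= 1 / 2 -> s%:R * theta <= 1 / 4 ->
  L \subset dominating Gs.
Proof.
move=> [cG freeG opt] x0 xe sparse common cL xL xt leB t0 d0 d8 c1 c2.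
have s0 := gamma_family_gt0 HH_ex HH_deg HH_star.
set rho := spectral_radius R Gs in xe.
pose B := common_nbrs L; pose Rm := ~: (L :|: B).
have dLB := common_nbrs_disjoint L.
pose clique := [forall l in L, forall l' in L, (l != l') ==> l -- l'].
have cliqueP : clique -> forall l l', l \in L -> l' \in L -> l != l' -> l -- l'.
  by move/forallP=> h l l' lL l'L; have /implyP/(_ lL)/forallP/(_ l')/implyP/(_ l'L)/implyP := h l.
have [Q sQB cQ] : exists2 Q : {set Gs}, Q \subset B & #|Q| = (~~ clique * s)%N.
  apply: subset_of_card; case: (clique) => /=; first by rewrite mul0n.
  by rewrite mul1n.
pose U := B :\: Q.
have sUB : U \subset B by apply: subsetDl.
have dLU : [disjoint L & U] by apply: disjointWr dLB.
have [l [l' ncl]] : exists l l', ~~ clique -> [/\ l \in L, l' \in L, l != l' & ~~ (l -- l')].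
  have /card_gt0P[l0 _] : (0 < #|L|)%N by rewrite cL.
  have [_|] := boolP clique; first by exists l0, l0.
  rewrite negb_forall => /existsP[l]; rewrite negb_imply => /andP[lL].
  rewrite negb_forall => /existsP[l']; rewrite negb_imply => /andP[l'L].
  by rewrite negb_imply => /andP[ll' nll']; exists l, l'.
have freeU : minor_free Gam (induced U).
  apply: (Gamma_free_join HH_ex HH_deg HH_star cL dLU _ _ freeG).
    by move=> a b aL /(subsetP sUB)/common_nbrsP; apply.
  case: (boolP clique) => cl; [by left; apply: cliqueP|right; exists Q; split].
  - by rewrite -setI_eq0 /U setIDA setDIl setDv set0I.
  - by apply: disjointWr dLB.
  - by rewrite cL cQ cl mul1n.
  - by move=> a q aL /(subsetP sQB)/common_nbrsP; apply.
pose G1 := completion L U.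
have le1 : spectral_radius R G1 <= rho.
  by apply: opt => //; apply: completion_HH_free => //; rewrite cL.
have G0 : (0 < #|G1|)%N by have := max_card L; rewrite cL; apply: leq_trans.
have [psd1 _] := @spectral_radius_max R G1 G0.
have psd y : dot y (nbr_sum (G := G1) y) <= rho * dot y y.
  by apply: le_trans (psd1 y) _; apply: ler_wpM2r le1; apply: dot_ge0.
pose m r := odflt r [pick l in L | ~~ (l -- r)].
have mP r : r \in Rm -> m r \in L /\ ~~ (m r -- r).
  rewrite inE in_setU negb_or => /andP[rL rB]; rewrite /m; case: pickP => [a /andP[]//|no].
  case/negP: rB; apply/common_nbrsP=> a aL; have := no a; rewrite /= aL /= => /negbT.
  by rewrite negbK.
have sRC : Rm \subset ~: L by rewrite setCS subsetUl.
have := completion_gain x0 dLU sRC mP ncl.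
set W := ~: (L :|: U); pose P (A A' : {set Gs}) := \sum_(v in A) \sum_(w in nbr v :&: A') x v * x w.
have P0 A' v : 0 <= \sum_(w in nbr v :&: A') x v * x w by apply: sumr_ge0 => w _; apply: mulr_ge0.
pose SR := \sum_(r in Rm) x r.
have SR0 : 0 <= SR by apply: sumr_ge0.
have CP : ~: L \subset B :|: Rm.
  by apply/subsetP=> v; rewrite !(in_setC, in_setU) negb_or => ->; case: (v \in B).
have coverC v : \sum_(w in nbr v :&: ~: L) x v * x w <=
    \sum_(w in nbr v :&: B) x v * x w + \sum_(w in nbr v :&: Rm) x v * x w.
  apply: sum_cover_le => [w|]; first exact: mulr_ge0.
  by rewrite -setIUr; apply: setIS.
have lostE : P W (~: L) <= P Q B + 2 * P Rm B + P Rm Rm.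
  have sW : W \subset Q :|: Rm.
    apply/subsetP=> v; rewrite !(in_setC, in_setU, in_setD) !negb_or negb_and negbK.
    by case: (v \in L) (v \in Q) (v \in B) => [] [] [].
  apply: le_trans (sum_cover_le _ sW) _; first exact: P0.
  have h1 : \sum_(v in Q) \sum_(w in nbr v :&: ~: L) x v * x w <= P Q B + P Rm Q.
    rewrite [P Rm Q]form_sym -big_split /=; apply: ler_sum => v _; exact: coverC.
  have h2 : \sum_(v in Rm) \sum_(w in nbr v :&: ~: L) x v * x w <= P Rm B + P Rm Rm.
    rewrite -big_split /=; apply: ler_sum => v _; exact: coverC.
  have h3 : P Rm Q <= P Rm B.
    apply: ler_sum => v _; rewrite [leRHS](big_setID Q) /= -setIA (setIidPr sQB) lerDl.
    by apply: sumr_ge0 => w _; apply: mulr_ge0.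
  by apply: le_trans (lerD h1 h2) _; lra.
have xR v : v \in Rm -> x v <= theta.
  by move=> /(subsetP sRC); rewrite inE; apply: xt.
have dRL : [disjoint Rm & L].
  by rewrite -setI_eq0 /Rm setCU -setIA [~: B :&: L]setIC setIA [~: L :&: L]setIC setICr set0I.
have hRB : P Rm B <= N'%:R * theta * SR := common_form_le x0 common cL xt t0 dRL.
have dQL : [disjoint Q & L] by rewrite disjoint_sym; apply: disjointWr dLB.
have hQB : P Q B <= N'%:R * theta * \sum_(v in Q) x v := common_form_le x0 common cL xt t0 dQL.
have hRR : P Rm Rm <= 2 * (D%:R * theta) * SR := sparse_form_le x0 sparse t0 xR.
have gainR : (1 - delta) * SR <= \sum_(r in Rm) x (m r) * x r.
  rewrite mulr_sumr; apply: ler_sum => r rR; apply: ler_wpM2r => //; apply: xL.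
  by have [] := mP r rR.
have xQ : \sum_(v in Q) x v <= (~~ clique)%:R * (s%:R * theta).
  apply: (@le_trans _ _ (\sum_(v in Q) theta)).
    by apply: ler_sum => v vQ; apply: xt; rewrite (disjointFr dQL vQ).
  by rewrite sumr_const cQ -[leLHS]mulr_natl natrM -mulrA.
rewrite -/(P W (~: L)) -/G1 => gain.
have Nt0 : 0 <= N'%:R * theta by rewrite mulr_ge0.
have Dt0 : 0 <= D%:R * theta by rewrite mulr_ge0.
have main : dot x (nbr_sum x) = rho * dot x x.
  by rewrite /dot mulr_sumr; apply: eq_bigr => v _; rewrite xe mulrCA.
have psdx := psd x; rewrite -[X in _ <= rho * X]/(dot (G := Gs) x x) in psdx.
rewrite main in gain.
have gain' : 2 * ((1 - delta) * SR) + 2 * ((~~ clique)%:R * (x l * x l')) <=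
    2 * (N'%:R * theta * ((~~ clique)%:R * (s%:R * theta))) + SR / 2.
  have h1 := ler_wpM2l Nt0 xQ.
  have h2 : (4 * N'%:R + 4 * D%:R) * theta * SR <= 1 / 2 * SR by apply: ler_wpM2r.
  exact: gain_arith gain psdx lostE hRB (le_trans hQB h1) hRR gainR h2.
have dR : 7 / 8 * SR <= (1 - delta) * SR by apply: ler_wpM2r => //; (clear xQ psdx gain lostE hRB hQB hRR gainR main psd psd1 coverC; lra).
have cl : clique.
  apply/negPn/negP=> ncl'; have [lL l'L _ _] := ncl ncl'.
  rewrite ncl' !mul1r in gain'.
  have h1 : 7 / 8 * (7 / 8) <= x l * x l'.
    by have := xL _ lL; have := xL _ l'L => *; apply: ler_pM; (clear xQ psdx gain lostE hRB hQB hRR gainR main psd psd1 coverC; lra).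
  have h2 : N'%:R * theta * (s%:R * theta) <= 1 / 8 * (1 / 4).
    by apply: ler_pM => //; [rewrite mulr_ge0|(clear xQ psdx gain lostE hRB hQB hRR gainR main psd psd1 coverC; lra)].
  exact: gain_arith1 gain' dR SR0 h1 h2.
have SRz : SR = 0.
  apply/eqP; rewrite eq_le SR0 andbT; rewrite cl !mul0r !mulr0 addr0 add0r in gain'.
  exact: gain_arith2 gain' dR.
have xRz r : r \in Rm -> x r = 0.
  move=> rR; apply/eqP; rewrite eq_le x0 andbT -SRz /SR (bigD1 r) //= lerDl.
  by apply: sumr_ge0.
have eig1 : rho * dot (G := G1) x x <= dot (G := G1) x (nbr_sum (G := G1) x).
  rewrite -[dot (G := G1) x x]/(dot (G := Gs) x x).
  rewrite SRz !mulr0 in hRB hRR.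
  have h0 : 0 <= \sum_(r in Rm) x (m r) * x r by apply: sumr_ge0 => r _; apply: mulr_ge0.
  have h1 : P Q B <= 0.
    apply: le_trans hQB _; apply: le_trans (ler_wpM2l Nt0 xQ) _.
    by rewrite cl mul0r mulr0.
  rewrite cl mul0r mulr0 addr0 in gain; rewrite -[dot (G := G1) x _]/(dot (G := Gs) x _).
  exact: gain_arith0 gain lostE hRB h1 hRR h0.
have noR : Rm = set0.
  apply/eqP/set0Pn=> -[r rR]; have := psd_isotropic psd eig1 r.
  rewrite xRz // mulr0; have /card_gt0P[a aL] : (0 < #|L|)%N by rewrite cL.
  have ra : @adj G1 r a.
    rewrite /= /completion_adj /= aL orbT andbT; apply: contraTneq aL => <-.
    by have := subsetP sRC _ rR; rewrite inE.
  rewrite /nbr_sum (bigD1 a) //= => E.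
  have : 7 / 8 <= x a by have := xL _ aL; (clear xQ psdx gain lostE hRB hQB hRR gainR main psd psd1 coverC; lra).
  have : 0 <= \sum_(i | (@adj G1 r i) && (i != a)) x i by apply: sumr_ge0.
  move: E; set S := \sum_(i | _) _; (clear xQ psdx gain lostE hRB hQB hRR gainR main psd psd1 coverC; lra).
apply/subsetP=> a aL; rewrite inE; apply/forallP=> v; apply/implyP=> va.
have [vL|vL] := boolP (v \in L); first by apply: cliqueP => //; rewrite eq_sym.
have : v \notin Rm by rewrite noR inE.
by rewrite inE negbK in_setU (negbTE vL) /= => /common_nbrsP; apply.
Qed.
End Dominating.

(** * The walk function *)

Lemma sub_of_add_eq (V : zmodType) (a b p q c : V) : a + p = c -> b + q = c -> a - b = q - p.
Proof. by move=> <- E; apply/eqP; rewrite subr_eq addrC addrA E addrK. Qed.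

Section WalkFunction.
Variables (R : realType) (lam : R).

(** Coordinatewise [z = sum_k (A / lam)^k 1], the generating function of the
    numbers of walks. *)
Definition walk_function (G : sgraph) (z : G -> R) : Prop :=
  forall v, lam * z v = lam + nbr_sum z v.

Definition max_degree_le (G : sgraph) (d : nat) : Prop := forall v : G, (#|nbr v| <= d)%N.

Section Bounds.
Variables (G : sgraph) (d : nat).
Hypotheses (deg : max_degree_le G d) (d_lt : d%:R < lam).

Lemma nbr_sum_le (y : G -> R) (c : R) v : 0 <= c -> (forall w, y w <= c) -> nbr_sum y v <= d%:R * c.
Proof.
move=> c0 yc; apply: (@le_trans _ _ (\sum_(w in nbr v) c)).
  by rewrite /nbr_sum big_mkcond [leRHS]big_mkcond; apply: ler_sum => w _; rewrite inE; case: ifP.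
by rewrite sumr_const -[leLHS]mulr_natl ler_wpM2r // ler_nat.
Qed.

Lemma ex_max_fun (y : G -> R) (v0 : G) : exists u, forall v, y v <= y u.
Proof.
exists [arg max_(i > v0) y i]%O.
by case: arg_maxP => // u _ h v; apply: h.
Qed.

Lemma walk_function_le (z : G -> R) v : walk_function z -> z v <= lam / (lam - d%:R).
Proof.
move=> zE; have [u uM] := ex_max_fun z v; apply: le_trans (uM v) _.
have ld : 0 < lam - d%:R by rewrite subr_gt0.
have d0 : 0 <= d%:R :> R by rewrite ler0n.
rewrite ler_pdivlMr //; have [zu|zu] := lerP (z u) 0; first by nra.
have := nbr_sum_le u (ltW zu) uM; have := zE u; lra.
Qed.

Lemma walk_function_ge1 (z : G -> R) v : walk_function z -> 1 <= z v.
Proof.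
move=> zE; have [u uM] := ex_max_fun (fun w => - z w) v.
have d0 : 0 <= d%:R :> R by rewrite ler0n.
have zu0 : 0 <= z u.
  rewrite leNgt; apply/negP=> zu.
  have zu' : 0 <= - z u by lra.
  have p : (lam - d%:R) * z u < 0 by rewrite pmulr_rlt0 // subr_gt0.
  have lam0 : 0 < lam by apply: le_lt_trans d_lt.
  have := nbr_sum_le u zu' uM; have := zE u; rewrite /nbr_sum sumrN mulrN lerN2.
  by move: p; rewrite mulrBl => p E h; lra.
have z0 w : 0 <= z w by have := uM w; lra.
have nn : 0 <= nbr_sum z v by apply: sumr_ge0.
have lam0 : 0 < lam by apply: le_lt_trans d_lt.
by rewrite -(ler_pM2l lam0) mulr1 zE lerDl.
Qed.

Lemma walk_function_exists : exists z : G -> R, walk_function z.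
Proof.
have [G0|G0] := posnP #|G|; first by exists (fun _ => 0) => v; have := card0_eq G0 v.
pose M := adjmx R G - lam%:M.
have unitM : M \in unitmx.
  rewrite -row_free_unit -kermx_eq0; apply: contraT => neig.
  have : eigenvalue (adjmx R G) lam by rewrite /eigenvalue /eigenspace.
  case/eigenvalue_adjmxP=> x [v0 xv0] xE.
  have [u uM] := ex_max_fun (fun w => `|x w|) v0.
  have xu0 : 0 < `|x u| by apply: lt_le_trans (uM v0); rewrite normr_gt0.
  have : `|nbr_sum x u| <= d%:R * `|x u|.
    apply: le_trans (ler_norm_sum _ _ _) _; exact: (nbr_sum_le u (ltW xu0) uM).
  have d0 : 0 <= d%:R :> R by rewrite ler0n.
  rewrite xE normrM ler_pM2r //; have := ler_norm lam.
  by move: d_lt => /[swap] h1 h2 /(le_trans h1) /(lt_le_trans h2); rewrite ltxx.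
pose r := (\row_i (- lam)) *m invmx M : 'rV[R]_#|G|.
exists (fun v => r 0 (enum_rank v)) => v.
have := mulmxKV unitM (\row_i (- lam)) => /rowP/(_ (enum_rank v)).
rewrite -/r mulmxBr mul_mx_scalar mxE [X in _ + X]mxE [X in - X]mxE [X in _ = X -> _]mxE.
have -> : (r *m adjmx R G) 0 (enum_rank v) = nbr_sum (fun v => r 0 (enum_rank v)) v.
  rewrite -[v in RHS]enum_rankK -mul_adjmx; congr ((_ *m _) 0 _).
  by apply/rowP=> i; rewrite [RHS]mxE enum_valK.
by move=> h; lra.
Qed.
End Bounds.

Section Exchange.
Variables (G : sgraph) (e : rel G) (e_sym : symmetric e) (e_irr : irreflexive e).
Let G2 := SGraph e_sym e_irr.
Variables (d : nat).
Hypotheses (deg1 : max_degree_le G d) (deg2 : max_degree_le G2 d) (d_lt : d%:R < lam).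

(** The difference of the sums is z2^T (A2 - A1) z1 / lam, and both vectors have
    entries between 1 and lam / (lam - d). *)
Lemma walk_exchange (z1 : G -> R) (z2 : G2 -> R) : walk_function z1 -> walk_function z2 ->
  #|[set p : G * G | e p.1 p.2 && ~~ (p.1 -- p.2)]|%:R <=
  lam * (\sum_v z2 v - \sum_v z1 v) +
  (lam / (lam - d%:R)) ^+ 2 * #|[set p : G * G | p.1 -- p.2 & ~~ e p.1 p.2]|%:R.
Proof.
move=> z1E z2E; set k := lam / _.
have z1_ge v := walk_function_ge1 deg1 d_lt v z1E.
have z2_ge v := walk_function_ge1 deg2 d_lt v z2E.
have z1_le v := walk_function_le deg1 d_lt v z1E.
have z2_le v := walk_function_le deg2 d_lt v z2E.
have id1 : \sum_v z2 v * (lam + nbr_sum z1 v) = lam * \sum_v z2 v * z1 v.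
  by rewrite mulr_sumr; apply: eq_bigr => v _; rewrite -z1E mulrCA.
have id2 : \sum_v z1 v * (lam + nbr_sum z2 v) = lam * \sum_v z2 v * z1 v.
  by rewrite mulr_sumr; apply: eq_bigr => v _; rewrite -z2E mulrCA [z1 v * _]mulrC.
have id3 : lam * (\sum_v z2 v - \sum_v z1 v) =
    \sum_v \sum_w ((e v w)%:R - (@adj G v w)%:R) * (z2 v * z1 w).
  have h1 : \sum_v z2 v * nbr_sum z1 v = \sum_v \sum_w (@adj G v w)%:R * (z2 v * z1 w).
    apply: eq_bigr => v _; rewrite /nbr_sum mulr_sumr big_mkcond /=.
    by apply: eq_bigr => w _; case: (@adj G v w); rewrite ?mul1r ?mul0r.
  have h2 : \sum_v z1 v * nbr_sum z2 v = \sum_v \sum_w (e v w)%:R * (z2 v * z1 w).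
    rewrite exchange_big; apply: eq_bigr => v _; rewrite /nbr_sum mulr_sumr big_mkcond /=.
    apply: eq_bigr => w _; rewrite (e_sym w v) [z2 w * _]mulrC.
    by case: (e v w); rewrite ?mul1r ?mul0r.
  under [RHS]eq_bigr do (under eq_bigr do rewrite mulrBl; rewrite sumrB).
  rewrite sumrB -h1 -h2.
  have id1' : lam * \sum_v z2 v + \sum_v z2 v * nbr_sum z1 v = lam * \sum_v z2 v * z1 v.
    rewrite -id1 mulr_sumr -big_split; apply: eq_bigr => v _ /=.
    by rewrite mulrDr [lam * _]mulrC.
  have id2' : lam * \sum_v z1 v + \sum_v z1 v * nbr_sum z2 v = lam * \sum_v z2 v * z1 v.
    rewrite -id2 mulr_sumr -big_split; apply: eq_bigr => v _ /=.
    by rewrite mulrDr [lam * _]mulrC.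
  move: id1' id2'; rewrite mulrBr => E1 E2.
  exact: sub_of_add_eq E1 E2.
rewrite id3; have count (P : pred (G * G)) : #|[set p | P p]|%:R = \sum_v \sum_w (P (v, w))%:R :> R.
  rewrite pair_big /= -sum1_card natr_sum big_mkcond /=; apply: eq_bigr => -[v w] _.
  by rewrite inE; case: (P _).
rewrite (count (fun p => e p.1 p.2 && ~~ (p.1 -- p.2))) (count (fun p => p.1 -- p.2 && ~~ e p.1 p.2)).
rewrite mulr_sumr -big_split /=; apply: ler_sum => v _.
rewrite mulr_sumr -big_split /=; apply: ler_sum => w _.
have zz1 : 1 <= z2 v * z1 w by rewrite -[1]mulr1; apply: ler_pM.
have zz2 : z2 v * z1 w <= k ^+ 2.
  by rewrite expr2; apply: ler_pM => //; apply: le_trans ler01 _.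
by case: (e v w) (@adj G v w) => [] []; rewrite /= ?subrr ?mul0r ?mulr0 ?addr0 ?subr0 ?sub0r ?mul1r ?mulr1 ?mulN1r; lra.
Qed.
End Exchange.
End WalkFunction.

Definition walk_optimal (R : realType) (lam : R) (Fam : graph_family) (G : sgraph) : Prop :=
  exists2 z : G -> R, walk_function lam z &
    forall (F : sgraph) (zF : F -> R), #|F| = #|G| -> minor_free Fam F ->
      walk_function lam zF -> \sum_v zF v <= \sum_v z v.

Section ExtremalStructure.
Variables (R : realType) (HH : graph_family).
Hypothesis HH_ex : exists H, HH H.
Hypothesis HH_deg : forall H, HH H -> (1 <= min_degree H)%N.
Hypothesis HH_star : forall H, HH H -> forall t : nat, ~ iso H (star t).
Hypothesis Gamma_connected : forall K, Gamma_family HH K -> connected K.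

Let s := gamma_family HH.

Lemma perron_vector (G : sgraph) : (0 < #|G|)%N -> exists (x : G -> R) (z : G),
  [/\ forall v, 0 <= x v, forall v, x v <= 1, x z = 1 &
      forall v, nbr_sum x v = spectral_radius R G * x v].
Proof.
move=> G0; have [_ [x [x0 [v xv]] xE]] := @spectral_radius_max R G G0.
have [z zM] := ex_max_fun x v; have xz : 0 < x z by apply: lt_le_trans (zM v).
exists (fun u => x u / x z), z; split=> [u|u||u].
- by rewrite divr_ge0 // ltW.
- by rewrite ler_pdivrMr // mul1r.
- by rewrite divff // gt_eqF.
by rewrite mulrA -xE /nbr_sum mulr_suml.
Qed.

Lemma extremal_dominating : exists n0, forall n, (n0 <= n)%N -> forall Gs, SPEX R n HH Gs ->
  #|dominating Gs| = s.
Proof.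
have s0 := gamma_family_gt0 HH_ex HH_deg HH_star; rewrite -/s in s0.
have [H HHH] := HH_ex.
have [D0 sparse0] := sparse_of_minor_free HHH; pose D := D0.+1.
have [N' common] := common_nbrs_bound HH_ex HH_deg HH_star.
have [n2 dom_le] := dominating_card_le HH_ex HH_deg HH_star.
pose theta : R := 1 / (16 * (N' + D + s)%:R); pose delta : R := 1 / (8 * (s%:R + 1)).
have sR : 1 <= s%:R :> R by rewrite ler1n.
have DR : 1 <= D%:R :> R by rewrite ler1n.
have N0 : 0 <= N'%:R :> R by rewrite ler0n.
have M0 : 0 < (N' + D + s)%:R :> R by rewrite !natrD; lra.
have t0 : 0 < theta by rewrite divr_gt0 // mulr_gt0.
have tM : theta * (N' + D + s)%:R = 1 / 16 
  by rewrite /theta; move: (N' + D + s)%:R M0 => M M0; field; rewrite gt_eqF.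
have d0 : 0 < delta by rewrite divr_gt0 // mulr_gt0 //; lra.
have dM : delta * (s%:R + 1) = 1 / 8 by rewrite /delta; field; rewrite gt_eqF //; lra.
rewrite !natrD !mulrDr in tM.
have tN : 0 <= theta * N'%:R by rewrite mulr_ge0 // ltW.
have tD : 0 <= theta * D%:R by rewrite mulr_ge0 ?ler0n // ltW.
have ts : 0 <= theta * s%:R by rewrite mulr_ge0 ?ler0n // ltW.
have ts4 : theta * s%:R <= 1 / 4 by lra.
have ds2 : delta * (s%:R + 1) <= 1 / 2 by lra.
have [n1 principal] := @principal_vertices R s D N' theta delta s0 isT t0 ts4 d0 ds2.
exists (n1 + n2 + 2 * s + 1)%N => n le_n Gs spexG.
have [n_1 n_2 n_2s n_s] : [/\ (n1 <= n)%N, (n2 <= n)%N, (2 * s <= n)%N & (s < n)%N].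
  by move: le_n s0; clear => le_n s0; split; lia.
have [cG freeG opt] := spexG.
have [rho0 rho2] := spectral_radius_extremal HH_ex HH_deg HH_star Gamma_connected n_s spexG.
have [|x [z [x0 x1 xz xE]]] := @perron_vector Gs; first by rewrite cG; apply: leq_trans n_s.
have sparse (A : {set Gs}) : (arcs_between A A <= D * #|A|)%N.
  by apply: leq_trans (sparse0 Gs freeG A) _; rewrite leq_mul2r leqnSn orbT.
have commonG (L : {set Gs}) : (s < #|L|)%N -> (#|common_nbrs L| < N')%N by apply: common.
have [||L [cL Lx Lt]] := principal Gs x _ z x0 x1 xz rho0 xE _ sparse commonG _.
- by rewrite cG.
- by rewrite cG.
have leB : (s <= #|common_nbrs L|)%N.
  have := @common_nbrs_card_ge R Gs L delta (fun l lL => proj2 (Lx l lL)).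
  rewrite cL cG -(ler_nat R); apply: le_trans.
  have : 2 * s%:R <= n%:R :> R by rewrite -natrM ler_nat.
  have h : 1 / 2 <= 1 - delta * s%:R by lra.
  have n0 : 0 <= n%:R :> R by rewrite ler0n.
  have := ler_wpM2r n0 h; lra.
have Ldom : L \subset dominating Gs.
  apply: (dominating_of_principal HH_ex HH_deg HH_star Gamma_connected spexG x0 xE sparse commonG
    cL (fun l lL => proj1 (Lx l lL)) Lt leB (ltW t0) (ltW d0)).
  - have h : 0 <= delta * s%:R by rewrite mulr_ge0 ?ler0n // ltW.
    by lra.
  - by rewrite mulrC mulrDr; lra.
  - by rewrite mulrC.
apply/eqP; rewrite eqn_leq -{2}cL subset_leq_card // andbT.
by apply: dom_le; rewrite ?cG.
Qed.

Lemma sum_split_val (T : finType) (L : {set T}) (F : T -> R) :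
  \sum_v F v = \sum_(v in L) F v + \sum_(v : {v : T | v \in ~: L}) F (val v).
Proof.
rewrite (bigID (mem L)) /=; congr (_ + _).
rewrite (eq_bigl (fun v => v \in ~: L)) => [|v]; last by rewrite inE.
exact: (big_sub (mem (~: L)) F).
Qed.

Lemma nbr_sum_dominating (G : sgraph) (y : G -> R) l : (forall v, v != l -> l -- v) ->
  nbr_sum y l = \sum_v y v - y l.
Proof.
move=> dom; rewrite [in RHS](bigD1 l) //= addrAC subrr add0r /nbr_sum; apply: eq_bigl => v.
by have [->|/dom //] := eqVneq v l; rewrite adj_irr.
Qed.

Lemma nbr_sum_join (G : sgraph) (L : {set G}) (y : G -> R) :
  (forall l v, l \in L -> v != l -> l -- v) ->
  forall v : induced (~: L), nbr_sum y (val v) =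
    \sum_(l in L) y l + nbr_sum (G := induced (~: L)) (y \o val) v.
Proof.
move=> dom v; rewrite /nbr_sum big_mkcond (sum_split_val L) /=; congr (_ + _); last first.
  by rewrite [RHS]big_mkcond.
apply: eq_bigr => l lL; rewrite adj_sym dom //.
by apply: contraTneq lL => <-; have := valP v; rewrite inE.
Qed.

Lemma ex_injection (T1 T2 : finType) (A : {set T1}) : #|A| = #|T2| -> (0 < #|T2|)%N ->
  exists g : T1 -> T2, {in A &, injective g} /\ (forall t, exists2 a, a \in A & g a = t).
Proof.
move=> cA /card_gt0P[t0 _].
have [|g [gE gS ginj gD]] := @partial_injection T2 T1 setT A; first by rewrite cardsT cA.
have {}gD := gD (etrans (cardsT _) (esym cA)).
exists (fun a => odflt t0 (g a)); split=> [a b aA bA|t].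
  have [s1 _ E1] := gD a aA; have [s2 _ E2] := gD b bA.
  by rewrite E1 E2 /= => E; apply: (ginj a b s1) => //; rewrite E2 E.
by have [a aA E] := gS t (in_setT t); exists a; rewrite ?E.
Qed.

(** Both sides of the inequality are read off the eigenvalue equation of the
    join of gamma dominating vertices with the graph in question. *)
Lemma extremal_walk_optimal (n : nat) (Gs : sgraph) : (s < n)%N -> SPEX R n HH Gs ->
  #|dominating Gs| = s ->
  walk_optimal (spectral_radius R Gs) (Gamma_family HH) (induced (~: dominating Gs)).
Proof.
move=> sn spexG cD; set L := dominating Gs in cD *; set G' := induced (~: L).
have s0 := gamma_family_gt0 HH_ex HH_deg HH_star; rewrite -/s in s0.
have sR : 0 < s%:R :> R by rewrite ltr0n.
have [cG freeG opt] := spexG; set rho := spectral_radius R Gs.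
have [rho0 _] := spectral_radius_extremal HH_ex HH_deg HH_star Gamma_connected sn spexG.
have G_gt0 : (0 < #|Gs|)%N by rewrite cG; apply: leq_trans sn.
have [x [z [x0 _ xz xE]]] := @perron_vector Gs G_gt0.
rewrite -/rho in rho0 xE.
have domP l v : l \in L -> v != l -> l -- v by rewrite inE => /forallP/(_ v)/implyP.
pose sigma := \sum_v x v; pose a := sigma / (rho + 1).
have sig0 : 0 < sigma.
  apply: (@lt_le_trans _ _ (x z)); first by rewrite xz.
  by rewrite /sigma (bigD1 z) //= lerDl; apply: sumr_ge0.
have rho1 : 0 < rho + 1 by rewrite addr_gt0.
have a0 : 0 < a by rewrite divr_gt0.
have sigE : sigma = (rho + 1) * a by rewrite /a mulrC divfK // gt_eqF.
have xL l : l \in L -> x l = a.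
  move=> lL; have := xE l; rewrite nbr_sum_dominating => [|v]; last exact: domP.
  move/eqP; rewrite subr_eq -/sigma -[X in _ + X]mul1r -mulrDl => /eqP E.
  by rewrite /a E [_ * x l]mulrC mulfK // gt_eqF.
have sumL (y : Gs -> R) c : (forall l, l \in L -> y l = c) -> \sum_(l in L) y l = s%:R * c.
  by move=> yc; rewrite (eq_bigr (fun=> c)) // sumr_const cD mulr_natl.
have k0 : 0 < rho / (s%:R * a) by rewrite divr_gt0 // mulr_gt0.
pose z' (v : G') := rho / (s%:R * a) * x (val v).
have sigE' : sigma = s%:R * a + s%:R * a / rho * \sum_v z' v.
  rewrite /sigma (sum_split_val L) (sumL x a xL); congr (_ + _).
  rewrite /z' -mulr_sumr mulrA (_ : _ / rho * _ = 1) ?mul1r //.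
  by field; rewrite !gt_eqF.
exists z' => [v|F zF cF freeF zFE].
  have := xE (val v); rewrite (nbr_sum_join _ domP) (sumL x a xL) => E.
  have -> : nbr_sum z' v = rho / (s%:R * a) * nbr_sum (G := G') (x \o val) v.
    by rewrite /nbr_sum mulr_sumr.
  rewrite /z' mulrCA -E mulrDr; congr (_ + _).
  by field; rewrite !gt_eqF.
have cC : #|~: L| = #|F| by rewrite cF card_induced.
have F_gt0 : (0 < #|F|)%N by rewrite -cC cardsCs setCK cD cG subn_gt0.
have [g [ginj gsurj]] := ex_injection cC F_gt0.
pose Gp := patch (~: L) g; pose G1 := completion (G := Gp) L (~: L).
have free1 : minor_free HH G1.
  apply: completion_HH_free => //; first by rewrite cD.
    by rewrite disjoint_subset; apply/subsetP=> v; rewrite !inE negbK.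
  apply: (@minor_free_embedding _ (induced (G := Gp) (~: L)) F (g \o val)) freeF.
  split=> [u v E|u v]; first by apply/val_inj/ginj => //; apply: valP.
  by rewrite /= /induced_adj /= /patch_adj /= (valP u) (valP v).
have le1 : spectral_radius R G1 <= rho by apply: opt.
have G1_gt0 : (0 < #|G1|)%N by [].
have [psd1 _] := @spectral_radius_max R G1 G1_gt0.
have dom1 (l v : G1) : l \in L -> v != l -> l -- v.
  by move=> lL vl; rewrite /= /completion_adj /= lL eq_sym vl.
pose y (v : G1) : R := if v \in L then 1 else s%:R / rho * zF (g v).
pose G1' := induced (G := G1) (~: L).
have yN (v : G1') : y (val v) = s%:R / rho * zF (g (val v)).
  by rewrite /y; have := valP v; rewrite inE => /negbTE ->.
have gbij : bijective (g \o val : G1' -> F).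
  apply: inj_card_bij; last by rewrite -cC card_induced.
  by move=> u v /= E; apply/val_inj/ginj => //; apply: valP.
have adj1 (u v : G1') : u -- v = (g (val u) -- g (val v)).
  rewrite /= /induced_adj /= /completion_adj /= /patch_adj /=.
  have := valP u; have := valP v; rewrite !inE => /negbTE-> /negbTE-> /=.
  by case: eqVneq => [->|//]; rewrite adj_irr.
have sumy : \sum_(v : G1') y (val v) = s%:R / rho * \sum_v zF v.
  rewrite mulr_sumr (reindex (g \o val : G1' -> F)) /=; last exact: onW_bij.
  by apply: eq_bigr => v _; rewrite yN.
have sumL1 : \sum_(l in L) y l = s%:R.
  rewrite (eq_bigr (fun=> 1)) => [|l lL]; last by rewrite /y lL.
  by rewrite sumr_const cD.
have yA (v : G1') : nbr_sum y (val v) = rho * y (val v).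
  rewrite (@nbr_sum_join G1 L y dom1) sumL1 yN.
  have -> : nbr_sum (G := G1') (y \o val) v = s%:R / rho * nbr_sum zF (g (val v)).
    rewrite /nbr_sum mulr_sumr (reindex (g \o val : G1' -> F)) /=; last exact: onW_bij.
    by apply: eq_big => [w|w _]; [exact: (adj1 v w)|rewrite /= yN].
  have := zFE (g (val v)) => E.
  have -> : nbr_sum zF (g (val v)) = rho * zF (g (val v)) - rho by rewrite E addrC addKr.
  by field; rewrite gt_eqF.
have := psd1 y; rewrite {1}/dot (sum_split_val L).
have -> : \sum_(v in L) y v * nbr_sum y v = s%:R * (s%:R + s%:R / rho * \sum_v zF v - 1).
  rewrite -cD mulr_natl -sumr_const; apply: eq_bigr => l lL.
  rewrite nbr_sum_dominating => [|v]; last exact: dom1.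
  by rewrite (sum_split_val L) sumL1 sumy /y lL mul1r cD.
have -> : \sum_(v : G1') y (val v) * nbr_sum y (val v) = rho * \sum_(v : G1') y (val v) * y (val v).
  by rewrite mulr_sumr; apply: eq_bigr => v _; rewrite yA mulrCA.
have dotE : dot y y = s%:R + \sum_(v : G1') y (val v) * y (val v).
  rewrite /dot (sum_split_val L); congr (_ + _).
  by rewrite -sumL1; apply: eq_bigr => l lL; rewrite /y lL mul1r.
move=> h; have {h} := le_trans h (ler_wpM2r (dot_ge0 y) le1).
rewrite dotE [rho * (_ + _)]mulrDr lerD2r [rho * _]mulrC ler_pM2l // => h.
have E : rho + 1 = s%:R + s%:R / rho * \sum_v z' v.
  apply: (mulIf (lt0r_neq0 a0)); rewrite -sigE sigE'; ring.
have {}h : s%:R / rho * \sum_v zF v <= s%:R / rho * \sum_v z' v.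
  by rewrite -(lerD2l s%:R) -E -lerBlDr.
by rewrite ler_pM2l // divr_gt0 in h.
Qed.
End ExtremalStructure.

Local Open Scope nat_scope.

(** * Edge exchanges in walk-optimal graphs *)

Lemma arcs_edges (G : sgraph) : arcs G = 2 * #|edges G|.
Proof.
pose e (p : G * G) := [set p.1; p.2].
rewrite /arcs -sum1_card (partition_big e (mem (edges G))) /= => [|[x y]]; last first.
  by rewrite inE /= /e /= edges_adj.
rewrite mulnC -sum_nat_const; apply: eq_bigr => E.
rewrite inE => /existsP[x /existsP[y /andP[xy /eqP ->]]].
have xny : x != y by apply: contraTneq xy => ->; rewrite adj_irr.
rewrite sum1_card (eq_card (B := [set (x, y); (y, x)])).
  by rewrite cards2 xpair_eqE negb_and xny.
move=> [a b]; rewrite -[LHS]topredE /= !inE /= /e /=; apply/andP/orP.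
  case=> ab /eqP E'; have : a \in [set x; y] by rewrite -E' !inE eqxx.
  have : b \in [set x; y] by rewrite -E' !inE eqxx orbT.
  by rewrite !inE => /orP[]/eqP Eb /orP[]/eqP Ea; rewrite Ea Eb ?adj_irr in ab *; auto.
by case=> /eqP[-> ->]; rewrite ?xy ?eqxx // adj_sym xy setUC.
Qed.

Definition closed_set (G : sgraph) (U : {set G}) : Prop :=
  forall x y, x \in U -> x -- y -> y \in U.

Lemma closed_setC (G : sgraph) (U : {set G}) : closed_set U -> closed_set (~: U).
Proof.
move=> cl x y; rewrite !inE => xU xy; apply: contra xU => yU; apply: cl yU _.
by rewrite adj_sym.
Qed.

Lemma closed_setU (G : sgraph) (U V : {set G}) :
  closed_set U -> closed_set V -> closed_set (U :|: V).
Proof.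
move=> cU cV x y; rewrite !inE => /orP[xU|xV] xy; first by rewrite (cU _ _ xU xy).
by rewrite (cV _ _ xV xy) orbT.
Qed.

Lemma closed_setD (G : sgraph) (U V : {set G}) :
  closed_set U -> closed_set V -> closed_set (U :\: V).
Proof.
move=> cU /closed_setC cV x y; rewrite !inE => /andP[xV xU] xy.
have := cV x y; rewrite !inE => /(_ xV xy) ->; exact: cU xU xy.
Qed.

Lemma arcs_between_closed (G : sgraph) (U V : {set G}) : closed_set V -> V \subset U ->
  arcs_between U U = arcs_between V V + arcs_between (U :\: V) (U :\: V).
Proof.
move=> cV /subsetP VU; rewrite /arcs_between -(cardsID (setX V V)); congr (_ + _).
  apply: eq_card => -[a b]; rewrite !inE /=.
  have [aV|_] := boolP (a \in V); last by rewrite /= !andbF.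
  have [bV|_] := boolP (b \in V); last by rewrite /= !andbF.
  by rewrite (VU _ aV) (VU _ bV) !andbT.
apply: eq_card => -[a b]; rewrite !inE /=.
case: (boolP (a -- b)) => [ab|]; rewrite ?andbF //=.
have -> : (b \in V) = (a \in V).
  by apply/idP/idP=> [bV|aV]; [apply: cV bV _; rewrite adj_sym|apply: cV aV ab].
by case: (a \in V) => //=; rewrite andbT.
Qed.

Lemma arcs_closed (G : sgraph) (U : {set G}) : closed_set U ->
  arcs G = arcs_between U U + arcs_between (~: U) (~: U).
Proof. by move=> cU; rewrite arcsT (arcs_between_closed cU (subsetT _)) setTD. Qed.

Lemma arcs_between_le_degree (G : sgraph) d (U V : {set G}) : max_degree_le G d ->
  arcs_between U V <= d * #|U|.
Proof.
move=> deg; rewrite arcs_betweenE mulnC -sum_nat_const; apply: leq_sum => v _.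
by apply: leq_trans (deg v); apply: subset_leq_card; apply: subsetIl.
Qed.

Section GraphSum.
Variables (G1 G2 : sgraph).

Definition graph_sum_adj : rel (G1 + G2) := fun u v =>
  match u, v with
  | inl x, inl y => x -- y
  | inr x, inr y => x -- y
  | _, _ => false
  end.
Lemma graph_sum_adj_sym : symmetric graph_sum_adj.
Proof. by move=> [x|x] [y|y] //=; apply: adj_sym. Qed.
Lemma graph_sum_adj_irr : irreflexive graph_sum_adj.
Proof. by move=> [x|x] /=; apply: adj_irr. Qed.
Definition graph_sum : sgraph := SGraph graph_sum_adj_sym graph_sum_adj_irr.

Lemma card_graph_sum : #|graph_sum| = #|G1| + #|G2|.
Proof. exact: card_sum. Qed.

Lemma arcs_graph_sum : arcs graph_sum = arcs G1 + arcs G2.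
Proof.
have E u : #|nbr (u : graph_sum)| = match u with inl x => #|nbr x| | inr x => #|nbr x| end.
  case: u => x; [rewrite -(card_imset (nbr x) (@inl_inj G1 G2))|
                 rewrite -(card_imset (nbr x) (@inr_inj G1 G2))];
  apply: eq_card => -[y|y]; rewrite inE /=; apply/esym.
  - by rewrite mem_imset ?inE //; apply: inl_inj.
  - by apply/imsetP=> -[].
  - by apply/imsetP=> -[].
  - by rewrite mem_imset ?inE //; apply: inr_inj.
rewrite !arcs_sum (eq_bigr _ (fun u _ => E u)) big_sumType /=.
by congr (_ + _); apply: eq_bigr.
Qed.
End GraphSum.

Lemma minor_trans (K H G : sgraph) : minor K H -> minor H G -> minor K G.
Proof.
move=> mKH; elim=> {G} [G isoHG|G v _|G x y xy _|G x y xy _].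
- case: isoHG => f fbij fadj; apply: has_model_minor.
  apply: (has_model_embedding (j := f)) (minor_has_model mKH).
  by split=> [|a b]; [apply: bij_inj|rewrite fadj].
- exact: minor_del_vertex.
- exact: minor_del_edge xy.
- exact: minor_contract xy.
Qed.

(** Contracting an edge that lies in no triangle removes one vertex and one edge. *)
Lemma triangle_minor (G : sgraph) : 0 < #|G| -> 2 * #|G| <= arcs G -> has_model (complete 3) G.
Proof.
have [n] := ubnP #|G|; elim: n G => // n IHn G; rewrite ltnS => leGn G0 dense.
have : 0 < arcs G by apply: leq_trans dense; rewrite muln_gt0.
case/card_gt0P=> -[x y]; rewrite inE /= => xy.
have [no|[w]] := set_0Vmem (nbr x :&: nbr y); last first.
  rewrite !inE => /andP[xw yw].
  apply: (has_model_embedding (j := fun i : complete 3 => nth x [:: x; y; w] i)); last first.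
    by apply: has_model_iso; exists id => //; exists id.
  have xny : x != y by apply: contraTneq xy => ->; rewrite adj_irr.
  have xnw : x != w by apply: contraTneq xw => ->; rewrite adj_irr.
  have ynw : y != w by apply: contraTneq yw => ->; rewrite adj_irr.
  split=> [i j /eqP|i j]; rewrite ?nth_uniq //= ?inE ?negb_or ?xny ?xnw ?ynw //.
    by move/eqP/val_inj.
  rewrite /complete_adj /=.
  by case: i => [[|[|[|//]]] ?]; case: j => [[|[|[|//]]] ?] //= _;
    rewrite ?xy ?xw ?yw // adj_sym ?xy ?xw ?yw.
have xny : x != y by apply: contraTneq xy => ->; rewrite adj_irr.
have G1 : 1 < #|G| by rewrite (cardD1 x) (cardD1 y) !inE eq_sym xny.
apply: (has_model_contract xy); apply: IHn; rewrite card_contract; [lia|lia|].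
have := arcs_contract xy; rewrite no cards0; move: dense G1; clear; lia.
Qed.

Section FreeFamily.
Variable Fam : graph_family.
Hypothesis Fam_connected : forall K, Fam K -> connected K.
Hypothesis Fam_card : forall K, Fam K -> 1 < #|K|.

Lemma minor_free_sum (G1 G2 : sgraph) :
  minor_free Fam G1 -> minor_free Fam G2 -> minor_free Fam (graph_sum G1 G2).
Proof.
move=> free1 free2; pose U : {set graph_sum G1 G2} := [set u | if u is inl _ then true else false].
apply: (minor_free_closed_union Fam_connected Fam_card (U := U)).
- by move=> [x|x] [y|y]; rewrite !inE.
- have g (u : induced U) : {x : G1 | val u = inl x}.
    by case: u => -[x|x] /= p; [exists x|exfalso; rewrite inE in p].
  apply: (minor_free_embedding (j := fun u => projT1 (g u))) free1; split=> [u v|u v].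
    by case: (g u) (g v) => [x Ex] [y Ey] /= E; apply: val_inj; rewrite Ex Ey E.
  rewrite {1}/adj /= /induced_adj /=; case: (g u) (g v) => [x Ex] [y Ey] /=.
  by rewrite Ex Ey.
have g (u : induced (~: U)) : {x : G2 | val u = inr x}.
  by case: u => -[x|x] /= p; [exfalso; rewrite !inE in p|exists x].
apply: (minor_free_embedding (j := fun u => projT1 (g u))) free2; split=> [u v|u v].
  by case: (g u) (g v) => [x Ex] [y Ey] /= E; apply: val_inj; rewrite Ex Ey E.
rewrite {1}/adj /= /induced_adj /=; case: (g u) (g v) => [x Ex] [y Ey] /=.
by rewrite Ex Ey.
Qed.

Lemma minor_free_copies (F : sgraph) c : minor_free Fam F ->
  exists Fc : sgraph, [/\ #|Fc| = c * #|F|, arcs Fc = c * arcs F & minor_free Fam Fc].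
Proof.
move=> freeF; elim: c => [|c [Fc [cFc aFc freeFc]]].
  exists (induced (set0 : {set F})); rewrite card_induced cards0 arcs_induced; split=> //.
    by rewrite arcs_betweenE big_set0.
  exact: minor_free_induced.
exists (graph_sum F Fc); rewrite card_graph_sum arcs_graph_sum cFc aFc !mulSn; split=> //.
exact: minor_free_sum.
Qed.

Lemma minor_free_triangle (G : sgraph) : 0 < #|G| -> 2 * #|G| <= arcs G -> minor_free Fam G ->
  minor_free Fam (complete 3).
Proof.
move=> G0 dense free K FK mK; apply: (free K FK).
exact/(minor_trans mK)/has_model_minor/triangle_minor.
Qed.
End FreeFamily.

(** What the exclusion of a subgraph of a star provides: contract P. *)
Definition star_bounded (Fam : graph_family) (t : nat) : Prop :=
  forall G : sgraph, minor_free Fam G -> forall P D : {set G}, P != set0 -> connected_set P ->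
    [disjoint P & D] -> (forall d, d \in D -> exists2 p, p \in P & p -- d) -> #|D| < t.

(** The factor tends to 1, so it cannot lift an integer at most K to the next one. *)
Lemma kappa_bound (R : realType) (d K : nat) : exists Lam : R, forall lam : R, (Lam <= lam)%R ->
  (d%:R < lam)%R /\ forall a b : nat, a <= K ->
    (b%:R <= (lam / (lam - d%:R)) ^+ 2 * a%:R)%R -> b <= a.
Proof.
exists (8 * (d%:R * K%:R) + 2 * d%:R + 1)%R => lam hlam.
have d0 : (0 <= d%:R :> R)%R by rewrite ler0n.
have K0 : (0 <= K%:R :> R)%R by rewrite ler0n.
have dK0 : (0 <= d%:R * K%:R :> R)%R by rewrite mulr_ge0.
have dl : (d%:R < lam)%R by lra.
split=> // a b aK h.
have aR : (a%:R <= K%:R :> R)%R by rewrite ler_nat.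
have a0 : (0 <= a%:R :> R)%R by rewrite ler0n.
suff : (b%:R < a%:R + 1 :> R)%R by rewrite natr1 ltr_nat ltnS.
apply: le_lt_trans h _; have u0 : (0 < lam - d%:R)%R by rewrite subr_gt0.
rewrite expr_div_n mulrAC ltr_pdivrMr ?exprn_gt0 //.
have h1 : (d%:R * a%:R <= d%:R * K%:R :> R)%R by apply: ler_wpM2l.
have lam0 : (0 < lam)%R by lra.
have h2 : (d%:R * a%:R * lam <= d%:R * K%:R * lam)%R by apply: ler_wpM2r => //; apply: ltW.
have h3 : ((8 * (d%:R * K%:R) + 2 * d%:R + 1) * lam <= lam * lam)%R by apply: ler_wpM2r => //; apply: ltW.
have h4 : (0 <= d%:R * d%:R * a%:R :> R)%R by rewrite !mulr_ge0.
move: (d%:R)%R (K%:R)%R (a%:R)%R d0 K0 dK0 dl aR a0 u0 h1 h2 h3 h4 hlam lam0; clear.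
move=> d K a; rewrite !expr2; nra.
Qed.

Lemma card_rel_diff (T : finType) (e1 e2 : rel T) :
  #|[set p : T * T | e2 p.1 p.2]| + #|[set p : T * T | e1 p.1 p.2 && ~~ e2 p.1 p.2]| =
  #|[set p : T * T | e1 p.1 p.2]| + #|[set p : T * T | e2 p.1 p.2 && ~~ e1 p.1 p.2]|.
Proof.
rewrite -!sum1_card ![\sum_(p in _) _]big_mkcond -!big_split /=; apply: eq_bigr => p _.
by rewrite !inE; case: (e1 _ _) (e2 _ _) => [] [].
Qed.

Section LocalOptimality.
Variables (Fam : graph_family) (t : nat).
Hypothesis Fam_connected : forall K, Fam K -> connected K.
Hypothesis Fam_card : forall K, Fam K -> 1 < #|K|.
Hypothesis star : star_bounded Fam t.

Lemma connected_set1 (G : sgraph) (v : G) : connected_set [set v].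
Proof. by move=> a b; rewrite !inE => /eqP-> /eqP->. Qed.

Lemma max_degree_free (G : sgraph) : minor_free Fam G -> max_degree_le G t.
Proof.
move=> free v; apply: ltnW; apply: (star free (P := [set v])).
- by rewrite -cards_eq0 cards1.
- exact: connected_set1.
- by rewrite disjoints1 inE adj_irr.
by move=> d; rewrite inE => vd; exists v; rewrite ?inE.
Qed.

(** A bounded exchange with more edges gained than lost increases the walk
    function. *)
Lemma walk_exchange_le (R : realType) (K : nat) : exists Lam : R, forall lam : R, (Lam <= lam)%R ->
  forall (G : sgraph) (e : rel G) (e_sym : symmetric e) (e_irr : irreflexive e),
  max_degree_le G t.+2 -> max_degree_le (SGraph e_sym e_irr) t.+2 ->
  forall (z1 : G -> R) (z2 : SGraph e_sym e_irr -> R), walk_function lam z1 -> walk_function lam z2 ->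
  (\sum_v z2 v <= \sum_v z1 v)%R ->
  #|[set p : G * G | p.1 -- p.2 & ~~ e p.1 p.2]| <= K ->
  arcs (SGraph e_sym e_irr) <= arcs G.
Proof.
have [Lam LamP] := kappa_bound R t.+2 K; exists Lam => lam hlam.
have [dl kap] := LamP _ hlam.
move=> G e e_sym e_irr deg1 deg2 z1 z2 z1E z2E le_z lostK.
have := walk_exchange deg1 deg2 dl z1E z2E => h.
have {}h : #|[set p : G * G | e p.1 p.2 && ~~ (p.1 -- p.2)]| <=
    #|[set p : G * G | p.1 -- p.2 & ~~ e p.1 p.2]|.
  apply: kap => //; apply: le_trans h _; rewrite gerDr.
  have lam0 : (0 <= lam)%R by apply: le_trans (ltW dl); rewrite ler0n.
  by rewrite mulr_ge0_le0 // subr_le0.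
have h2 : arcs (SGraph e_sym e_irr) + #|[set p : G * G | p.1 -- p.2 & ~~ e p.1 p.2]| =
    arcs G + #|[set p : G * G | e p.1 p.2 && ~~ (p.1 -- p.2)]| := card_rel_diff (@adj G) e.
by rewrite -(leq_add2r #|[set p : G * G | p.1 -- p.2 & ~~ e p.1 p.2]|) h2 leq_add2l.
Qed.

(** The arcs of G that are not inside the complement of J are the ones that an
    exchange on J gives up; K bounds their number. *)
Definition locally_optimal (K : nat) (G : sgraph) : Prop :=
  forall (J : {set G}) (F : sgraph), #|F| = #|J| -> minor_free Fam F ->
    arcs G <= arcs_between (~: J) (~: J) + K ->
    arcs F + arcs_between (~: J) (~: J) <= arcs G.

Lemma arcs_between_card (G : sgraph) (A : {set G}) : arcs_between A A <= arcs G.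
Proof. by rewrite arcsT; apply: arcs_betweenS; apply: subsetT. Qed.

Lemma locally_optimal_walk (R : realType) (K : nat) : exists Lam : R, forall lam : R,
  (Lam <= lam)%R -> forall G, minor_free Fam G -> walk_optimal lam Fam G -> locally_optimal K G.
Proof.
have [Lam1 Lam1P] := walk_exchange_le R K.
exists (Num.max Lam1 (t.+2%:R + 1))%R => lam; rewrite ge_max => /andP[hlam hlam2].
have dl : (t.+2%:R < lam)%R by apply: lt_le_trans hlam2; rewrite ltrDl.
move=> G freeG [z1 z1E opt] J F cF freeF few.
have [F0|F0] := posnP #|F|.
  rewrite [arcs F](_ : _ = 0) ?add0n ?arcs_between_card //.
  by rewrite arcs_sum big_pred0 // => x; have := card0_eq F0 x.
have [g [ginj _]] := ex_injection (esym cF) F0.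
have freeP : minor_free Fam (patch J g) by apply: minor_free_patch.
have degG v : #|@nbr G v| <= t.+2 by apply: leq_trans (max_degree_free freeG v) _; lia.
have degP : max_degree_le (patch J g) t.+2.
  by move=> v; apply: leq_trans (max_degree_free freeP v) _; lia.
have [z2 z2E] := walk_function_exists degP dl.
rewrite -(arcs_patch ginj cF).
apply: (Lam1P _ hlam G _ _ _ degG degP _ _ z1E z2E); first exact: opt.
have h : arcs_between (~: J) (~: J) + #|[set p : G * G | p.1 -- p.2 & ~~ patch_adj J g p.1 p.2]| <= arcs G.
  rewrite /arcs_between -cardsUI [X in _ + X](_ : _ = 0) ?addn0.
    apply/subset_leq_card/subsetP=> p; rewrite !inE => /orP[/and3P[]//|/andP[]//].
  apply/eqP; rewrite cards_eq0; apply/eqP/setP=> -[a b]; rewrite !inE /= /patch_adj /=.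
  by case: (a \in J) (b \in J) => [] []; rewrite ?andbF //= andbT andbA andbb andbN.
move: h few; clear; lia.
Qed.

Lemma locally_optimal_max (K : nat) (G : sgraph) : minor_free Fam G ->
  (forall F : sgraph, #|F| = #|G| -> minor_free Fam F -> arcs F <= arcs G) -> locally_optimal K G.
Proof.
move=> freeG opt J F cF freeF _.
have [F0|F0] := posnP #|F|.
  rewrite [arcs F](_ : _ = 0) ?add0n ?arcs_between_card //.
  by rewrite arcs_sum big_pred0 // => x; have := card0_eq F0 x.
have [g [ginj _]] := ex_injection (esym cF) F0.
by rewrite -(arcs_patch ginj cF); apply: opt => //; apply: minor_free_patch.
Qed.

End LocalOptimality.

(** * Components and long geodesics *)

Definition component (G : sgraph) (x : G) : {set G} := [set y | connect (@adj G) x y].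

Definition grow (G : sgraph) (X : {set G}) : {set G} := X :|: \bigcup_(u in X) nbr u.

Definition ball (G : sgraph) (x : G) (i : nat) : {set G} := iter i (@grow G) [set x].

Lemma adj_connect_sym (G : sgraph) : connect_sym (@adj G).
Proof. by apply: sym_connect_sym => x y; apply: adj_sym. Qed.

Lemma closed_component (G : sgraph) (x : G) : closed_set (component x).
Proof. by move=> y w; rewrite !inE => xy yw; apply: connect_trans xy (connect1 yw). Qed.

Lemma component_sub (G : sgraph) (U : {set G}) x : closed_set U -> x \in U -> component x \subset U.
Proof.
move=> cU xU; apply/subsetP=> y; rewrite inE => /connectP[p].
elim: p x xU => [|w p IHp] x xU /= => [_ -> //|/andP[xw pth]].
by apply: IHp => //; apply: cU xU xw.
Qed.

Lemma component_eq (G : sgraph) (x y : G) : y \in component x -> component y = component x.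
Proof.
rewrite inE => xy; apply/setP=> w; rewrite !inE.
by rewrite (same_connect (@adj_connect_sym G) xy).
Qed.

Lemma growP (G : sgraph) (X : {set G}) y :
  reflect (y \in X \/ exists2 u, u \in X & u -- y) (y \in grow X).
Proof.
rewrite inE; apply: (iffP orP) => [[yX|/bigcupP[u uX]]|[yX|[u uX uy]]]; [by left| |by left|].
  by rewrite inE => uy; right; exists u.
by right; apply/bigcupP; exists u; rewrite ?inE.
Qed.

Lemma card_ball (G : sgraph) t (x : G) i : max_degree_le G t -> #|ball x i| <= t.+1 ^ i.
Proof.
move=> deg; elim: i => [|i IHi]; first by rewrite cards1.
rewrite /ball iterS -/(ball x i) expnS mulSn; apply: leq_trans (leq_card_setU _ _) _.
apply: leq_add => //; apply: leq_trans (_ : \sum_(u in ball x i) #|nbr u| <= _).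
  elim/big_rec2: _ => [|u m X _ le]; first by rewrite cards0.
  by apply: leq_trans (leq_card_setU _ _) _; rewrite leq_add2l.
apply: (@leq_trans (\sum_(u in ball x i) t)); first by apply: leq_sum.
by rewrite sum_nat_const mulnC leq_mul2l IHi orbT.
Qed.

Lemma ball_mono (G : sgraph) (x : G) i j : i <= j -> ball x i \subset ball x j.
Proof.
move/subnK <-; elim: (j - i) => [|k IHk]; first by [].
by rewrite addSn; apply: subset_trans IHk _; apply: subsetUl.
Qed.

Lemma geodesic_to (G : sgraph) (x y : G) i : y \in ball x i -> (forall k, k < i -> y \notin ball x k) ->
  exists f : nat -> G, [/\ f i = y, forall j, j <= i -> f j \in ball x j,
    forall k j, k < j -> j <= i -> f j \notin ball x k & forall j, j < i -> f j -- f j.+1].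
Proof.
elim: i y => [|i IHi] y yi yk.
  by exists (fun=> y); split=> // j; [rewrite leqn0 => /eqP->|case].
have [yi'|[u ui uy]] := growP _ _ yi; first by have := yk i (ltnSn i); rewrite yi'.
have [k ki|f [fi fb fnb fadj]] := IHi u ui.
  apply/negP=> uk; have := yk k.+1; rewrite ltnS ki => /(_ isT) /negP; apply.
  by apply/growP; right; exists u.
exists (fun j => if j <= i then f j else y); split=> [|j|k j|j].
- by rewrite ltnn.
- by case: (leqP j i) => [ji _|ij ji]; [apply: fb|have -> : j = i.+1 by apply/eqP; rewrite eqn_leq ji].
- case: (leqP j i) => [ji kj _|ij kj ji]; first exact: fnb.
  by apply: yk; apply: leq_trans kj ji.
rewrite ltnS => ji; rewrite ji; case: (ltnP j i) => [|ij]; first exact: fadj.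
by have -> : j = i by [apply/eqP; rewrite eqn_leq ji]; rewrite fi.
Qed.

(** Balls grow at most by the factor t + 1; backtracking from a vertex outside the
    ball of radius l yields a geodesic, and geodesics are induced. *)
Lemma long_geodesic (G : sgraph) t (x : G) l : max_degree_le G t -> t.+1 ^ l < #|component x| ->
  exists f : nat -> G, [/\ forall j k, j <= l -> k <= l -> f j = f k -> j = k &
    forall j k, j <= l -> k <= l -> f j -- f k = ((j.+1 == k) || (k.+1 == j))].
Proof.
move=> deg big; have [y yl ynl] : exists2 y, y \in ball x l.+1 & y \notin ball x l.
  apply: contrapT => no; have : component x \subset ball x l.
    apply: component_sub; last by apply: (subsetP (ball_mono x (leq0n l))); rewrite inE.
    move=> u v ul uv; apply: contrapT => nvl; apply: no; exists v; last exact/negP.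
    by apply/growP; right; exists u.
  by move/subset_leq_card; rewrite leqNgt (leq_ltn_trans (card_ball _ _ deg)).
have [k|f [_ fb fnb fadj]] := geodesic_to yl.
  by rewrite ltnS => kl; apply: contra ynl; apply: (subsetP (ball_mono x kl)).
exists f; have far j k : j.+1 < k -> k <= l.+1 -> ~~ (f j -- f k).
  move=> jk kl; apply/negP=> adj; have /negP := fnb j.+1 k jk kl; apply.
  by apply/growP; right; exists (f j) => //; apply: fb; lia.
have inj j k : j < k -> k <= l.+1 -> f j <> f k.
  move=> jk kl E; have /negP := fnb j k jk kl; apply; rewrite -E; apply: fb; lia.
split=> j k jl kl.
  by case: (ltngtP j k) => // [jk|kj] E; [case: (inj j k) => //; lia|case: (inj k j) => //; lia].
apply/idP/idP => [adj|/orP[]/eqP <-]; last 2 first.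
- by apply: fadj.
- by rewrite adj_sym; apply: fadj.
apply: contraTT adj => ne.
have [E|[jk|kj]] : j = k \/ (j.+1 < k \/ k.+1 < j) by move: ne; clear; lia.
- by rewrite E adj_irr.
- exact: far jk (leqW kl).
by rewrite adj_sym; apply: far kj (leqW jl).
Qed.

Section PathGraph.
Variable q : nat.
Definition path_graph_adj : rel 'I_q := [rel i j : 'I_q | (i.+1 == j) || (j.+1 == i)].
Lemma path_graph_adj_sym : symmetric path_graph_adj.
Proof. by move=> i j; rewrite /path_graph_adj /= orbC. Qed.
Lemma path_graph_adj_irr : irreflexive path_graph_adj.
Proof. by move=> i; rewrite /path_graph_adj /= orbb; apply/negbTE; rewrite neq_ltn ltnSn orbT. Qed.
Definition path_graph : sgraph := SGraph path_graph_adj_sym path_graph_adj_irr.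
End PathGraph.

Lemma arcs_between_setT (G : sgraph) (A J : {set G}) :
  arcs_between A setT = arcs_between A J + arcs_between A (~: J).
Proof.
rewrite !arcs_betweenE -big_split /=; apply: eq_bigr => v _.
by rewrite setIT -(cardsID J) -setDE.
Qed.

Lemma arcs_split (G : sgraph) (J : {set G}) :
  arcs G = arcs_between (~: J) (~: J) + (arcs_between J J + 2 * arcs_between J (~: J)).
Proof.
rewrite arcsT (arcs_between_setT _ J) ![arcs_between setT _]arcs_betweenC !(arcs_between_setT _ J).
by rewrite (arcs_betweenC (~: J) J); lia.
Qed.

Section Blocks.
Variables (Fam : graph_family) (t : nat).
Hypothesis Fam_connected : forall K, Fam K -> connected K.
Hypothesis Fam_card : forall K, Fam K -> 1 < #|K|.
Hypothesis star : star_bounded Fam t.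

(** The path is connected, hence has fewer than t outside neighbours. *)
Lemma geodesic_arcs (G : sgraph) (f : nat -> G) l : minor_free Fam G ->
  (forall j k, j <= l -> k <= l -> f j = f k -> j = k) ->
  (forall j k, j <= l -> k <= l -> f j -- f k = ((j.+1 == k) || (k.+1 == j))) ->
  let J := [set f (i : 'I_l) | i in 'I_l] in
  #|J| = l /\ arcs G <= arcs_between (~: J) (~: J) + (2 * l + 2 * (t * t)).
Proof.
move=> free finj fadj J.
have cJ : #|J| = l.
  rewrite card_imset ?card_ord // => i j /finj E; apply: val_inj; apply: E; exact: ltnW.
split=> //; rewrite (arcs_split J) leq_add2l; apply: leq_add.
  rewrite arcs_betweenE mulnC -[X in _ <= X * _]cJ -sum_nat_const; apply: leq_sum => v /imsetP[i _ ->].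
  apply: (@leq_trans #|[set f i.-1; f i.+1]|); last by rewrite cards2; case: (_ == _).
  apply/subset_leq_card/subsetP=> w; rewrite !inE => /andP[+ /imsetP[j _ E]]; rewrite E.
  by rewrite fadj ?(ltnW (ltn_ord _)) // => /orP[]/eqP E'; rewrite -E' ?eqxx ?orbT.
rewrite leq_mul2l /=; have degG := max_degree_free star free.
pose D := [set v | (v \notin J) && [exists p in J, p -- v]].
apply: (@leq_trans (arcs_between D setT)).
  rewrite arcs_betweenC; apply/subset_leq_card/subsetP => -[a b]; rewrite !inE /=.
  case/and3P=> ab aJ bJ; rewrite ab aJ !andbT /=; apply/existsP; exists b.
  by rewrite bJ adj_sym.
apply: leq_trans (arcs_between_le_degree _ _ degG) _; rewrite leq_mul2l; apply/orP; right.
have [l0|l0] := posnP l.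
  suff -> : D = set0 by rewrite cards0.
  apply/setP=> v; rewrite !inE; apply/negbTE/negP=> /andP[_ /existsP[p /andP[]]].
  by case/imsetP=> -[i il]; exfalso; rewrite l0 in il.
apply/ltnW/(star free (P := J)).
- by rewrite -cards_eq0 cJ -lt0n.
- have path_le i j : i <= j -> j < l -> connect (restr J) (f i) (f j).
    move/subnK <-; elim: (j - i) => [|k IHk] lt; first exact: connect0.
    have lt' : k + i < l by apply: ltn_trans lt.
    apply: connect_trans (IHk lt') (connect1 _); rewrite addSn in lt *.
    rewrite /restr /= fadj ?eqxx ?(ltnW lt) ?(ltnW lt') //=.
    by rewrite (imset_f (fun i : 'I_l => f i) (x := Ordinal lt')) //
               (imset_f (fun i : 'I_l => f i) (x := Ordinal lt)).
  have csym : connect_sym (restr J).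
    by apply: sym_connect_sym => a b; rewrite /restr /= adj_sym [(a \in J) && _]andbC.
  move=> u v /imsetP[i _ ->] /imsetP[j _ ->].
  by case: (leqP i j) => ij; [|rewrite csym]; apply: path_le => //; apply: ltnW.
- by rewrite disjoint_subset; apply/subsetP=> v vJ; rewrite !inE negb_and negbK vJ.
by move=> d; rewrite inE => /andP[_ /existsP[p /andP[pJ pd]]]; exists p.
Qed.

(** A long geodesic contains every path, and copies of a graph with more edges than
    vertices eventually beat it together with all edges that leave it. *)
Lemma bounded_components :
  (exists k, ~ minor_free Fam (path_graph k)) \/
  (exists2 F : sgraph, minor_free Fam F & 2 * #|F| < arcs F) ->
  exists M K, forall G, minor_free Fam G -> locally_optimal Fam K G ->
    forall x : G, #|component x| <= M.
Proof.
case=> [[k nfree]|[F freeF dense]].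
  exists (t.+1 ^ k), 0 => G freeG _ x; rewrite leqNgt; apply/negP=> big; apply: nfree.
  have [f [finj fadj]] := long_geodesic (max_degree_free star freeG) big.
  apply: (minor_free_embedding (j := fun i : path_graph k => f i)) freeG.
  split=> [i j /finj E|i j ij]; first by apply: val_inj; apply: E; apply: ltnW.
  by rewrite fadj //; apply: ltnW.
pose c := 2 * (t * t) + 1; pose l := c * #|F|.
have [Fc [cFc aFc freeFc]] := minor_free_copies Fam_connected Fam_card c freeF.
exists (t.+1 ^ l), (2 * l + 2 * (t * t)) => G freeG optG x; rewrite leqNgt; apply/negP=> big.
have [f [finj fadj]] := long_geodesic (max_degree_free star freeG) big.
have [cJ few] := geodesic_arcs freeG finj fadj.
have := optG _ Fc (etrans cFc (esym cJ)) freeFc few.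
set out := arcs_between _ _ in few *; rewrite aFc => h.
have h2 : c * (2 * #|F|).+1 <= c * arcs F by rewrite leq_mul2l dense orbT.
move: h h2 few; rewrite /l mulnS mulnCA; clear; rewrite /c; lia.
Qed.

Lemma cover_components (G : sgraph) (U : {set G}) : closed_set U ->
  cover [set component x | x in U] = U.
Proof.
move=> cU; apply/setP=> y; apply/bigcupP/idP => [[C /imsetP[x xU ->]]|yU].
  exact: (subsetP (component_sub cU xU)).
by exists (component y); [apply: imset_f|rewrite inE connect0].
Qed.

Lemma trivIset_components (G : sgraph) (P : {set {set G}}) :
  (forall C, C \in P -> exists x, C = component x) -> trivIset P.
Proof.
move=> PC; apply/trivIsetP=> A B /PC[x ->] /PC[y ->]; apply: contraR.
by case/pred0Pn=> w /andP[/= wx wy]; rewrite -(component_eq wx) -(component_eq wy).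
Qed.

(** Some component order a occurs at least M times among more than M^2 components. *)
Lemma block_of_components (G : sgraph) (U : {set G}) M : closed_set U ->
  (forall x : G, #|component x| <= M) -> M ^ 3 < #|U| ->
  exists a, 0 < a <= M /\ forall b, b <= M ->
    exists2 V : {set G}, closed_set V /\ V \subset U & #|V| = a * b.
Proof.
move=> cU leM big; pose P := [set component x | x in U].
have PC C : C \in P -> exists2 x, x \in U & C = component x by case/imsetP=> x; exists x.
have cP : M ^ 2 < #|P|.
  rewrite ltnNge; apply/negP=> le; move: big; rewrite ltnNge => /negP; apply.
  rewrite -(cover_components cU); apply: leq_trans (leq_card_cover _) _.
  apply: (@leq_trans (\sum_(C in P) M)).
    by apply: leq_sum => C /PC[x _ ->].
  by rewrite sum_nat_const expnSr leq_mul2r le orbT.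
have [a [a0 aM cPa]] : exists a, [/\ 0 < a, a <= M & M <= #|[set C in P | #|C| == a]|].
  apply: contrapT => no; move: cP; rewrite ltnNge => /negP; apply.
  rewrite -sum1_card (partition_big (fun C : {set G} => inord #|C| : 'I_M.+1) xpredT) //=.
  rewrite big_ord_recl [X in X + _]big1 ?add0n => [|C /andP[CP /eqP]]; last first.
    have [x _ E] := PC _ CP; move/(congr1 val); rewrite /= inordK ?ltnS ?E // => E0.
    by have := cards0_eq E0; move/setP/(_ x); rewrite !inE connect0.
  rewrite -mulnn -[X in _ <= X * _](card_ord M) -sum_nat_const; apply: leq_sum => i _.
  rewrite sum1_card leqNgt; apply/negP=> lt; apply: no; exists i.+1; split=> //.
  apply: leq_trans (ltnW lt) _; apply/subset_leq_card/subsetP=> C.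
  rewrite -topredE /= => /andP[CP /eqP /(congr1 val)]; have [x _ E] := PC _ CP.
  by rewrite /= inordK ?ltnS ?E // inE -E CP => ->; rewrite eqxx.
exists a; split; first by rewrite a0.
move=> b bM; have [Q sQ cQ] := subset_of_card (leq_trans bM cPa).
have QP C : C \in Q -> C \in P /\ #|C| = a.
  by move/(subsetP sQ); rewrite inE => /andP[-> /eqP].
exists (cover Q); first split.
- move=> x y /bigcupP[C CQ xC] xy; apply/bigcupP; exists C => //.
  have [CP _] := QP _ CQ; have [w _ E] := PC _ CP; rewrite E in xC *.
  exact: closed_component xC xy.
- apply/bigcupsP=> C /QP[/PC[x xU ->] _]; exact: component_sub.
have /eqP <- : trivIset Q.
  by apply: trivIset_components => C /QP[/PC[x _ ->] _]; exists x.
rewrite (eq_bigr (fun=> a)) => [|C /QP[]//].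
by rewrite sum_nat_const cQ mulnC.
Qed.

(** Removing the same number of vertices from both graphs, in blocks made of b
    components of order a and of a components of order b, reduces the comparison
    to bounded sets, where local optimality decides. *)
Lemma arcs_eq_of_bounded_components M K (G1 G2 : sgraph) : t * M ^ 3 <= K ->
  minor_free Fam G1 -> minor_free Fam G2 ->
  locally_optimal Fam K G1 -> locally_optimal Fam K G2 ->
  (forall x : G1, #|component x| <= M) -> (forall x : G2, #|component x| <= M) ->
  forall (U1 : {set G1}) (U2 : {set G2}), closed_set U1 -> closed_set U2 -> #|U1| = #|U2| ->
    arcs_between U1 U1 = arcs_between U2 U2.
Proof.
move=> leK free1 free2 opt1 opt2 le1 le2.
have half (G G' : sgraph) (U : {set G}) (U' : {set G'}) : minor_free Fam G -> minor_free Fam G' ->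
    locally_optimal Fam K G -> closed_set U -> #|U| = #|U'| -> #|U| <= M ^ 3 ->
    arcs_between U' U' <= arcs_between U U.
  move=> free free' opt cU cUU' leU.
  have := opt U (induced U'); rewrite card_induced arcs_induced -cUU' => /(_ erefl).
  move=> /(_ (minor_free_induced free')); rewrite (arcs_closed cU) => h.
  rewrite -(leq_add2r (arcs_between (~: U) (~: U))); apply: h.
  rewrite addnC leq_add2l; apply: leq_trans (arcs_between_le_degree _ _ (max_degree_free star free)) _.
  by apply: leq_trans leK; rewrite leq_mul2l leU orbT.
move=> U1; have [n] := ubnP #|U1|; elim: n U1 => // n IHn U1; rewrite ltnS => leUn U2 c1 c2 cU.
have [small|big] := leqP #|U1| (M ^ 3).
  apply/eqP; rewrite eqn_leq; apply/andP; split; apply: half => //; by rewrite -?cU.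
have [a [/andP[a0 aM] blk1]] := block_of_components c1 le1 big.
have [b [/andP[b0 bM] blk2]] : exists b, 0 < b <= M /\ forall b', b' <= M ->
    exists2 V : {set G2}, closed_set V /\ V \subset U2 & #|V| = b * b'.
  by apply: block_of_components; rewrite -?cU.
have [V1 [cV1 sV1] cardV1] := blk1 b bM; have [V2 [cV2 sV2] cardV2] := blk2 a aM.
have cV : #|V1| = #|V2| by rewrite cardV1 cardV2 mulnC.
have leV : #|V1| <= M ^ 3.
  rewrite cardV1 !expnS expn0 muln1 mulnA; apply: (@leq_trans (M * M)); first exact: leq_mul.
  by rewrite leq_pmulr //; apply: leq_trans a0 aM.
have V1_gt0 : 0 < #|V1| by rewrite cardV1 muln_gt0 a0.
rewrite (arcs_between_closed cV1 sV1) (arcs_between_closed cV2 sV2); congr (_ + _).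
  by apply/eqP; rewrite eqn_leq; apply/andP; split; apply: half => //; rewrite -?cV.
apply: IHn.
- by rewrite cardsD (setIidPr sV1); lia.
- exact: closed_setD.
- exact: closed_setD.
by rewrite !cardsD (setIidPr sV1) (setIidPr sV2) cU cV.
Qed.
End Blocks.

(** * Covering components by few paths *)

Definition path_covered (G : sgraph) (U : {set G}) (c : nat) : Prop :=
  exists ps : seq (seq G), [/\ all (sorted (@adj G)) ps, uniq (flatten ps),
    flatten ps =i U & size ps <= c].

Lemma path_coveredU (G : sgraph) (U V : {set G}) c d : [disjoint U & V] ->
  path_covered U c -> path_covered V d -> path_covered (U :|: V) (c + d).
Proof.
move=> dUV [ps [sp up eU szp]] [qs [sq uq eV szq]].
exists (ps ++ qs); rewrite all_cat sp sq flatten_cat size_cat leq_add //; split=> //.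
  rewrite cat_uniq up uq andbT /=; apply/hasPn=> v; rewrite eU eV => vV.
  by rewrite (disjointFl dUV).
by move=> v; rewrite mem_cat eU eV inE.
Qed.

Lemma restr_connect_sym (G : sgraph) (P : {set G}) : connect_sym (restr P).
Proof. by apply: sym_connect_sym => a b; rewrite /restr /= adj_sym [(a \in P) && _]andbC. Qed.

Lemma connected_setU1 (G : sgraph) (P : {set G}) u p : connected_set P -> p \in P -> p -- u ->
  connected_set (u |: P).
Proof.
move=> conP pP pu; have toP a : a \in u |: P -> connect (restr (u |: P)) a p.
  rewrite inE in_set1 => /orP[/eqP ->|aP].
    by apply: connect1; rewrite /restr /= adj_sym pu !inE eqxx pP orbT.
  apply: connect_sub (conP a p aP pP) => b c /and3P[bc bP cP]; apply: connect1.
  by rewrite /restr /= bc !inE bP cP !orbT.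
move=> a b aU bU; apply: connect_trans (toP a aU) _.
by rewrite restr_connect_sym; apply: toP.
Qed.

Lemma perm_rcons_insert (T : eqType) (A p C : seq T) v :
  perm_eq (A ++ rcons p v ++ C) (v :: A ++ p ++ C).
Proof. by apply/seq.permP=> a; rewrite /= !count_cat -cats1 count_cat /=; lia. Qed.

(** Grow the covered set X one vertex at a time; Z collects the last vertices of
    all paths but one. As X minus Z stays connected and sees all of Z, the family
    bounds the size of Z. *)
Lemma path_covered_component (Fam : graph_family) (t : nat) (G : sgraph) (x : G) :
  star_bounded Fam t -> minor_free Fam G -> path_covered (component x) t.
Proof.
move=> star free.
suff grow_cover : forall (X Z : {set G}) (ps : seq (seq G)),
    x \in X -> X \subset component x -> Z \subset X -> x \notin Z ->
    connected_set (X :\: Z) -> (forall z, z \in Z -> exists2 p, p \in X :\: Z & p -- z) ->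
    all (sorted (@adj G)) ps -> uniq (flatten ps) -> flatten ps =i X -> size ps <= #|Z|.+1 ->
    (forall z, z \in Z -> exists q, rcons q z \in ps) -> path_covered (component x) t.
  apply: (grow_cover [set x] set0 [:: [:: x]]) => //=; rewrite ?inE ?sub0set ?setD0 //.
  - by rewrite sub1set inE connect0.
  - exact: connected_set1.
  - by move=> z; rewrite inE.
  - by move=> y; rewrite !inE.
  by move=> z; rewrite inE.
move=> X Z ps; have [n] := ubnP #|component x :\: X|.
elim: n X Z ps => // n IHn X Z ps.
rewrite ltnS => leXn xX sXC sZX xZ conXZ Zadj sps ups eps szps lasts.
have ltZ : #|Z| < t.
  apply: (star _ free (X :\: Z)) => //.
    by apply/set0Pn; exists x; rewrite inE xZ.
  by rewrite -setI_eq0 setIDAC setDIl setDv setI0.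
have [cX|ncX] := pselect (closed_set X).
  exists ps; split=> //; last exact: leq_trans szps ltZ.
  by move=> y; rewrite eps; apply/idP/idP; apply/subsetP => //; apply: component_sub.
have [u [v [uX uv vX]]] : exists u v, [/\ u \in X, u -- v & v \notin X].
  apply: contrapT => no; apply: ncX => u v uX uv; apply: contrapT => vX; apply: no.
  by exists u, v; split=> //; apply/negP.
have vC : v \in component x by apply: closed_component uv; apply: (subsetP sXC).
have vZ : v \notin Z by apply: contra vX => /(subsetP sZX).
have less : #|component x :\: (v |: X)| < n.
  apply: leq_trans leXn; apply/proper_card/properP; split.
    by apply: setDS; apply: subsetUr.
  by exists v; rewrite !inE ?vX ?eqxx //; move: vC; rewrite inE.
have xv : x != v by apply: contraNneq vX => <-.
have sXC' : v |: X \subset component x by rewrite subUset sub1set vC.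
have [uZ|uZ] := boolP (u \in Z); last first.
  have E : (v |: X) :\: (v |: Z) = X :\: Z.
    apply/setP=> y; rewrite !inE; have [->|_] //= := eqVneq y v.
    by rewrite (negbTE vX) andbF.
  apply: (IHn (v |: X) (v |: Z) ([:: v] :: ps)) => //.
  - by rewrite !inE xX orbT.
  - by apply: setUS.
  - by rewrite !inE negb_or xv.
  - by rewrite E.
  - move=> z; rewrite E inE in_set1 => /orP[/eqP->|/Zadj//].
    by exists u => //; rewrite inE uZ.
  - by rewrite /= ups andbT eps.
  - by move=> y; rewrite /= !inE eps.
  - by rewrite /= cardsU1 vZ.
  move=> z; rewrite inE in_set1 => /orP[/eqP->|/lasts[q qps]].
    by exists [::]; rewrite inE eqxx.
  by exists q; rewrite inE qps orbT.
have [q qps] := lasts _ uZ; have uv' : u != v by apply: contraTneq uX => ->.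
have [p0 p0X p0u] := Zadj _ uZ.
have E : (v |: X) :\: (v |: Z :\ u) = u |: (X :\: Z).
  apply/setP=> y; rewrite !inE; have [->|yv] /= := eqVneq y v.
    by rewrite eq_sym (negbTE uv') (negbTE vX) andbF.
  by have [->|yu] /= := eqVneq y u; rewrite ?uX.
case/splitPr: qps sps ups eps szps lasts => ps1 ps2 sps ups eps szps lasts.
have pe : perm_eq (flatten (ps1 ++ rcons (rcons q u) v :: ps2))
    (v :: flatten (ps1 ++ rcons q u :: ps2)).
  by rewrite !flatten_cat /=; apply: perm_rcons_insert.
apply: (IHn (v |: X) (v |: Z :\ u) (ps1 ++ rcons (rcons q u) v :: ps2)) => //.
- by rewrite !inE xX orbT.
- by apply: setUS; apply: subset_trans sZX; apply: subsetDl.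
- by rewrite !inE negb_or xv (negbTE xZ) andbF.
- rewrite E; exact: connected_setU1 conXZ p0X p0u.
- move=> z; rewrite E in_setU1 in_setD1 => /orP[/eqP->|/andP[zu /Zadj[p pX pz]]].
    by exists u => //; rewrite setU11.
  by exists p => //; rewrite in_setU1 pX orbT.
- move: sps; rewrite !all_cat /= => /and3P[-> sq ->]; rewrite andbT /=.
  move: sq; clear -uv; case: q => [|a q] /=; first by rewrite uv.
  by rewrite !rcons_path last_rcons => /andP[-> ->].
- by rewrite (perm_uniq pe) /= ups andbT eps.
- by move=> y; rewrite (perm_mem pe) !inE eps.
- move: szps; rewrite !size_cat /= => szps; rewrite cardsU1 !inE (negbTE vZ) andbF /=.
  by rewrite (cardsD1 u Z) uZ in szps.
move=> z; rewrite in_setU1 in_setD1 => /orP[/eqP->|/andP[zu /lasts[q']]].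
  by exists (rcons q u); rewrite mem_cat inE eqxx orbT.
rewrite mem_cat inE => /orP[q1|/orP[/eqP E'|q2]].
- by exists q'; rewrite mem_cat q1.
- by have := congr1 (last u) E'; rewrite !last_rcons => E2; rewrite E2 eqxx in zu.
by exists q'; rewrite mem_cat inE q2 !orbT.
Qed.

Lemma bad_steps_flatten (G : sgraph) (ps : seq (seq G)) (x : G) : all (sorted (@adj G)) ps ->
  count negb (pairmap (@adj G) x (flatten ps)) <= size ps.
Proof.
elim: ps x => [|p ps IHps] x //= /andP[sp sps]; rewrite pairmap_cat count_cat.
rewrite -[X in _ <= X]add1n; apply: leq_add; last exact: IHps.
case: p sp => [|y p] //= sp; rewrite [X in _ + X](_ : _ = 0) ?addn0; first by case: (_ -- _).
apply/eqP; rewrite eqn0Ngt -has_count; apply/hasPn=> b.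
elim: p y sp => [|w p IHp] y //= /andP[yw sp].
by rewrite inE yw => /orP[/eqP-> //|]; apply: IHp.
Qed.

(** Laying F along the listing of a closed set keeps the edges of the covering
    paths, up to the steps of the listing that are missing in F. *)
Lemma listing_exchange (G F : sgraph) (U : {set G}) (c bb : nat) (h : nat -> F) :
  closed_set U -> path_covered U c -> #|F| = #|U| ->
  (forall i j, i < #|U| -> j < #|U| -> h i = h j -> i = j) ->
  (exists2 Bd : {set 'I_#|U|}, #|Bd| <= bb &
     forall i : 'I_#|U|, 0 < i -> i \notin Bd -> h i.-1 -- h i) ->
  exists g : G -> F, {in U &, injective g} /\
    #|[set p : G * G | p.1 -- p.2 & ~~ patch_adj U g p.1 p.2]| + 2 * (#|U| - c - bb) <=
      arcs_between U U.
Proof.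
move=> cU [ps [sps ups eps szps]] cF hinj [Bd cBd hBd].
set l := flatten ps in ups eps.
have szl : size l = #|U| by rewrite -(card_uniqP ups); apply: eq_card.
pose g v := h (index v l); exists g.
have lU v : v \in U -> index v l < #|U| by rewrite -eps -szl index_mem.
have ginj : {in U &, injective g}.
  move=> u v uU vU /hinj; move=> /(_ (lU _ uU) (lU _ vU)) E.
  by rewrite -(nth_index u (s := l) (x := u)) ?eps // E nth_index ?eps.
split=> //.
set lost := [set p : G * G | p.1 -- p.2 & ~~ patch_adj U g p.1 p.2].
pose AU := [set p : G * G | [&& p.1 -- p.2, p.1 \in U & p.2 \in U]].
have lost_sub : lost \subset AU.
  apply/subsetP=> -[a b]; rewrite !inE /= /patch_adj /= => /andP[ab].
  rewrite ab /=; have -> : (b \in U) = (a \in U).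
    by apply/idP/idP=> [bU|aU]; [apply: cU bU _; rewrite adj_sym|apply: cU aU ab].
  by case: (a \in U).
have [U0|/set0Pn[u0 u0U]] := eqVneq U set0.
  by rewrite [X in X - _ - _](_ : _ = 0) ?muln0 ?addn0 ?subset_leq_card // U0 cards0.
have q0 : 0 < #|U| by apply/card_gt0P; exists u0.
(* starting from the head of the listing makes the step at index 0 a loop, so that
   it is counted as bad *)
pose x0 := nth u0 l 0; pose ad := pairmap (@adj G) x0 l.
have sad : size ad = #|U| by rewrite size_pairmap.
pose S := [set i : 'I_#|U| | nth false ad i].
have cS : #|U| - c <= #|S|.
  have -> : #|S| = count id ad.
    by rewrite -sum1_count (big_nth false) big_mkord sad sum1dep_card cardsE.
  have := count_predC id ad; rewrite sad => <-; rewrite leq_subLR [c + _]addnC leq_add2l.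
  by apply: leq_trans szps; apply: bad_steps_flatten.
have SP (i : 'I_#|U|) : i \in S -> 0 < i /\ nth x0 l i.-1 -- nth x0 l i.
  rewrite inE /ad; case: i => -[|i] /= ilt.
    have e0 : nth x0 l 0 = x0 by apply: set_nth_default; rewrite szl.
    by rewrite (nth_pairmap x0) ?szl //= e0 adj_irr.
  by rewrite (nth_pairmap x0) ?szl.
pose I := S :\: Bd.
have cI : #|U| - c - bb <= #|I|.
  rewrite cardsD leq_subLR; apply: leq_trans cS _; rewrite -leq_subLR.
  apply: leq_trans (leq_sub2l _ _) (leqnn _); apply: leq_trans cBd.
  by apply: subset_leq_card; apply: subsetIr.
pose k1 (i : 'I_#|U|) := (nth x0 l i.-1, nth x0 l i).
pose k2 (i : 'I_#|U|) := (nth x0 l i, nth x0 l i.-1).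
have nthE i j : i < #|U| -> j < #|U| -> nth x0 l i = nth x0 l j -> i = j.
  by move=> ilt jlt /eqP; rewrite nth_uniq ?szl // => /eqP.
have k1inj : {in I &, injective k1}.
  by move=> i j _ _ [_ /nthE E]; apply: val_inj; apply: E; apply: ltn_ord.
have k2inj : {in I &, injective k2}.
  by move=> i j _ _ [/nthE E _]; apply: val_inj; apply: E; apply: ltn_ord.
have Ipos (i : 'I_#|U|) : i \in I -> 0 < i by rewrite inE => /andP[_ /SP[]].
have nthU i : i < #|U| -> nth x0 l i \in U by move=> ilt; rewrite -eps mem_nth ?szl.
have kept (i : 'I_#|U|) : i \in I -> nth x0 l i.-1 -- nth x0 l i /\ patch_adj U g (nth x0 l i.-1) (nth x0 l i).
  rewrite inE => /andP[iB /SP[i0 st]]; split=> //.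
  have ip : i.-1 < #|U| by apply: leq_ltn_trans (leq_pred _) (ltn_ord i).
  by rewrite /patch_adj /= !nthU // /g !index_uniq ?szl //; apply: hBd.
have dk : [disjoint k1 @: I & k2 @: I].
  rewrite disjoint_subset; apply/subsetP=> p /imsetP[i iI ->]; rewrite inE.
  apply/imsetP=> -[j jI [/nthE E1 /nthE E2]].
  have := Ipos _ iI; have := Ipos _ jI; have := ltn_ord i; have := ltn_ord j.
  move: E1 E2; case: i {iI} => i ilt; case: j {jI} => j jlt /=; clear; lia.
have keptS : k1 @: I :|: k2 @: I \subset AU :\: lost.
  have psym := @patch_adj_sym G F U g.
  rewrite subUset; apply/andP; split; apply/subsetP=> p /imsetP[i iI ->];
    have [st pa] := kept i iI; rewrite !inE /= ?st ?pa ?andbF /=;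
    rewrite ?(adj_sym (nth x0 l i)) ?(psym (nth x0 l i)) ?st ?pa ?andbF /= !nthU //;
    exact: leq_ltn_trans (leq_pred _) (ltn_ord i).
rewrite /arcs_between -/AU -(cardsID lost AU) (setIidPr lost_sub) leq_add2l.
apply: leq_trans (subset_leq_card keptS); rewrite cardsU disjoint_setI0 // cards0 subn0.
by rewrite !card_in_imset // addnn -mul2n leq_mul2l cI orbT.
Qed.

(** * Two-regular graphs *)

Definition two_regular (G : sgraph) : Prop := forall v : G, #|nbr v| = 2.

Lemma arcs_two_regular (G : sgraph) : two_regular G -> arcs G = 2 * #|G|.
Proof.
move=> reg; rewrite arcs_sum (eq_bigr (fun=> 2)) => [|v _]; last exact: reg.
by rewrite sum_nat_const mulnC cardT.
Qed.

Lemma arcs_path_graph q : 2 * q <= arcs (path_graph q) + 2.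
Proof.
case: q => [|p]; first by rewrite muln0.
pose k1 (i : 'I_p) : path_graph p.+1 * path_graph p.+1 := (widen_ord (leqnSn p) i, lift ord0 i).
pose k2 (i : 'I_p) : path_graph p.+1 * path_graph p.+1 := (lift ord0 i, widen_ord (leqnSn p) i).
have k1inj : injective k1 by move=> i j [E _]; apply: val_inj.
have k2inj : injective k2 by move=> i j [_ E]; apply: val_inj.
have c1 : #|k1 @: setT| = p by rewrite card_imset // cardsT card_ord.
have c2 : #|k2 @: setT| = p by rewrite card_imset // cardsT card_ord.
have dk : [disjoint k1 @: setT & k2 @: setT].
  rewrite disjoint_subset; apply/subsetP=> x /imsetP[i _ ->]; rewrite inE.
  apply/imsetP=> -[j _ [E1 E2]]; move: E1 E2; case: i => i ilt; case: j => j jlt /=.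
  by rewrite /bump /=; clear; lia.
suff : #|k1 @: setT :|: k2 @: setT| <= arcs (path_graph p.+1).
  by rewrite cardsU disjoint_setI0 // cards0 subn0 c1 c2; lia.
apply/subset_leq_card; rewrite subUset; apply/andP; split; apply/subsetP=> x /imsetP[i _ ->];
  by rewrite inE /= /path_graph_adj /= ?eqxx ?orbT.
Qed.

Section CycleGraph.
Variable T : finType.
Definition cycle_adj : rel T := [rel u v | (u != v) &&
  ((enum_rank v == ordS (enum_rank u)) || (enum_rank u == ordS (enum_rank v)))].
Lemma cycle_adj_sym : symmetric cycle_adj.
Proof. by move=> u v; rewrite /cycle_adj /= eq_sym orbC. Qed.
Lemma cycle_adj_irr : irreflexive cycle_adj.
Proof. by move=> u; rewrite /cycle_adj /= eqxx. Qed.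
Definition cycle_graph : sgraph := SGraph cycle_adj_sym cycle_adj_irr.

Lemma cycle_graph_two_regular : 2 < #|T| -> two_regular cycle_graph.
Proof.
move=> T2 v; pose a := enum_rank (v : T).
have vS (i : 'I_#|T|) : val (ordS i) = i.+1 %% #|T| by [].
have vP (i : 'I_#|T|) : val (ord_pred i) = (i + #|T|).-1 %% #|T| by [].
have SE : (ordS a : nat) = if a.+1 == #|T| then 0 else a.+1.
  rewrite vS; case: eqP => [->|ne]; first by rewrite modnn.
  by rewrite modn_small // ltn_neqAle ltn_ord andbT; apply/eqP.
have PE : (ord_pred a : nat) = if a == 0 :> nat then #|T|.-1 else a.-1.
  rewrite vP; case: eqP => [->|ne]; first by rewrite add0n modn_small // prednK //; lia.
  have lta : (a : nat) < #|T| := ltn_ord a.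
  move: ne lta; move: (nat_of_ord a) => m ne ltm.
  have -> : (m + #|T|).-1 = m.-1 + #|T| by clear -ne; lia.
  rewrite modnDr modn_small //. clear -ltm; lia.
have lta : (a : nat) < #|T| := ltn_ord a.
have aSP : ordS a != ord_pred a.
  apply/eqP=> /(congr1 (@nat_of_ord _)); rewrite SE PE; move: lta T2; clear.
  by case: eqP; case: eqP; lia.
have aS : a != ordS a.
  by apply/eqP=> /(congr1 (@nat_of_ord _)); rewrite SE; move: lta T2; clear; case: eqP; lia.
have aP : a != ord_pred a.
  by apply/eqP=> /(congr1 (@nat_of_ord _)); rewrite PE; move: lta T2; clear; case: eqP; lia.
have -> : nbr (v : cycle_graph) = [set enum_val (ordS a); enum_val (ord_pred a)].
  apply/setP=> w; rewrite !inE /= /cycle_adj /= -(inj_eq enum_rank_inj) -/a.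
  rewrite -(inj_eq enum_rank_inj w) enum_valK -(inj_eq enum_rank_inj w) enum_valK.
  have -> : (a == ordS (enum_rank w)) = (enum_rank w == ord_pred a).
    by apply/eqP/eqP => [->|->]; rewrite ?ordSK ?ord_predK.
  move: (enum_rank w) => b; case: (b =P ordS a) => [->|_]; first by rewrite aS.
  by case: (b =P ord_pred a) => [->|_]; [rewrite aP|rewrite orbF andbF].
by rewrite cards2 (inj_eq enum_val_inj) aSP.
Qed.
End CycleGraph.

Section Triangles.
Variable k : nat.
Definition triangles_adj : rel ('I_k * 'I_3) := [rel u v | (u.1 == v.1) && (u.2 != v.2)].
Lemma triangles_adj_sym : symmetric triangles_adj.
Proof. by move=> u v; rewrite /triangles_adj /= eq_sym [u.2 == _]eq_sym. Qed.
Lemma triangles_adj_irr : irreflexive triangles_adj.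
Proof. by move=> u; rewrite /triangles_adj /= !eqxx. Qed.
Definition triangles : sgraph := SGraph triangles_adj_sym triangles_adj_irr.

Lemma triangles_two_regular : two_regular triangles.
Proof.
move=> [a i]; have -> : nbr ((a, i) : triangles) = [set (a, j) | j in [set~ i]].
  apply/setP=> -[b j]; rewrite !inE /= /triangles_adj /=; apply/andP/imsetP.
    by case=> /eqP -> ij; exists j => //; rewrite !inE eq_sym.
  by case=> j'; rewrite !inE => ij [-> ->]; rewrite eqxx eq_sym.
by rewrite card_imset ?cardsC1 ?card_ord // => x y [].
Qed.
End Triangles.

Section ConnectedClasses.
Variables (Fam : graph_family).
Hypothesis Fam_connected : forall K, Fam K -> connected K.
Hypothesis Fam_card : forall K, Fam K -> 1 < #|K|.

Lemma minor_free_classes (G : sgraph) (cl : G -> nat) : (forall x y, x -- y -> cl x = cl y) ->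
  (forall c, minor_free Fam (induced [set v | cl v == c])) -> minor_free Fam G.
Proof.
have [n] := ubnP #|G|; elim: n G cl => // n IHn G cl; rewrite ltnS => leGn clE freec.
have [G0|/card_gt0P[v _]] := posnP #|G|.
  by apply: (minor_free_edgeless Fam_connected Fam_card) => x; have := card0_eq G0 x.
apply: (minor_free_closed_union Fam_connected Fam_card (U := [set w | cl w == cl v])).
- by move=> x y; rewrite !inE => /eqP <- /clE ->.
- exact: freec.
apply: (IHn (induced (~: [set w | cl w == cl v])) (fun w => cl (val w))) => [||c].
- apply: leq_trans leGn; rewrite card_induced cardsCs setCK -subn_gt0 subKn ?max_card //.
  by apply/card_gt0P; exists v; rewrite inE.
- by move=> x y xy; apply: clE.
set U := ~: _; pose j (w : induced [set w : induced U | cl (val w) == c]) :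
    induced [set w | cl w == c] := exist _ (val (val w)) (eq_ind _ is_true
      (eq_ind _ is_true (valP w) _ (in_set _ _)) _ (esym (in_set _ _))).
apply: (minor_free_embedding (j := j)) (freec c); split=> // x y /(congr1 val) /= E.
by apply/val_inj/val_inj.
Qed.

Lemma minor_free_triangles k : minor_free Fam (complete 3) -> minor_free Fam (triangles k).
Proof.
move=> free3; apply: (@minor_free_classes (triangles k) (fun u => u.1 : nat)).
  by move=> x y /andP[/eqP -> _].
move=> c; set X := [set _ | _].
apply: (@minor_free_embedding Fam (induced X) (complete 3) (fun u => (val u).2)) free3.
split=> [x y E|x y /andP[]//].
have := valP x; have := valP y; rewrite !inE => /eqP Ey /eqP Ex.
apply: val_inj; move: Ex Ey E; case: (val x) (val y) => [a i] [b j] /= Ea Eb ->.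
by congr (_, _); apply: val_inj; rewrite /= Ea Eb.
Qed.
End ConnectedClasses.

(** * Families admitting all paths and at most one cycle per component *)

Section UnicyclicFamily.
Variables (R : realType) (Fam : graph_family) (t : nat).
Hypothesis Fam_connected : forall K, Fam K -> connected K.
Hypothesis Fam_card : forall K, Fam K -> 1 < #|K|.
Hypothesis star : star_bounded Fam t.
Hypothesis paths_free : forall k, minor_free Fam (path_graph k).
Hypothesis sparse : forall F : sgraph, minor_free Fam F -> arcs F <= 2 * #|F|.

Lemma path_covered_le (G : sgraph) (U : {set G}) c d :
  c <= d -> path_covered U c -> path_covered U d.
Proof. by move=> cd [ps [? ? ? le]]; exists ps; split=> //; apply: leq_trans cd. Qed.

Lemma arcs_between_free_le (G : sgraph) (U : {set G}) :
  minor_free Fam G -> arcs_between U U <= 2 * #|U|.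
Proof.
by move=> free; have := sparse (minor_free_induced (S := U) free); rewrite arcs_induced card_induced.
Qed.

Lemma deficient_component (G : sgraph) (U : {set G}) : closed_set U ->
  arcs_between U U < 2 * #|U| -> exists2 x, x \in U &
    arcs_between (component x) (component x) < 2 * #|component x|.
Proof.
have [n] := ubnP #|U|; elim: n U => // n IHn U; rewrite ltnS => leUn cU def.
have [x xU] : exists x, x \in U by apply/card_gt0P; move: def; clear; lia.
have [defx|full] := ltnP (arcs_between (component x) (component x)) (2 * #|component x|).
  by exists x.
have sC := component_sub cU xU; have cC := @closed_component G x.
have cD : #|U| = #|component x| + #|U :\: component x|.
  by rewrite -(cardsID (component x) U) (setIidPr sC).
have C0 : 0 < #|component x| by apply/card_gt0P; exists x; rewrite inE connect0.
have [||y] := IHn (U :\: component x) _ (closed_setD cU cC).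
- by move: leUn cD C0; clear; lia.
- move: def; rewrite (arcs_between_closed cC sC) cD; move: full; clear; lia.
by rewrite inE => /andP[_ yU]; exists y.
Qed.

(** Two missing edges: rearrange the set into one Hamiltonian path. *)
Lemma not_two_deficient : exists Lam : R, forall lam : R, (Lam <= lam)%R ->
  forall G, minor_free Fam G -> walk_optimal lam Fam G ->
  forall U : {set G}, closed_set U -> path_covered U (t + t) -> 2 * #|U| < arcs_between U U + 4.
Proof.
have [Lam1 Lam1P] := walk_exchange_le t R (4 * t).
exists (Num.max Lam1 (t.+2%:R + 1))%R => lam; rewrite ge_max => /andP[hlam hlam2].
have dl : (t.+2%:R < lam)%R by apply: lt_le_trans hlam2; rewrite ltrDl.
move=> G freeG [z1 z1E opt] U cU covU; rewrite ltnNge; apply/negP=> def.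
have q2 : 1 < #|U| by move: def; clear; lia.
pose F := path_graph #|U|; pose i0 : F := Ordinal (ltnW q2).
pose h (i : nat) : F := insubd i0 i.
have hE i : i < #|U| -> h i = i :> nat by move=> ilt; rewrite /h val_insubd ilt.
have [|i j ilt jlt E||g [ginj lost]] := @listing_exchange G F U (t + t) 0 h cU covU _ _ _.
- by rewrite card_ord.
- by rewrite -(hE i ilt) -(hE j jlt) E.
- exists set0 => [|i i0' _]; first by rewrite cards0.
  have ip : i.-1 < #|U| by apply: leq_ltn_trans (leq_pred _) (ltn_ord i).
  by rewrite /= /path_graph_adj /= (hE _ ip) (hE _ (ltn_ord i)) prednK // eqxx.
have freeP : minor_free Fam (patch U g).
  have freeF : minor_free Fam F by exact: paths_free.
  exact (@minor_free_patch _ Fam_connected Fam_card G F U g ginj freeG freeF).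
have degG v : #|@nbr G v| <= t.+2 by apply: leq_trans (max_degree_free star freeG v) _; lia.
have degP : max_degree_le (patch U g) t.+2.
  by move=> v; apply: leq_trans (max_degree_free star freeP v) _; lia.
have [z2 z2E] := walk_function_exists degP dl.
have := Lam1P _ hlam G _ _ _ degG degP _ _ z1E z2E (opt (patch U g) z2 erefl freeP z2E).
rewrite (arcs_patch ginj) ?card_ord // (arcs_closed cU) leq_add2r => h1.
have {h1} le : arcs F <= arcs_between U U.
  by apply: h1; move: lost def; clear; lia.
by move: (arcs_path_graph #|U|) (le) (def) (q2); rewrite -/F; clear; lia.
Qed.

(** The orders of the admissible graphs with as many edges as vertices. *)
Definition saturated_order (q : nat) : Prop :=
  exists F : sgraph, [/\ minor_free Fam F, #|F| = q & arcs F = 2 * q].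

Lemma saturated_orderD p q : saturated_order p -> saturated_order q -> saturated_order (p + q).
Proof.
move=> [F [fF cF aF]] [F' [fF' cF' aF']]; exists (graph_sum F F').
rewrite card_graph_sum arcs_graph_sum cF cF' aF aF' mulnDr; split=> //.
exact: minor_free_sum.
Qed.

(** When the order 3 is saturated, only the residue of an order modulo 3 matters
    beyond a bound. *)
Lemma saturated_residues : exists B, forall q, saturated_order q ->
  exists b, [/\ b <= B, saturated_order b & b = q %[mod 3]].
Proof.
have res r : exists b, forall q, saturated_order q -> q %% 3 = r ->
    saturated_order b /\ b %% 3 = r.
  have [[b [sb br]]|no] := pselect (exists b, saturated_order b /\ b %% 3 = r); first by exists b.
  by exists 0 => q sq qr; case: no; exists q.
have [b0 P0] := res 0; have [b1 P1] := res 1; have [b2 P2] := res 2.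
exists (b0 + b1 + b2) => q sq; have := ltn_pmod q (isT : 0 < 3).
case E : (q %% 3) => [|[|[|//]]] _.
- by have [sb br] := P0 q sq E; exists b0; split=> //; lia.
- by have [sb br] := P1 q sq E; exists b1; split=> //; lia.
- by have [sb br] := P2 q sq E; exists b2; split=> //; lia.
Qed.

(** Components are added one at a time, each with its own t paths. *)
Lemma covered_superset (G : sgraph) (x : G) j : minor_free Fam G -> j <= #|G| ->
  exists U : {set G}, [/\ closed_set U, component x \subset U, j <= #|U| & path_covered U (j.+1 * t)].
Proof.
move=> freeG; elim: j => [|j IHj] lej.
  exists (component x); split=> //; first exact: closed_component.
  by rewrite mul1n; apply: path_covered_component star freeG.
have [U [cU sU jU covU]] := IHj (ltnW lej).
have [E|/subsetPn[y _ yU]] := boolP ([set: G] \subset U).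
  exists U; split=> //; last by apply: path_covered_le covU; rewrite leq_mul2r leqnSn orbT.
  by apply: leq_trans lej _; rewrite -(cardsT G) subset_leq_card.
have dUC : [disjoint U & component y].
  rewrite disjoint_sym disjoints_subset; apply: component_sub; first exact: closed_setC.
  by rewrite inE.
exists (U :|: component y); split.
- by apply: closed_setU => //; apply: closed_component.
- by apply: subset_trans sU _; apply: subsetUl.
- rewrite cardsU (disjoint_setI0 dUC) cards0 subn0 -addn1; apply: leq_add => //.
  by apply/card_gt0P; exists y; rewrite inE connect0.
rewrite mulSnr; apply: path_coveredU => //.
exact: path_covered_component star freeG.
Qed.

Section RegularPart.
Variables (lam : R) (H : sgraph) (X : {set H}).
Hypothesis lam2 : (2 < lam)%R.
Hypotheses (closX : closed_set X) (regX : forall v, v \in X -> #|nbr v| = 2).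

(** The constant c = lam / (lam - 2) solves lam c = lam + 2 c. *)
Definition constant_on (z : H -> R) (v : H) : R := if v \in X then (lam / (lam - 2))%R else z v.

Lemma walk_function_regular_part (z : H -> R) :
  (forall v, v \notin X -> lam * z v = lam + nbr_sum z v)%R -> walk_function lam (constant_on z).
Proof.
move=> zE v; have [vX|vX] := boolP (v \in X).
  have -> : nbr_sum (constant_on z) v = (lam / (lam - 2) *+ 2)%R.
    rewrite /nbr_sum (eq_bigr (fun=> (lam / (lam - 2))%R)) => [|w vw].
      by rewrite sumr_const -(regX vX); congr (_ *+ _)%R; apply: eq_card => w; rewrite inE.
    by rewrite /constant_on (closX vX vw).
  rewrite /constant_on vX -mulr_natr; field.
  by rewrite gt_eqF // subr_gt0.
have -> : nbr_sum (constant_on z) v = nbr_sum z v.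
  apply: eq_bigr => w vw; rewrite /constant_on; case: ifP => // wX.
  by rewrite (closX wX (y := v)) // adj_sym in vX.
by rewrite /constant_on (negbTE vX) zE.
Qed.
End RegularPart.

Lemma card_nbr_patch (G F : sgraph) (J : {set G}) (g : G -> F) : {in J &, injective g} ->
  #|F| = #|J| -> forall v : patch J g, v \in J -> #|nbr v| = #|nbr (g v)|.
Proof.
move=> ginj cF v vJ; rewrite -(card_in_imset (f := g)) => [|a b]; last first.
  rewrite !inE /= /patch_adj /= vJ /=; case: ifP => // aJ _; case: ifP => // bJ _.
  exact: ginj.
apply: eq_card => u; apply/imsetP/idP => [[w]|].
  by rewrite !inE /= /patch_adj /= vJ /=; case: ifP => // wJ uw ->.
rewrite inE => vu; have : u \in g @: J.
  have -> : g @: J = setT by apply/eqP; rewrite eqEcard subsetT card_in_imset // cardsT cF /=.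
  by rewrite inE.
by case/imsetP=> w wJ E; exists w => //; rewrite inE /= /patch_adj /= vJ wJ -E.
Qed.

Lemma card_nbr_inl (G1 G2 : sgraph) (x : G1) : #|nbr (inl x : graph_sum G1 G2)| = #|nbr x|.
Proof.
rewrite -(card_imset (nbr x) (@inl_inj G1 G2)); apply: eq_card => -[y|y]; rewrite inE /=.
  by rewrite mem_imset ?inE //; apply: inl_inj.
by apply/esym/imsetP=> -[].
Qed.

(** One missing edge: rearrange the set into one long cycle and a bounded
    unicyclic remainder. The long cycle need not be admissible, but it has the
    same walk function as a disjoint union of triangles. *)
Lemma not_one_deficient (B : nat) : exists Lam : R, forall lam : R, (Lam <= lam)%R ->
  forall G, minor_free Fam G -> walk_optimal lam Fam G -> minor_free Fam (complete 3) ->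
  forall U : {set G}, closed_set U -> path_covered U (B.+1 * t) ->
  forall b k, saturated_order b -> b <= B -> #|U| = b + k * 3 -> 2 * #|U| <= arcs_between U U.
Proof.
have [Lam1 Lam1P] := walk_exchange_le t R (2 * (B.+1 * t + B)).
exists (Num.max Lam1 (t.+2%:R + 1))%R => lam; rewrite ge_max => /andP[hlam hlam2].
have dl : (t.+2%:R < lam)%R by apply: lt_le_trans hlam2; rewrite ltrDl.
have lam2 : (2 < lam)%R by apply: le_lt_trans dl; rewrite ler_nat.
move=> G freeG [z1 z1E opt] free3 U cU covU b k [Fb [freeFb cFb aFb]] bB cardU.
rewrite leqNgt; apply/negP=> def; have U0 : 0 < #|U| by move: def; clear; lia.
pose T : finType := ('I_k * 'I_3)%type.
have cT : #|T| = k * 3 by rewrite card_prod !card_ord.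
pose F1 := graph_sum (cycle_graph T) Fb; pose F2 := graph_sum (triangles k) Fb.
have cCT : #|cycle_graph T| = k * 3 := cT.
have cF1 : #|F1| = #|U| by rewrite card_graph_sum cFb cCT cardU addnC.
have [s0 _] : exists s0 : F1, true.
  by have /card_gt0P[s0 _] : 0 < #|F1| by [rewrite cF1]; exists s0.
pose eT : seq T := enum T; pose eF : seq Fb := enum Fb.
pose enumF1 : seq F1 := map inl eT ++ map inr eF.
have szT : size eT = k * 3 by rewrite -cardE.
have szF1 : size enumF1 = #|U|.
  by rewrite size_cat [size (map inl _)]size_map [size (map inr _)]size_map szT /eF -cardE cFb cardU addnC.
have uniqF1 : uniq enumF1.
  rewrite cat_uniq; apply/and3P; split.
  - by rewrite map_inj_uniq ?enum_uniq // => ? ? [].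
  - by apply/hasPn=> ? /mapP[v _ ->]; apply/mapP=> -[].
  by rewrite map_inj_uniq ?enum_uniq // => ? ? [].
pose h i := nth s0 enumF1 i.
have hinl i : i < k * 3 -> exists2 u : T, h i = inl u & enum_rank u = i :> nat.
  move=> ilt; have iT : i < #|T| by rewrite cT.
  exists (enum_val (Ordinal iT)); last by rewrite enum_valK.
  rewrite /h /enumF1 nth_cat size_map szT ilt (nth_map (enum_val (Ordinal iT))) ?szT //.
  by congr inl; rewrite [RHS](enum_val_nth (enum_val (Ordinal iT))).
have hinj i j : i < #|U| -> j < #|U| -> h i = h j -> i = j.
  by move=> ilt jlt /eqP; rewrite nth_uniq ?szF1 // => /eqP.
have [|g [ginj lost]] := @listing_exchange G F1 U (B.+1 * t) B h cU covU cF1 hinj.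
  exists [set i : 'I_#|U| | k * 3 <= i].
    apply: leq_trans bB; rewrite -(card_ord b) -cardsT.
    have lt_b (i : 'I_#|U|) : k * 3 <= i -> i - k * 3 < b.
      move=> le; have : i < b + k * 3 by rewrite -cardU.
      by move: le; clear; lia.
    have [b0|b0] := posnP b.
      rewrite cardsT card_ord b0 leqn0 cards_eq0; apply/eqP/setP=> i; rewrite !inE.
      by apply/negbTE/negP=> /lt_b; rewrite b0.
    pose f (i : 'I_#|U|) : 'I_b := insubd (Ordinal b0) (i - k * 3).
    have finj : {in [set i : 'I_#|U| | k * 3 <= i] &, injective f}.
      move=> i j; rewrite !inE => ki kj /(congr1 val); rewrite !val_insubd !lt_b // => E.
      by apply: val_inj; rewrite /= -(subnK ki) E subnK.
    by rewrite -(card_in_imset finj); apply: subset_leq_card; apply: subsetT.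
  move=> i i0; rewrite inE -ltnNge => ilt.
  have ip : i.-1 < k * 3 by apply: leq_ltn_trans (leq_pred _) ilt.
  have [u -> ru] := hinl _ ip; have [v -> rv] := hinl _ ilt.
  rewrite /= /cycle_adj /=; have uv : u != v.
    apply/eqP=> E; move: rv; rewrite -E ru => E2.
    by move: i0 E2; case: (nat_of_ord i) => //= m _; clear; lia.
  rewrite uv; apply/orP; left; apply/eqP/val_inj; rewrite /= rv ru prednK //.
  by rewrite modn_small // cT.
pose g2 : G -> F2 := g; pose P1 := patch (F := F1) U g; pose P2 := patch (F := F2) U g2.
have freeP2 : minor_free Fam P2.
  have freeF2 : minor_free Fam F2.
    apply: minor_free_sum => //; exact: minor_free_triangles.
  exact (@minor_free_patch _ Fam_connected Fam_card G F2 U g2 ginj freeG freeF2).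
pose X : {set G} := [set v | (v \in U) && (if g v is inl _ then true else false)].
have gsurj (u : F1) : exists2 v, v \in U & g v = u.
  have : u \in g @: U.
    have -> : g @: U = setT by apply/eqP; rewrite eqEcard subsetT card_in_imset // cardsT cF1 /=.
    by rewrite inE.
  by case/imsetP=> v vU ->; exists v.
have T3 (u : T) : 2 < #|T|.
  by have : 0 < #|T| by [apply/card_gt0P; exists u]; rewrite cT; clear; lia.
have regP1 (v : P1) : v \in X -> #|nbr v| = 2.
  rewrite inE => /andP[vU]; case E : (g v) => [u|//] _.
  rewrite (@card_nbr_patch G F1 U g ginj cF1 v vU) E.
  by rewrite (@card_nbr_inl (cycle_graph T) Fb u) (cycle_graph_two_regular (T3 u)).
have regP2 (v : P2) : v \in X -> #|nbr v| = 2.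
  rewrite inE => /andP[vU]; case E : (g v) => [u|//] _.
  rewrite (@card_nbr_patch G F2 U g2 ginj cF1 v vU) /g2 E.
  by rewrite (@card_nbr_inl (triangles k) Fb u) triangles_two_regular.
have closX1 : closed_set (X : {set P1}).
  move=> v w; rewrite !inE => /andP[vU]; case E : (g v) => [u|//] _.
  by rewrite /= /patch_adj /= vU /=; case: ifP => wU; rewrite // E; case: (g w).
have closX2 : closed_set (X : {set P2}).
  move=> v w; rewrite !inE => /andP[vU]; case E : (g v) => [u|//] _.
  by rewrite /= /patch_adj /= vU /=; case: ifP => wU; rewrite // /g2 E; case: (g w).
have same v w : v \notin X -> @adj P1 v w = @adj P2 v w.
  rewrite inE /= /patch_adj /= /g2; case: (v \in U) => //=; case: (w \in U) => //=.
  by case: (g v) => // u _; case: (g w).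
have degG v : #|@nbr G v| <= t.+2 by apply: leq_trans (max_degree_free star freeG v) _; lia.
have degP2 : max_degree_le P2 t.+2.
  by move=> v; apply: leq_trans (max_degree_free star freeP2 v) _; lia.
have degP1 : max_degree_le P1 t.+2.
  move=> v; have [vX|vX] := boolP (v \in X); first by rewrite regP1.
  apply: leq_trans (degP2 v); apply/subset_leq_card/subsetP=> w; rewrite !inE.
  by have := same v w vX => /= ->.
have [z2 z2E] := walk_function_exists degP2 dl.
have zc2 : walk_function lam (constant_on lam X z2 : P2 -> R).
  by apply: (walk_function_regular_part lam2 closX2 regP2) => v _.
have zc1 : walk_function lam (constant_on lam X z2 : P1 -> R).
  apply: (walk_function_regular_part (H := P1) lam2 closX1 regP1) => v vX.
  rewrite [LHS](z2E v); congr (_ + _)%R; apply: eq_bigl => w.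
  by have := same v w vX => /= ->.
have := Lam1P _ hlam G _ _ _ degG degP1 _ _ z1E zc1 (opt P2 _ erefl freeP2 zc2).
have -> : arcs P1 = arcs F1 + arcs_between (~: U) (~: U) by apply: arcs_patch.
rewrite (arcs_closed cU) leq_add2r => h1.
have {h1} le : arcs F1 <= arcs_between U U.
  by apply: h1; move: lost def; clear; lia.
have aF1 : arcs F1 = 2 * #|U|.
  rewrite arcs_graph_sum aFb cardU mulnDr addnC; congr (_ + _).
  have [k0|/card_gt0P[u _]] := posnP #|T|.
    by rewrite arcs_sum big_pred0 => [|u]; [rewrite -cT k0|have := card0_eq k0 u].
  by rewrite (arcs_two_regular (cycle_graph_two_regular (T3 u))) cCT.
by move: le def; rewrite aF1; clear; lia.
Qed.
End UnicyclicFamily.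

(** * Walk-optimal graphs have the maximum number of edges *)

Section EdgeExtremality.
Variables (R : realType) (Fam : graph_family) (t : nat).
Hypothesis Fam_connected : forall K, Fam K -> connected K.
Hypothesis Fam_card : forall K, Fam K -> 1 < #|K|.
Hypothesis star : star_bounded Fam t.

Definition eventually_edge_extremal : Prop := exists (Lam : R) (m0 : nat),
  forall lam : R, (Lam <= lam)%R -> forall G, minor_free Fam G -> walk_optimal lam Fam G ->
  m0 <= #|G| -> forall F : sgraph, #|F| = #|G| -> minor_free Fam F -> arcs F <= arcs G.

Lemma arcs_between_double (G : sgraph) (U : {set G}) : exists e, arcs_between U U = 2 * e.
Proof. by exists #|edges (induced U)|; rewrite -arcs_edges arcs_induced. Qed.

(** By parity the defect 2 |U| - arcs is even on closed sets. One or two components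
    of total defect 4 contradict [not_two_deficient], so a non-extremal graph has
    one deficient component, of defect 2, and its competitor has defect 0. Then the
    order of G and the orders of the other components are saturated, which fixes
    the residue that [not_one_deficient] needs. *)
Lemma edge_extremal_unicyclic : (forall k, minor_free Fam (path_graph k)) ->
  (forall F : sgraph, minor_free Fam F -> arcs F <= 2 * #|F|) -> eventually_edge_extremal.
Proof.
move=> paths_free sparse.
have [B resB] := saturated_residues Fam.
have [Lam1 two] := not_two_deficient R Fam_connected Fam_card star paths_free.
have [Lam2 one] := not_one_deficient R Fam_connected Fam_card star B.
exists (Num.max Lam1 Lam2), B => lam; rewrite ge_max => /andP[hlam1 hlam2].
move=> G freeG optG leBG F cF freeF; rewrite leqNgt; apply/negP=> ltGF.
have {}two := two lam hlam1 G freeG optG; have {}one := one lam hlam2 G freeG optG.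
have arcsF := sparse F freeF; rewrite cF in arcsF.
have defG : arcs_between [set: G] setT < 2 * #|[set: G]|.
  by rewrite -arcsT cardsT; apply: leq_trans arcsF.
have [x _ defx] := deficient_component (fun _ _ _ _ => in_setT _) defG.
have cover1 y : path_covered (component (y : G)) t by apply: path_covered_component star freeG.
set C := component x in defx; have cC : closed_set C by apply: closed_component.
have arcsC : arcs_between C C + 2 = 2 * #|C|.
  have := two C cC (path_covered_le (leq_addl t t) (cover1 x)).
  have [e Ee] := arcs_between_double C; move: defx; rewrite Ee; clear; lia.
have full (W : {set G}) : closed_set W -> W \subset ~: C -> arcs_between W W = 2 * #|W|.
  move=> cW sWC; apply/eqP; rewrite eqn_leq (arcs_between_free_le sparse _ freeG) leqNgt /=.
  apply/negP=> defW; have [y yW defy] := deficient_component cW defW.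
  have sy := subset_trans (component_sub cW yW) sWC.
  have dCy : [disjoint C & component y] by rewrite disjoint_sym disjoints_subset.
  have cU := closed_setU cC (@closed_component G y).
  have := two _ cU (path_coveredU dCy (cover1 x) (cover1 y)).
  rewrite (arcs_between_closed cC (subsetUl _ _)) cardsU (disjoint_setI0 dCy) cards0 subn0.
  have -> : (C :|: component y) :\: C = component y.
    by rewrite setDUl setDv set0U; apply/setDidPl; rewrite disjoint_sym.
  have [e Ee] := arcs_between_double (component y).
  by move: defy arcsC; rewrite Ee; clear; lia.
have [U [cU sCU BU covU]] := covered_superset star x freeG leBG.
pose W := ~: U; have cW : closed_set W by apply: closed_setC.
have arcsW : arcs_between W W = 2 * #|W| by apply: full => //; rewrite setCS.
have cardU : #|U| = #|C| + #|U :\: C| by rewrite -(cardsID C U) (setIidPr sCU).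
have arcsU : arcs_between U U + 2 = 2 * #|U|.
  rewrite (arcs_between_closed cC sCU) (full _ (closed_setD cU cC)); last first.
    by apply/subsetP=> y; rewrite !inE => /andP[].
  by rewrite cardU; move: arcsC; clear; lia.
have cardG : #|G| = #|U| + #|W| by rewrite cardsC.
have arcsG : arcs G + 2 = 2 * #|G|.
  by rewrite (arcs_closed cU) -/W arcsW cardG; move: arcsU; clear; lia.
have satF : arcs F = 2 * #|G|.
  by move: ltGF arcsF arcsG; rewrite (arcs_edges F) (arcs_edges G); clear; lia.
have satG : saturated_order Fam #|G| by exists F.
have satW : saturated_order Fam #|W|.
  exists (induced W); rewrite card_induced arcs_induced; split=> //; exact: minor_free_induced.
have [b [bB satb bmod]] := resB _ (saturated_orderD Fam_connected Fam_card satG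
  (saturated_orderD Fam_connected Fam_card satW satW)).
have Ub : #|U| = b + (#|U| - b) %/ 3 * 3.
  by move: bmod BU bB; rewrite cardG; clear; lia.
have G0 : 0 < #|F| by rewrite cF; move: arcsG; clear; lia.
have free3 : minor_free Fam (complete 3).
  by apply: minor_free_triangle freeF => //; rewrite satF cF.
have := one free3 U cU covU b _ satb bB Ub; move: arcsU; clear; lia.
Qed.

Lemma locally_optimal_le K K' G : K <= K' -> locally_optimal Fam K' G -> locally_optimal Fam K G.
Proof.
move=> le opt J F cF freeF few; apply: opt => //; apply: leq_trans few _.
by rewrite leq_add2l.
Qed.

Lemma ex_arcs_max (G : sgraph) : minor_free Fam G -> exists G2 : sgraph,
  [/\ #|G2| = #|G|, minor_free Fam G2 &
      forall F : sgraph, #|F| = #|G| -> minor_free Fam F -> arcs F <= arcs G2].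
Proof.
move=> freeG; suff: forall n (G1 : sgraph), #|G1| = #|G| -> minor_free Fam G1 ->
    #|G| ^ 2 - arcs G1 < n -> exists G2 : sgraph, [/\ #|G2| = #|G|, minor_free Fam G2 &
      forall F : sgraph, #|F| = #|G| -> minor_free Fam F -> arcs F <= arcs G2].
  by move=> /(_ _ G erefl freeG (ltnSn _)).
elim=> // n IHn G1 c1 free1 le1.
have [[F [cF freeF lt]]|no] := pselect (exists F : sgraph,
    [/\ #|F| = #|G|, minor_free Fam F & arcs G1 < arcs F]); last first.
  exists G1; split=> // F cF freeF; rewrite leqNgt; apply/negP=> lt; apply: no.
  by exists F.
apply: (IHn F cF freeF); have : arcs F <= #|G| ^ 2.
  by rewrite -cF -mulnn -card_prod max_card.
by move: le1 lt; clear; lia.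
Qed.

Lemma edge_extremal_walk_optimal : eventually_edge_extremal.
Proof.
have [bounded|unbounded] := pselect ((exists k, ~ minor_free Fam (path_graph k)) \/
    (exists2 F : sgraph, minor_free Fam F & 2 * #|F| < arcs F)); last first.
  apply: edge_extremal_unicyclic => [k|F freeF].
    by apply: contrapT => no; apply: unbounded; left; exists k.
  by rewrite leqNgt; apply/negP=> lt; apply: unbounded; right; exists F.
have [M [K comps]] := bounded_components Fam_connected Fam_card star bounded.
pose K' := K + t * M ^ 3.
have [Lam LamP] := locally_optimal_walk Fam_connected Fam_card star R K'.
exists Lam, 0 => lam hlam G freeG optG _ F cF freeF.
have locG := LamP lam hlam G freeG optG.
have [G2 [cG2 free2 max2]] := ex_arcs_max freeG.
apply: leq_trans (max2 F cF freeF) _.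
have loc2 : locally_optimal Fam K' G2.
  apply: locally_optimal_max => // F' cF' freeF'; apply: max2 => //; by rewrite cF'.
have KK' : K <= K' by apply: leq_addr.
rewrite !arcsT; apply/eq_leq/esym.
apply: (arcs_eq_of_bounded_components (K := K') star _ freeG free2 locG loc2).
- exact: leq_addl.
- by apply: comps => //; apply: locally_optimal_le locG.
- by apply: comps => //; apply: locally_optimal_le loc2.
- by [].
- by [].
by rewrite !cardsT.
Qed.

End EdgeExtremality.

Theorem theorem1p3 (R : realType) (HH : graph_family) :
  (exists H, HH H) ->
  (forall H, HH H -> 1 <= min_degree H) ->
  (forall H, HH H -> forall t : nat, ~ iso H (star t)) ->
  exists N : nat, forall n : nat, N <= n ->
    forall Gs : sgraph, SPEX R n HH Gs ->
      (forall K, Gamma_family HH K -> connected K) ->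
      EX (n - gamma_family HH) (Gamma_family HH)
         (induced (~: dominating Gs)%SET).
Proof.
move=> HH_ex HH_deg HH_star.
have [conn|nconn] := pselect (forall K, Gamma_family HH K -> connected K); last first.
  by exists 0 => n _ Gs _ conn; case: nconn.
set s := gamma_family HH.
have [t star_t] := Gamma_star_bound HH_ex HH_deg HH_star.
have card_Gamma := @Gamma_family_card HH HH_ex HH_deg HH_star.
have [Lam [m0 extremal]] := edge_extremal_walk_optimal R conn card_Gamma star_t.
have [n0 dom] := @extremal_dominating R HH HH_ex HH_deg HH_star conn.
have s0 : 0 < s := gamma_family_gt0 HH_ex HH_deg HH_star.
have [n1 n1P] := @ex_nat_ge R (Lam ^+ 2)%R (sqr_ge0 Lam).
exists (n0 + (n1 + m0 + s).+1) => n le_n Gs spexG _.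
have [n_0 n_1 n_m n_s] : [/\ n0 <= n, n1 <= n - s, m0 <= n - s & s < n].
  by split; move: le_n; clear; lia.
have cD := dom n n_0 Gs spexG; have [cG freeG _] := spexG.
set G' := induced _; have cG' : #|G'| = n - s by rewrite card_induced cardsCs setCK cD cG.
have domP l v : l \in dominating Gs -> v != l -> l -- v.
  by rewrite inE => /forallP/(_ v)/implyP.
have freeG' : minor_free (Gamma_family HH) G'.
  apply: (Gamma_free_join HH_ex HH_deg HH_star cD _ _ _ freeG).
  - by rewrite disjoints_subset setCK.
  - by move=> l b lD; rewrite inE => bD; apply: domP => //; apply: contraNneq bD => ->.
  - by left=> l l' lD _ ll'; apply: domP; rewrite // eq_sym.
have [rho0 rho2] := spectral_radius_extremal HH_ex HH_deg HH_star conn n_s spexG.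
have optG' := extremal_walk_optimal HH_ex HH_deg HH_star conn n_s spexG cD.
have hlam : (Lam <= spectral_radius R Gs)%R.
  have [Lam0|Lam0] := lerP Lam 0; first exact: le_trans Lam0 (ltW rho0).
  rewrite -(ler_pXn2r (n := 2)) ?nnegrE ?(ltW rho0) ?(ltW Lam0) //.
  apply: le_trans rho2; apply: le_trans n1P _; rewrite -natrB ?(ltnW n_s) // -natrM ler_nat.
  by apply: leq_trans n_1 _; rewrite leq_pmull.
split=> [|//|F cF freeF]; first exact: cG'.
have := extremal _ hlam G' freeG' optG' _ F _ freeF; rewrite cG' => /(_ n_m cF).
by rewrite !arcs_edges leq_pmul2l.
Qed.
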